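(* Let $\vec G$ be an orientation of the Coxeter diagram $s_0\overset{4}{-}s_1-\cdots-s_{n-1}$ of $B_n$ and let $Q(\vec G)$ be a centrally symmetric polygon as described below. Then the Cambrian lattice $\mathcal C(\vec G)$ is isomorphic to the partial order on centrally symmetric triangulations of $Q(\vec G)$ whose cover relations are diameter flips or symmetric pairs of diagonal flips, where going up in a cover relation corresponds to increasing the slope of the diameter or of each diagonal being flipped.
   Context: $B_n$: signed permutations with generators $s_0=(-1\ 1)$, $s_i=(i\ i{+}1)(-i{-}1\ {-i})$; weak order $v\le w$ iff $I(v)\subseteq I(w)$ ($I(w)$ the reflections $t$ with $\ell(tw)<\ell(w)$). $\Theta(\vec G)$: smallest lattice congruence of the weak order with $t$ congruent to the element with word $tsts\cdots$ of $m(s,t)-1$ letters for each directed edge $s\to t$ ($m(s_0,s_1)=4$, otherwise $3$); $\mathcal C(\vec G)$ is the quotient. Up/down: for $b\in[n-1]$, $b$ is up if $s_b\to s_{b-1}$ and down if $s_{b-1}\to s_b$; $n$ is declared up or down arbitrarily; $-b$ is down iff $b$ is up. $Q(\vec G)$: convex $(2n+2)$-gon with vertices $v_i$, $i\in\{\pm1,\dots,\pm(n+1)\}$, $v_{-i}=-v_i$, $x$-coordinates strictly increasing in the order $-n-1<\dots<-1<1<\dots<n+1$, $v_{\pm(n+1)}$ on the $x$-axis, $v_i$ above the axis iff $i$ up; slopes measured in these coordinates. A diagonal joins non-adjacent vertices; a diameter is a diagonal $v_iv_{-i}$; a centrally symmetric triangulation is a triangulation invariant under $v\mapsto-v$; a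 diagonal flip replaces a diagonal by the other diagonal of the quadrilateral formed by removing it. *)

(* Defs.v *)
From HB Require Import structures.
From mathcomp Require Import all_boot all_order fingroup perm all_algebra.
From Stdlib Require Import Relations.
Set Implicit Arguments. Unset Strict Implicit. Unset Printing Implicit Defensive.
Import Order.TTheory GRing.Theory Num.Theory.

(* Coxeter side: B_n as signed permutations of {+-1,...,+-n}.          *)
(* The label (false, i) stands for i+1 and (true, i) for -(i+1).       *)

Definition negl n (x : bool * 'I_n) : bool * 'I_n := (~~ x.1, x.2).

Definition signedperms n : {set {perm bool * 'I_n}} :=
  [set w : {perm bool * 'I_n} | [forall x, w (negl x) == negl (w x)]].

Definition predord n (k : 'I_n) : 'I_n :=
  Ordinal (leq_ltn_trans (leq_pred k) (ltn_ord k)).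

(* gen k = s_k :  s_0 = (-1 1),  s_j = (j j+1)(-j-1 -j)  for j >= 1 *)
Definition gen n (k : 'I_n) : {perm bool * 'I_n} :=
  if val k == 0 then tperm (false, k) (true, k)
  else (tperm (false, predord k) (false, k) * tperm (true, predord k) (true, k))%g.

Definition gens n : {set {perm bool * 'I_n}} := [set gen k | k : 'I_n].

Definition gpow n (k : nat) : {set {perm bool * 'I_n}} :=
  iter k (fun A => (A * gens n)%g) [set 1%g].

Definition len n (w : {perm bool * 'I_n}) : nat :=
  find (fun k => w \in gpow n k) (iota 0 #|{perm bool * 'I_n}|).

Definition refls n : {set {perm bool * 'I_n}} :=
  [set (s ^ w)%g | s in gens n, w in signedperms n].

Definition invs n (w : {perm bool * 'I_n}) : {set {perm bool * 'I_n}} :=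
  [set t in refls n | len (t * w)%g < len w].

Definition weak_le n (v w : {perm bool * 'I_n}) : bool := invs v \subset invs w.

Definition is_meet n (x z m : {perm bool * 'I_n}) : Prop :=
  m \in signedperms n /\ weak_le m x /\ weak_le m z /\
  forall u, u \in signedperms n -> weak_le u x -> weak_le u z -> weak_le u m.

Definition is_join n (x z m : {perm bool * 'I_n}) : Prop :=
  m \in signedperms n /\ weak_le x m /\ weak_le z m /\
  forall u, u \in signedperms n -> weak_le x u -> weak_le z u -> weak_le m u.

Definition lattice_congruence n (Rl : {perm bool * 'I_n} -> {perm bool * 'I_n} -> Prop) : Prop :=
  (forall x, x \in signedperms n -> Rl x x) /\
  (forall x y, x \in signedperms n -> y \in signedperms n -> Rl x y -> Rl y x) /\
  (forall x y z, x \in signedperms n -> y \in signedperms n -> z \in signedperms n ->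
      Rl x y -> Rl y z -> Rl x z) /\
  (forall x y z m m', x \in signedperms n -> y \in signedperms n -> z \in signedperms n ->
      Rl x y -> is_meet x z m -> is_meet y z m' -> Rl m m') /\
  (forall x y z m m', x \in signedperms n -> y \in signedperms n -> z \in signedperms n ->
      Rl x y -> is_join x z m -> is_join y z m' -> Rl m m').

(* Orientation of the diagram s_0 -4- s_1 - ... - s_{n-1}:
   for 1 <= b <= n-1, o b = true  means  s_b -> s_{b-1},
                      o b = false means  s_{b-1} -> s_b.
   For the directed edge s -> t (edge {s_{b-1}, s_b}, k = b), the pair
   (t, tsts... with m(s,t)-1 letters). *)
Definition camb_pair n (o : nat -> bool) (k : 'I_n) :
    {perm bool * 'I_n} * {perm bool * 'I_n} :=
  let s := if o (val k) then gen k else gen (predord k) in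
  let t := if o (val k) then gen (predord k) else gen k in
  (t, if val k == 1 then (t * s * t)%g else (t * s)%g).

Definition Theta n (o : nat -> bool) (x y : {perm bool * 'I_n}) : Prop :=
  forall Rl, lattice_congruence Rl ->
    (forall k : 'I_n, 0 < val k -> Rl (camb_pair o k).1 (camb_pair o k).2) ->
    Rl x y.

(* order of the quotient C(G) = weak order / Theta(G), expressed on
   representatives: [x] <= [y] iff x' <= y' for some x' in [x], y' in [y] *)
Definition camb_le n (o : nat -> bool) (x y : {perm bool * 'I_n}) : Prop :=
  exists x' y', [/\ x' \in signedperms n, y' \in signedperms n,
                    Theta o x x', Theta o y y' & weak_le x' y'].

(* Polygon side: vertices v_i, i in {+-1, ..., +-(n+1)};               *)
(* (false, i) stands for v_{i+1} and (true, i) for v_{-(i+1)}.         *)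

Definition vneg n (v : bool * 'I_n.+1) : bool * 'I_n.+1 := (~~ v.1, v.2).

Definition vlab n (v : bool * 'I_n.+1) : int :=
  if v.1 then (- Posz (val v.2).+1)%R else Posz (val v.2).+1.

(* up/down labels: b in [n-1] up iff s_b -> s_{b-1} (o b = true);
   n up iff upn; -b up iff b down *)
Definition vup n (o : nat -> bool) (upn : bool) (v : bool * 'I_n.+1) : bool :=
  let u := if (val v.2).+1 < n then o (val v.2).+1 else upn in
  if v.1 then ~~ u else u.

Section Geometry.
Variables (R : realFieldType) (n : nat) (px py : bool * 'I_n.+1 -> R).
Local Open Scope ring_scope.

Definition orient (a b c : bool * 'I_n.+1) : R :=
  (px b - px a) * (py c - py a) - (py b - py a) * (px c - px a).

Definition in_closed_tri (a b c d : bool * 'I_n.+1) : bool :=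
  ((0 <= orient a b d) && (0 <= orient b c d) && (0 <= orient c a d)) ||
  ((orient a b d <= 0) && (orient b c d <= 0) && (orient c a d <= 0)).

Definition convex_pos : Prop :=
  forall a b c d, uniq [:: a; b; c; d] -> ~~ in_closed_tri a b c d.

Definition pedge (a b : bool * 'I_n.+1) : bool :=
  (a != b) &&
  ([forall c, ((c != a) && (c != b)) ==> (0 < orient a b c)] ||
   [forall c, ((c != a) && (c != b)) ==> (orient a b c < 0)]).

Definition is_diag (D : {set bool * 'I_n.+1}) : bool :=
  [exists a, exists b, [&& a != b, ~~ pedge a b & D == [set a; b]]].

Definition is_diameter (D : {set bool * 'I_n.+1}) : bool :=
  [exists a, D == [set a; vneg a]].

Definition crossing (a b c d : bool * 'I_n.+1) : bool :=
  (orient a b c * orient a b d < 0) && (orient c d a * orient c d b < 0).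

Definition dcross (D E : {set bool * 'I_n.+1}) : bool :=
  [exists a, exists b, exists c, exists d,
    [&& D == [set a; b], E == [set c; d] & crossing a b c d]].

Definition is_triang (T : {set {set bool * 'I_n.+1}}) : bool :=
  [&& [forall D in T, is_diag D],
      [forall D in T, forall E in T, ~~ dcross D E] &
      [forall D, (is_diag D && (D \notin T)) ==> [exists E in T, dcross D E]]].

Definition cs_triang (T : {set {set bool * 'I_n.+1}}) : bool :=
  is_triang T && ([set (@vneg n) @: D | D : {set bool * 'I_n.+1} in T] == T).

Definition slope (a b : bool * 'I_n.+1) : R := (py b - py a) / (px b - px a).

Definition dflip (T : {set {set bool * 'I_n.+1}}) (a b c d : bool * 'I_n.+1)
    (T' : {set {set bool * 'I_n.+1}}) : bool :=
  [&& [set a; b] \in T, T' == (T :\ [set a; b]) :|: [set [set c; d]],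
      [set c; d] != [set a; b] & is_triang T'].

Definition upflip (T T' : {set {set bool * 'I_n.+1}}) : Prop :=
  cs_triang T /\ cs_triang T' /\
  exists a b c d, slope a b < slope c d /\
   ((is_diameter [set a; b] /\ dflip T a b c d T') \/
    (~~ is_diameter [set a; b] /\
     exists T1, dflip T a b c d T1 /\
                dflip T1 (vneg a) (vneg b) (vneg c) (vneg d) T' /\
                slope (vneg a) (vneg b) < slope (vneg c) (vneg d))).

Definition tri_le : {set {set bool * 'I_n.+1}} -> {set {set bool * 'I_n.+1}} -> Prop :=
  clos_refl_trans _ upflip.

Definition tri_cover (T T' : {set {set bool * 'I_n.+1}}) : Prop :=
  T <> T' /\ tri_le T T' /\
  forall U, tri_le T U -> tri_le U T' -> U = T \/ U = T'.

End Geometry.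

(* Main.v *)
(* A signed permutation w is read as the order [bef w] in which the labels occur
   in the one-line notation of w^-1. Every initial segment P of that order cuts
   out a path from v_{-n-1} to v_{n+1} through the up vertices in P and the down
   vertices outside P, and the paths sweep out a triangulation [diags w]: the
   diagonal pq belongs to it iff the labels in [inA p q] (up ends of pq and down
   labels between them) all occur before those in [inB p q] (down ends, up labels
   between them).

   Fibres: the inversion set of the bottom element [pd w] of the fibre of w is
   an explicit monotone function of that of w, so the fibres of [diags] are the
   classes of a lattice congruence, which contracts the generators of Theta.
   Conversely a cover swapping a < c stays in its fibre iff some b between a and
   c is on the path at that moment, and any congruence containing the generators
   contracts all these covers, by induction on c - a through hexagons and
   octagons of the weak order. The other covers are flips of a diameter or of a
   symmetric pair, and two crossing diagonals are ordered by slope as the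
   violated pair of labels is; this matches quotient order and flip order. *)
Require Import Defs.
From HB Require Import structures.
From Stdlib Require Import Relations.
From mathcomp Require Import all_boot all_order fingroup perm all_algebra.
From mathcomp Require Import zify ring lra.
Set Implicit Arguments. Unset Strict Implicit. Unset Printing Implicit Defensive.
Import Order.TTheory GRing.Theory Num.Theory.

(** * Labels and signed permutations *)

(** A cover exchanging a and c need not border a polygon of the weak order that involves a suitable
    third label, so the induction on c - a cannot be applied to it directly. A congruence, however,
    treats comparable covers exchanging the same a and c alike. The cover is therefore first pushed
    up to a maximal one, where any two labels standing in increasing order enclose a and c or their
    mirror images. This constrains the other labels so much that the cover, or one below it obtained
    by moving a single label and its negative, borders a hexagon or an octagon usable by the
    induction. Octagons arise when the third label is -a or -c, and when c = -a.

    The flip order is only a transitive closure, so it is not obvious that a flip is a cover of it.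
    Slopes show that a flip goes up in the quotient; then a weak-order cover just under the bottom
    element of the upper fibre is shown to start in the lower fibre, which leaves no room in
    between. *)

Section Labels.
Variable n : nat.
Implicit Types x y : bool * 'I_n.

(* At [n.+1] instead of [n] this is the label [vlab] of a polygon vertex. *)
Definition lab x : int :=
  if x.1 then (- Posz (val x.2).+1)%R else Posz (val x.2).+1.

Lemma neglK : involutive (@negl n).
Proof. by case=> s i; rewrite /negl /= negbK. Qed.

Lemma lab_neg x : lab (negl x) = (- lab x)%R.
Proof. by case: x => [[] i]; rewrite /lab /= ?opprK. Qed.

Lemma lab_inj : injective lab.
Proof.
case=> s i [t j]; rewrite /lab /=.
by case: s; case: t => /= h; congr pair; try apply: val_inj => /=; lia.
Qed.

Lemma lab_neq0 x : lab x != 0%R.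
Proof. by case: x => [[] i]; rewrite /lab /=; lia. Qed.

Lemma lab_bound x : (- n%:Z <= lab x <= n%:Z)%R.
Proof. by case: x => [[] i]; rewrite /lab /=; have := ltn_ord i; lia. Qed.

Lemma lab_ex (z : int) : z != 0%R -> (- n%:Z <= z <= n%:Z)%R -> exists x, lab x = z.
Proof.
move=> z0 zn; case: (ltrP 0%R z) => hz.
  have h : (`|z|.-1 < n)%N by lia.
  by exists (false, Ordinal h); rewrite /lab /=; lia.
have h : (`|z|.-1 < n)%N by lia.
by exists (true, Ordinal h); rewrite /lab /=; lia.
Qed.

Lemma lab_eq x y : (x == y) = (lab x == lab y).
Proof. by rewrite (inj_eq lab_inj). Qed.

Lemma negl_neq x : negl x != x.
Proof. by rewrite lab_eq lab_neg; have := lab_neq0 x; lia. Qed.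

Lemma negl_inj : injective (@negl n).
Proof. exact: inv_inj neglK. Qed.

(* Consecutive labels: 0 is skipped. *)
Definition nxt (i j : int) : bool :=
  ((j == i + 1) && (i != -1) || (i == -1) && (j == 1))%R.

End Labels.

Section Signed.
Variable n : nat.
Notation L := (bool * 'I_n)%type.
Implicit Types (w v u : {perm L}) (a c x y : L) (k : 'I_n).

Lemma signedP w : reflect (forall x, w (negl x) = negl (w x)) (w \in signedperms n).
Proof. by rewrite inE; apply: (iffP forallP) => h x; apply/eqP. Qed.

Lemma signed1 : (1%g : {perm L}) \in signedperms n.
Proof. by apply/signedP => x; rewrite !perm1. Qed.

Lemma signedM v w :
  v \in signedperms n -> w \in signedperms n -> (v * w)%g \in signedperms n.
Proof. by move=> /signedP hv /signedP hw; apply/signedP => x; rewrite !permM hv hw. Qed.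

Lemma signedV v : v \in signedperms n -> (v^-1)%g \in signedperms n.
Proof.
move=> /signedP hv; apply/signedP => x; apply: (@perm_inj _ v).
by rewrite hv !permKV.
Qed.

(** When c = -a the transpositions of a, c and of -a, -c coincide and their product would be the
    identity, hence the separate case. *)
Definition rf a c : {perm L} :=
  if c == negl a then tperm a c else (tperm a c * tperm (negl a) (negl c))%g.

Lemma rfE a c x : a != c ->
  rf a c x = if x == a then c else if x == c then a
             else if x == negl a then negl c else if x == negl c then negl a else x.
Proof.
rewrite /rf => ac.
case: eqP => [->|/eqP cna].
  rewrite neglK; case: tpermP => [->|->|/eqP/negbTE h1 /eqP/negbTE h2]; rewrite ?eqxx //.
    by rewrite (negbTE (negl_neq a)).
  by rewrite h1 h2.
have acn : a != negl c by apply: contraNneq cna => ->; rewrite neglK.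
have nca : negl a != c by rewrite eq_sym.
have nac : negl c != a by rewrite eq_sym.
rewrite permM; case: (tpermP a c) => [->|->|/eqP/negbTE h1 /eqP/negbTE h2]; rewrite ?eqxx.
- by rewrite tpermD // negl_neq.
- by rewrite eq_sym (negbTE ac) tpermD // negl_neq.
by rewrite h1 h2; case: tpermP => [->|->|/eqP/negbTE -> /eqP/negbTE ->] //;
   rewrite ?eqxx // (inj_eq (@negl_inj n)) [c == a]eq_sym (negbTE ac).
Qed.

Lemma rf_signed a c : a != c -> rf a c \in signedperms n.
Proof.
move=> ac; apply/signedP => x; apply: lab_inj; rewrite !rfE //.
move: ac (lab_neq0 a) (lab_neq0 c); rewrite !lab_eq !(lab_neg, fun_if (@negl n), fun_if (@lab n)).
by move: (lab a) (lab c) (lab x) => A C X; do ![case: ifP]; lia.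
Qed.

Lemma rfK a c : a != c -> (rf a c * rf a c = 1)%g.
Proof.
move=> ac; apply/permP => x; rewrite permM perm1.
apply: lab_inj; rewrite !rfE //.
move: ac (lab_neq0 a) (lab_neq0 c); rewrite !lab_eq !(lab_neg, fun_if (@lab n)).
by move: (lab a) (lab c) (lab x) => A C X; do ![case: ifP]; lia.
Qed.

Lemma rfJ a c w : w \in signedperms n -> (rf a c ^ w)%g = rf (w a) (w c).
Proof.
move=> /signedP hw; rewrite /rf -hw (inj_eq perm_inj).
by case: ifP => _; rewrite ?conjMg !tpermJ ?hw.
Qed.

Lemma rfN a c : a != c -> rf (negl c) (negl a) = rf a c.
Proof.
move=> ac; apply/permP => x; apply: lab_inj.
have ac' : negl c != negl a by rewrite (inj_eq (@negl_inj n)) eq_sym.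
rewrite !rfE //.
move: ac ac' (lab_neq0 a) (lab_neq0 c); rewrite !lab_eq !(lab_neg, fun_if (@lab n)).
by move: (lab a) (lab c) (lab x) => A C X; do ![case: ifP]; lia.
Qed.

(* [gen k] exchanges the neighbouring values [glo k] and [ghi k]. *)
Definition glo k : L := if val k == 0 then (true, k) else (false, predord k).
Definition ghi k : L := (false, k).

Lemma lab_glo k : lab (glo k) = if val k == 0 then (-1)%R else Posz (val k).
Proof. by rewrite /glo /lab; case: eqP => /= h; lia. Qed.

Lemma lab_ghi k : lab (ghi k) = Posz (val k).+1.
Proof. by []. Qed.

Lemma glo_ghi k : (lab (glo k) < lab (ghi k))%R.
Proof. by rewrite lab_glo lab_ghi; case: ifP => _; lia. Qed.

Lemma glo_neq k : glo k != ghi k.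
Proof. by rewrite lab_eq; have := glo_ghi k; lia. Qed.

Lemma genE k : gen k = rf (glo k) (ghi k).
Proof.
rewrite /gen /rf; case: ifP => h.
  by rewrite /glo h /ghi /negl /= eqxx tpermC.
by rewrite /glo h.
Qed.

Lemma gen_signed k : gen k \in signedperms n.
Proof. by rewrite genE rf_signed // glo_neq. Qed.

Lemma genK k : (gen k * gen k = 1)%g.
Proof. by rewrite genE rfK // glo_neq. Qed.

Lemma gen_lt k x y :
  (lab (gen k x) < lab (gen k y))%R = (lab x < lab y)%R (+)
    [|| (x == glo k) && (y == ghi k), (y == glo k) && (x == ghi k),
        (x == negl (ghi k)) && (y == negl (glo k)) |
        (y == negl (ghi k)) && (x == negl (glo k))].
Proof.
rewrite genE !rfE ?glo_neq //.
move: (lab_glo k) (lab_ghi k) (lab_neq0 x) (lab_neq0 y); move: (glo k) (ghi k) => p q.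
rewrite !lab_eq !(lab_neg, fun_if (@negl n), fun_if (@lab n)).
case: (val k) => [|m] /=; move: (lab x) (lab y) (lab p) (lab q) => X Y P Q -> ->;
by do ![case: ifP]; lia.
Qed.

Lemma nxtP x y : nxt (lab x) (lab y) ->
  exists k, (x = glo k /\ y = ghi k) \/ (x = negl (ghi k) /\ y = negl (glo k)).
Proof.
move=> h; have := lab_bound x; have := lab_bound y; have := lab_neq0 x; have := lab_neq0 y.
move: h; rewrite /nxt; case: (ltrP 0%R (lab y)) => hy h ny nx yb xb.
  have hk : (`|lab y|.-1 < n)%N by lia.
  exists (Ordinal hk); left; split; apply: lab_inj; rewrite ?lab_glo ?lab_ghi /=; try case: ifP; lia.
have hk : (`|lab x|.-1 < n)%N by lia.
by exists (Ordinal hk); right; split; apply: lab_inj;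
   rewrite lab_neg ?lab_glo ?lab_ghi /=; try case: ifP; lia.
Qed.

(* Positions are values of w: x precedes y in the one-line notation of w^-1. *)
Definition bef w x y : bool := (lab (w x) < lab (w y))%R.

Definition ivs w : {set L * L} := [set p | (lab p.1 < lab p.2)%R && bef w p.2 p.1].

Lemma in_ivs w a c : ((a, c) \in ivs w) = (lab a < lab c)%R && bef w c a.
Proof. by rewrite inE. Qed.

Lemma bef_irr w x : bef w x x = false.
Proof. by rewrite /bef ltxx. Qed.

Lemma bef_trans w : transitive (bef w).
Proof. by move=> y x z; apply: lt_trans. Qed.

Lemma bef_total w x y : x != y -> ~~ bef w x y = bef w y x.
Proof.
rewrite -(inj_eq (@perm_inj _ w)) lab_eq /bef; lia.
Qed.

Lemma bef_asym w x y : bef w x y -> bef w y x = false.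
Proof. by rewrite /bef; lia. Qed.

Lemma bef_neg w x y : w \in signedperms n -> bef w (negl x) (negl y) = bef w y x.
Proof. by move=> /signedP h; rewrite /bef !h !lab_neg; lia. Qed.

Lemma ivs_neg w a c : w \in signedperms n ->
  ((negl c, negl a) \in ivs w) = ((a, c) \in ivs w).
Proof. by move=> h; rewrite !in_ivs bef_neg // !lab_neg; congr andb; lia. Qed.

(** An increasing bijection of a finite total order preserves the number of smaller elements. *)
Lemma perm_mono1 w : (forall x y, (lab x < lab y)%R -> bef w x y) -> w = 1%g.
Proof.
move=> h; apply/permP => x; rewrite perm1.
have h2 y z : bef w y z = (lab y < lab z)%R.
  case: (ltrP (lab y) (lab z)) => [/h //|].
  by rewrite le_eqVlt -lab_eq => /orP[/eqP -> | /h]; rewrite ?bef_irr // => /bef_asym.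
pose r (z : L) := #|[set y : L | (lab y < lab z)%R]|.
have r_lt y z : (lab y < lab z)%R -> (r y < r z)%N.
  move=> yz; apply: proper_card; apply/properP; split.
    by apply/subsetP => t; rewrite !inE => ty; lia.
  by exists y; rewrite !inE ?ltxx.
have rE z : r (w z) = r z.
  rewrite /r -(card_imset [set y : L | (lab y < lab z)%R] (@perm_inj _ w)).
  apply: eq_card => y; rewrite inE; apply/idP/imsetP => [hy|[t ht ->]].
    by exists ((w^-1)%g y); rewrite ?permKV // inE -h2 /bef permKV.
  by move: ht; rewrite inE -h2.
apply: lab_inj; case: (ltgtP (lab (w x)) (lab x)) => // /r_lt; rewrite rE; lia.
Qed.

(** One implication is enough, because it makes [v^-1 * w] increasing. *)
Lemma bef_inj v w : (forall x y, bef v x y -> bef w x y) -> v = w.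
Proof.
move=> h; have : (v^-1 * w)%g = 1%g.
  apply: perm_mono1 => x y xy; rewrite /bef !permM; apply: h.
  by rewrite /bef !permKV.
by move=> e; rewrite -[w]mul1g -(mulgV v) -mulgA e mulg1.
Qed.

Lemma ivs_inj v w : ivs v = ivs w -> v = w.
Proof.
move=> h; apply: bef_inj => x y vxy.
have nxy : x != y by apply: contraTneq vxy => ->; rewrite bef_irr.
case: (ltgtP (lab x) (lab y)) => [xy|yx|/lab_inj e]; last by rewrite e eqxx in nxy.
  have : (x, y) \notin ivs v by rewrite in_ivs xy /= (bef_asym vxy).
  by rewrite h in_ivs xy /= bef_total // eq_sym.
have : (y, x) \in ivs v by rewrite in_ivs yx vxy.
by rewrite h in_ivs => /andP[].
Qed.

(** The pairs [glo k], [ghi k] and their negatives are all the pairs of consecutive labels; the rest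
    is transitivity. *)
Lemma signed_mono w : w \in signedperms n ->
  (forall k, bef w (glo k) (ghi k)) -> forall x y, (lab x < lab y)%R -> bef w x y.
Proof.
move=> sw hk.
have step x y : nxt (lab x) (lab y) -> bef w x y.
  by move=> /nxtP[k [[-> ->]|[-> ->]]]; rewrite ?bef_neg.
suff main m x y : (lab x < lab y)%R -> (lab y - lab x <= m%:Z)%R -> bef w x y.
  by move=> x y xy; apply: (main `|(lab y - lab x)%R|%N) => //; lia.
elim: m x y => [|m IH] x y xy hm; first by lia.
have [z zE] : exists z : L, lab z = (if lab x == -1 then 1 else lab x + 1)%R.
  by apply: lab_ex; have := lab_bound x; have := lab_bound y;
     have := lab_neq0 x; have := lab_neq0 y; case: ifP; lia.
have xz : bef w x z by apply: step; rewrite zE /nxt; case: ifP; lia.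
case: (eqVneq z y) => [<- //|]; rewrite lab_eq => zy.
apply: (bef_trans xz); apply: IH; move: zE; case: ifP;
  have := lab_neq0 y; lia.
Qed.

Lemma signed_descent w : w \in signedperms n -> w != 1%g -> exists k, bef w (ghi k) (glo k).
Proof.
move=> sw w1; case: (boolP [exists k, bef w (ghi k) (glo k)]) => [/existsP //|].
rewrite negb_exists => /forallP h; case/eqP: w1; apply: perm_mono1.
apply: signed_mono => // k; have := h k; rewrite bef_total // eq_sym glo_neq //.
Qed.

End Signed.

(** * Covers, joins and meets of the weak order *)

Section Covers.
Variable n : nat.
Notation L := (bool * 'I_n)%type.
Implicit Types (w v u x y : {perm L}) (a c e f : L) (k : 'I_n).

Definition wle v w : bool := ivs v \subset ivs w.

Lemma wleP v w :
  reflect (forall a c, (lab a < lab c)%R -> bef v c a -> bef w c a) (wle v w).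
Proof.
apply: (iffP subsetP) => h => [a c ac vca|[a c]].
  by have := h (a, c); rewrite !in_ivs ac vca => /(_ isT) /andP[].
by rewrite !in_ivs => /andP[ac /(h _ _ ac)]; rewrite ac.
Qed.

Lemma wle_refl w : wle w w.
Proof. exact: subxx. Qed.

Lemma wle_trans v u w : wle u v -> wle v w -> wle u w.
Proof. exact: subset_trans. Qed.

Lemma wle_anti v w : wle v w -> wle w v -> v = w.
Proof. by move=> h1 h2; apply: ivs_inj; apply/eqP; rewrite eqEsubset; apply/andP. Qed.

Definition swp a c e f : bool :=
  [|| (e == a) && (f == c), (e == c) && (f == a),
      (e == negl c) && (f == negl a) | (e == negl a) && (f == negl c)].

Lemma swpC a c e f : swp a c f e = swp a c e f.
Proof. by rewrite /swp; do ![case: eqP => //=]. Qed.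

Lemma swp_negl a c e f : swp (negl c) (negl a) e f = swp a c e f.
Proof. by rewrite /swp !neglK; do ![case: eqP => //=]. Qed.

(* y is obtained from x by exchanging the neighbouring entries a < c, and -c, -a. *)
Definition cov x y a c : Prop :=
  [/\ x \in signedperms n, y \in signedperms n, (lab a < lab c)%R, bef x a c &
      forall e f, bef y e f = bef x e f (+) swp a c e f].

Lemma cov_gen x k : x \in signedperms n ->
  (lab ((x^-1)%g (glo k)) < lab ((x^-1)%g (ghi k)))%R ->
  cov x (x * gen k)%g ((x^-1)%g (glo k)) ((x^-1)%g (ghi k)).
Proof.
move=> sx h; split => //; first by rewrite signedM ?gen_signed.
  by rewrite /bef !permKV glo_ghi.
have /signedP sx' := signedV sx.
move=> e f; rewrite /bef !permM gen_lt /swp; congr (_ (+) _).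
have eP e' f' : (e' == (x^-1)%g f') = (x e' == f').
  by rewrite (can2_eq (permK x) (permKV x)).
by rewrite -!sx' !eP; do ![case: eqP => //=].
Qed.

Lemma cov_neg x y a c : cov x y a c -> cov x y (negl c) (negl a).
Proof.
case=> sx sy ac xac h; split => //; first by rewrite !lab_neg; lia.
  by rewrite bef_neg.
by move=> e f; rewrite h swp_negl.
Qed.

Lemma cov_bef x y a c : cov x y a c -> bef y c a.
Proof.
case=> sx sy ac xac h; rewrite h (bef_asym xac) /swp !eqxx.
by rewrite !(orbT, orTb).
Qed.

Lemma swp_lab a c e f : swp a c e f = [|| (lab e == lab a) && (lab f == lab c),
   (lab e == lab c) && (lab f == lab a),
   (lab e == - lab c)%R && (lab f == - lab a)%R |
   (lab e == - lab a)%R && (lab f == - lab c)%R].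
Proof. by rewrite /swp !lab_eq !lab_neg. Qed.

(** If e stood between a and c, y would still have a before e and e before c, although it has c
    before a. *)
Lemma cov_adj x y a c e : cov x y a c -> bef x a e -> bef x e c = false.
Proof.
case=> sx sy ac xac h xae; apply/negP => xec.
have nea : lab e != lab a by rewrite -lab_eq; apply: contraTneq xae => ->; rewrite bef_irr.
have nec : lab e != lab c by rewrite -lab_eq; apply: contraTneq xec => ->; rewrite bef_irr.
have /negbTE s1 : ~~ swp a c a e.
  by rewrite swp_lab; move: nea nec (lab_neq0 a); clear; lia.
have /negbTE s2 : ~~ swp a c e c.
  by rewrite swp_lab; move: nea nec (lab_neq0 c); clear; lia.
have s3 : swp a c c a by rewrite /swp !eqxx orbT.
have yae : bef y a e by rewrite h xae s1.
have yec : bef y e c by rewrite h xec s2.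
by have := bef_trans yae yec; rewrite bef_asym // h s3 (bef_asym xac).
Qed.

Lemma cov_ivs x y a c : cov x y a c ->
  ivs y = ivs x :|: [set (a, c); (negl c, negl a)].
Proof.
move=> cv; have yca := cov_bef cv; case: (cov_neg cv) => _ _ ca xca _.
have yac := cov_bef (cov_neg cv).
case: cv => sx sy ac xac h; apply/setP => -[e f]; rewrite !inE /= h.
rewrite !xpair_eqE swpC; case: (boolP (swp a c e f)); last first.
  by rewrite /swp !negb_or => /and4P[/negbTE -> _ /negbTE -> _]; rewrite addbF !orbF.
rewrite /swp => /or4P[] /andP[/eqP -> /eqP ->].
- by rewrite ac (bef_asym xac) !eqxx.
- rewrite xac /= !lab_eq !lab_neg; move: ac; lia.
- by rewrite ca (bef_asym xca) !eqxx !orbT.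
rewrite xca /= !lab_eq !lab_neg; move: ac; lia.
Qed.

Lemma cov_notin x y a c : cov x y a c -> (a, c) \notin ivs x.
Proof. by case=> _ _ ac xac _; rewrite in_ivs ac (bef_asym xac). Qed.

Lemma cov_wle x y a c : cov x y a c -> wle x y.
Proof. by move=> h; rewrite /wle (cov_ivs h) subsetUl. Qed.

Lemma cov_in x y a c : cov x y a c -> (a, c) \in ivs y.
Proof. by move=> h; rewrite (cov_ivs h) !inE eqxx orbT. Qed.

Lemma cov_wle_below x y a c u : cov x y a c -> u \in signedperms n ->
  wle u y -> (a, c) \notin ivs u -> wle u x.
Proof.
move=> cv su uy nac; apply/subsetP => p pu; have := subsetP uy _ pu.
rewrite (cov_ivs cv) in_setU in_set2 => /or3P[//|/eqP e|/eqP e].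
  by rewrite -e pu in nac.
by rewrite e ivs_neg // (negbTE nac) in pu.
Qed.

Lemma cov_wle_above x y a c u : cov x y a c -> u \in signedperms n ->
  wle x u -> (a, c) \in ivs u -> wle y u.
Proof.
move=> cv su xu ac; rewrite /wle (cov_ivs cv) subUset -/(wle x u) xu /=.
by apply/subsetP => p; rewrite in_set2 => /orP[/eqP ->|/eqP ->]; rewrite ?ivs_neg.
Qed.

(** The entry in the position following that of a cannot precede c, so it is c. Positions skip 0
    just as labels do. *)
Lemma adj_nxt x a c : bef x a c -> (forall e, bef x a e -> bef x e c = false) ->
  nxt (lab (x a)) (lab (x c)).
Proof.
move=> ac h.
have [z zE] : exists z : L, lab z = (if lab (x a) == -1 then 1 else lab (x a) + 1)%R.
  by apply: lab_ex; have := lab_bound (x a); have := lab_bound (x c);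
     have := lab_neq0 (x a); have := lab_neq0 (x c); move: ac; rewrite /bef; case: ifP; lia.
have := h ((x^-1)%g z); rewrite /bef permKV; move: ac zE; rewrite /bef /nxt.
have := lab_neq0 (x a); have := lab_neq0 (x c); case: ifP; lia.
Qed.

Lemma cov_nxt x y a c : cov x y a c -> nxt (lab (x a)) (lab (x c)).
Proof. by move=> h; apply: adj_nxt; [case: h | move=> e; apply: cov_adj h]. Qed.

(** As the positions are consecutive, reflecting the entries amounts to a generator acting on
    positions; the two cases are the two sides of 0. *)
Lemma cov_rf x a c : x \in signedperms n -> (lab a < lab c)%R ->
  nxt (lab (x a)) (lab (x c)) -> cov x (rf a c * x)%g a c.
Proof.
move=> sx ac h.
have nac : a != c by rewrite lab_eq; lia.
have xi := permKV x; have /signedP sx' := signedV sx.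
have cj e f : x e = f -> e = (x^-1)%g f by move=> <-; rewrite permK.
have [k [[e1 e2]|[e1 e2]]] := nxtP h.
  have -> : (rf a c * x = x * gen k)%g.
    rewrite genE -e1 -e2 -rfJ // conjgE.
    by rewrite !mulgA mulgV mul1g.
  have := @cov_gen x k sx; rewrite -e1 -e2 !permK; exact.
have -> : (rf a c * x = x * gen k)%g.
  rewrite genE -[rf (glo k) _]rfN ?glo_neq // -e1 -e2 -rfJ // conjgE.
  by rewrite !mulgA mulgV mul1g.
have := @cov_gen x k sx.
have -> : (x^-1)%g (ghi k) = negl a by rewrite -[ghi k]neglK -e1 sx' permK.
have -> : (x^-1)%g (glo k) = negl c by rewrite -[glo k]neglK -e2 sx' permK.
by rewrite !lab_neg ltrN2 => H; have /cov_neg := H ac; rewrite !neglK.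
Qed.

Definition w0 : {perm L} := perm (@negl_inj n).

Lemma w0_signed : w0 \in signedperms n.
Proof. by apply/signedP => x; rewrite !permE. Qed.

(** Multiplying by the longest element reverses the order of occurrence and hence the weak order;
    dual statements are derived through it. *)
Definition rv x : {perm L} := (x * w0)%g.

Lemma rv_signed x : x \in signedperms n -> rv x \in signedperms n.
Proof. by move=> sx; apply: signedM w0_signed. Qed.

Lemma bef_rv x e f : bef (rv x) e f = bef x f e.
Proof. by rewrite /bef !permM !permE !lab_neg; lia. Qed.

Lemma rvK : involutive rv.
Proof. by move=> x; apply: bef_inj => e f; rewrite !bef_rv. Qed.

Lemma wle_rv x y : wle (rv x) (rv y) = wle y x.
Proof.
apply/wleP/wleP => h a c ac; last first.
  have nac : a != c by rewrite lab_eq; lia.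
  rewrite !bef_rv -![bef _ a c]bef_total 1?eq_sym //; exact/contra/h.
have nac : a != c by rewrite lab_eq; lia.
have := h _ _ ac; rewrite !bef_rv -![bef _ c a]bef_total // => H; exact/contra/H.
Qed.

Lemma cov_rv x y a c : cov x y a c -> cov (rv y) (rv x) a c.
Proof.
move=> cv; have yca := cov_bef cv; case: cv => sx sy ac xac h.
split; rewrite ?rv_signed ?bef_rv // => e f.
by rewrite !bef_rv h swpC -addbA addbb addbF.
Qed.

(** A descent of [w^-1 * v] is a pair of neighbours of w that v has in the opposite order. It has to
    be an inversion of w, and undoing it stays above v. *)
Lemma chain_down v w : v \in signedperms n -> w \in signedperms n -> wle v w -> v != w ->
  exists w' a c, cov w' w a c /\ wle v w'.
Proof.
move=> sv sw vw nvw.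
have su : (w^-1 * v)%g \in signedperms n by rewrite signedM ?signedV.
have [|k] := signed_descent su.
  by apply: contra nvw => /eqP e; rewrite -[v]mul1g -(mulgV w) -mulgA e mulg1.
rewrite /bef !permM; set c := (w^-1)%g (glo k); set a := (w^-1)%g (ghi k) => vac.
have wca : bef w c a by rewrite /bef !permKV glo_ghi.
have ac : (lab a < lab c)%R.
  case: (ltgtP (lab a) (lab c)) => // [ca|/lab_inj e]; last by rewrite e ltxx in vac.
  by have := wleP _ _ vw c a ca vac; rewrite (bef_asym wca).
have sw' : (w * gen k)%g \in signedperms n by rewrite signedM ?gen_signed.
have eP e f : (w e == f) = (e == (w^-1)%g f) by rewrite (can2_eq (permK w) (permKV w)).
have wE e f : bef (w * gen k)%g e f = bef w e f (+) swp a c e f.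
  rewrite /bef !permM gen_lt; congr (_ (+) _).
  have /signedP sw'' := signedV sw.
  by rewrite !eP !sw'' -/a -/c /swp; do ![case: eqP => //=].
exists (w * gen k)%g, a, c; split.
  split => // [|e f]; last by rewrite wE -addbA addbb addbF.
  by rewrite wE (bef_asym wca) /swp !eqxx.
apply/wleP => e f ef vfe; rewrite wE (wleP _ _ vw e f ef vfe) /=.
apply/negP; rewrite /swp => /or4P[] /andP[/eqP e1 /eqP e2]; rewrite e1 e2 in ef vfe.
- by move: ef; rewrite ltNge ltW.
- by move: vfe; rewrite (bef_asym vac).
- by move: ef; rewrite !lab_neg; lia.
by move: vfe; rewrite bef_neg // (bef_asym vac).
Qed.

Lemma chain_up v w : v \in signedperms n -> w \in signedperms n -> wle v w -> v != w ->
  exists v' a c, cov v v' a c /\ wle v' w.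
Proof.
move=> sv sw vw nvw.
have [||||x [a [c [cv h]]]] := @chain_down (rv w) (rv v); rewrite ?rv_signed ?wle_rv //.
  by rewrite (inj_eq (can_inj rvK)) eq_sym.
exists (rv x), a, c; split; last by rewrite -[w]rvK wle_rv.
by rewrite -[v]rvK; apply: cov_rv.
Qed.

End Covers.

(** * Biclosed sets of pairs and the lattice property *)

Section Build.
Variable n : nat.
Notation L := (bool * 'I_n)%type.
Implicit Types (w v u m : {perm L}) (a b c e f x y z : L).

(** The rank of a label for [lt] is matched with a rank in the label order. Conjugating by [w0] does
    not change the resulting order, and the order determines the permutation, so the permutation is
    signed. *)
Lemma build (lt : rel L) : irreflexive lt -> transitive lt ->
  (forall x y, x != y -> lt x y || lt y x) ->
  (forall x y, lt x y -> lt (negl y) (negl x)) ->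
  exists2 w, w \in signedperms n & forall x y, bef w x y = lt x y.
Proof.
move=> irr tr tot sym.
have asym x y : lt x y -> lt y x = false.
  by move=> xy; apply/negP => /(tr _ _ _ xy); rewrite irr.
have rank_lt (r : rel L) (ir : irreflexive r) (trr : transitive r) x y : r x y ->
    (#|[set z | r z x]| < #|[set z | r z y]|)%N.
  move=> xy; apply: proper_card; apply/properP; split.
    by apply/subsetP => z; rewrite !inE => /trr; apply.
  by exists x; rewrite inE ?ir.
have rank_bd (r : rel L) (ir : irreflexive r) x : (#|[set z | r z x]| < #|{: L}|)%N.
  rewrite -cardsT; apply: proper_card; rewrite properT.
  by apply/negP => /eqP/setP/(_ x); rewrite !inE ir.
pose ll (x y : L) := (lab x < lab y)%R.
have irl : irreflexive ll by move=> x; rewrite /ll ltxx.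
have trl : transitive ll by move=> y x z; apply: lt_trans.
pose g r ir x : 'I_#|{: L}| := Ordinal (rank_bd r ir x).
have g_inj r ir (trr : transitive r) (totr : forall x y, x != y -> r x y || r y x) :
    injective (g r ir).
  move=> x y [exy]; apply/eqP; apply/negPn/negP => /totr /orP[] /(rank_lt _ ir trr);
  by rewrite exy ltnn.
have totl x y : x != y -> ll x y || ll y x by rewrite lab_eq /ll; lia.
have [h hK Kh] := inj_card_bij (g_inj _ irl trl totl) (eq_leq (card_ord _)).
have hi : injective (h \o g lt irr).
  by apply: inj_comp; [apply: can_inj Kh | apply: g_inj].
pose w := perm hi.
have wE x y : bef w x y = lt x y.
  have wl z : #|[set t | ll t (w z)]| = #|[set t | lt t z]|.
    by rewrite permE /=; have := Kh (g lt irr z) => /(congr1 val) /=.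
  have imp z t : lt z t -> bef w z t.
    move=> /(rank_lt _ irr tr); rewrite -!wl /bef => hzt.
    case: (ltgtP (lab (w z)) (lab (w t))) => // [/(rank_lt _ irl trl)|/lab_inj e].
      by rewrite ltnNge ltnW.
    by rewrite e ltnn in hzt.
  apply/idP/idP => [|/imp //] b.
  case: (eqVneq x y) => [e|/tot]; first by rewrite e bef_irr in b.
  by case/orP => // /imp /bef_asym; rewrite b.
exists w => //; apply/signedP => x.
have w0E z : w0 n z = negl z by rewrite permE.
have : (w0 n * w * w0 n)%g = w.
  apply: bef_inj => e f; rewrite -/(rv _) bef_rv /bef !permM !w0E.
  by rewrite -!/(bef w _ _) !wE => /sym; rewrite !neglK.
by move=> /permP /(_ (negl x)); rewrite !permM !w0E neglK.
Qed.

(** Reverse in the label order exactly the pairs of I. Closure and coclosure exclude the two ways in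
    which the result could fail to be transitive. *)
Lemma build_ivs (I : {set L * L}) :
  (forall a c, (a, c) \in I -> (lab a < lab c)%R) ->
  (forall a b c, (a, b) \in I -> (b, c) \in I -> (a, c) \in I) ->
  (forall a b c, (a, c) \in I -> (lab a < lab b < lab c)%R ->
     (a, b) \in I \/ (b, c) \in I) ->
  (forall a c, (a, c) \in I -> (negl c, negl a) \in I) ->
  exists2 w, w \in signedperms n & ivs w = I.
Proof.
move=> I1 cl co sy.
pose lt x y := (lab x < lab y)%R && ((x, y) \notin I) || ((y, x) \in I).
have [|y x z|x y|x y|w sw wE] := @build lt.
- by move=> x; rewrite /lt ltxx /=; apply/negP => /I1; rewrite ltxx.
- rewrite /lt.
  have I1' a c : (a, c) \in I -> (lab a < lab c)%R && ((a, c) \in I) by move=> /[dup]/I1->.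
  case/orP => [/andP[xy nxy]|/I1'/andP[yx iyx]];
    case/orP => [/andP[yz nyz]|/I1'/andP[zy izy]].
  + rewrite (lt_trans xy yz) /=; case: (boolP ((x, z) \in I)) => //= h.
    by have [|h1|h1] := co _ y _ h; [rewrite xy yz | rewrite h1 in nxy | rewrite h1 in nyz].
  + case: (ltgtP (lab x) (lab z)) => [xz|zx|/lab_inj e].
    * case: (boolP ((x, z) \in I)) => //= h.
      by rewrite (cl _ _ _ h izy) in nxy.
    * by have [|->|h1] := co _ x _ izy; [rewrite zx xy | rewrite orbT | rewrite h1 in nxy].
    by rewrite e izy in nxy.
  + case: (ltgtP (lab x) (lab z)) => [xz|zx|/lab_inj e].
    * case: (boolP ((x, z) \in I)) => //= h.
      by rewrite (cl _ _ _ iyx h) in nyz.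
    * by have [|h1|->] := co _ z _ iyx; [rewrite yz zx | rewrite h1 in nyz | rewrite orbT].
    by rewrite -e iyx in nyz.
  by rewrite (cl _ _ _ izy iyx) orbT.
- rewrite lab_eq neq_lt /lt => /orP[] h; rewrite h /=;
  by case: (boolP ((x, y) \in I)); case: (boolP ((y, x) \in I)); rewrite ?orbT.
- rewrite /lt !lab_neg => /orP[/andP[xy nxy]|/sy ->]; last by rewrite orbT.
  rewrite ltrN2 xy /=; apply/orP; left; apply: contra nxy => /sy; by rewrite !neglK.
exists w => //; apply/setP => -[a c]; rewrite in_ivs wE /lt.
apply/idP/idP => [/andP[ac /orP[/andP[]|//]]|h]; first by rewrite ltNge ltW.
by rewrite h orbT (I1 _ _ h).
Qed.

(** The join inverts the transitive closure of the union of the inversion sets. This closure is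
    coclosed: a label b between the ends of a chain is an element of it or lies inside one of its
    steps, and that step splits at b. *)
Lemma join_ex v w : v \in signedperms n -> w \in signedperms n ->
  exists m, [/\ m \in signedperms n, wle v m, wle w m &
    forall u, u \in signedperms n -> wle v u -> wle w u -> wle m u].
Proof.
move=> sv sw; pose r a c := (a, c) \in ivs v :|: ivs w.
have r_lt a c : r a c -> (lab a < lab c)%R by rewrite /r !inE /= => /orP[]/andP[].
pose I := [set p : L * L | connect r p.1 p.2 && (p.1 != p.2)].
have con_le a c : connect r a c -> (lab a <= lab c)%R.
  case/connectP => p; elim: p a => [|e p IH] a /=; first by move=> _ ->.
  by case/andP => /r_lt ae /IH h /h; apply: le_trans; apply: ltW.
have II a c : ((a, c) \in I) = connect r a c && (lab a < lab c)%R.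
  rewrite inE /=; case: (boolP (connect r a c)) => //= /con_le; rewrite lab_eq.
  by rewrite lt_neqAle => ->; rewrite andbT.
have r_co a b c : r a c -> (lab a < lab b < lab c)%R -> r a b \/ r b c.
  have aux (z : {perm L}) : bef z c a -> bef z b a \/ bef z c b by rewrite /bef; lia.
  rewrite /r !inE /= => h /andP[ab bc]; rewrite ab bc /=.
  by case/orP: h => /andP[_ /aux[]] ->; rewrite ?orbT; [left|right|left|right].
have [|a b c|a b c|a c|m sm mE] := @build_ivs I.
- by move=> a c; rewrite II => /andP[].
- rewrite !II => /andP[h1 l1] /andP[h2 l2].
  by rewrite (connect_trans h1 h2) (lt_trans l1 l2).
- rewrite !II => /andP[/connectP[p pp ->] _ ] {c}.
  elim: p a pp => [|e p IH] a /=; first by move=> _; lia.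
  case/andP => rae pe /andP[ab bl]; rewrite ab bl /= !andbT.
  have cl : connect r e (last e p) by apply/connectP; exists p.
  case: (ltgtP (lab b) (lab e)) => [be|eb|/lab_inj ->].
  + have [|h|h] := r_co _ b _ rae; first by rewrite ab be.
      by left; apply: connect1.
    by right; apply: connect_trans cl; apply: connect1.
  + have [|/andP[h _]|/andP[h _]] := IH _ pe; first by rewrite eb bl.
      by left; apply: connect_trans h; apply: connect1.
    by right.
  by left; apply: connect1.
- rewrite !II !lab_neg ltrN2 => /andP[h ->]; rewrite andbT.
  case/connectP: h => p pp ->; elim: p a pp => [|e p IH] a /=; first by rewrite connect0.
  case/andP => rae /IH h; apply: (connect_trans h); apply: connect1.
  by move: rae; rewrite /r !in_setU !ivs_neg.
exists m; split => //; rewrite /wle mE.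
- apply/subsetP => -[a c] h; rewrite II r_lt ?connect1 // /r in_setU h //.
- apply/subsetP => -[a c] h; rewrite II r_lt ?connect1 // /r in_setU h orbT //.
move=> u su /subsetP vu /subsetP wu; apply/subsetP => -[a c]; rewrite II => /andP[].
case/connectP => p; elim: p a => [|e p IH] a /=; first by move=> _ ->; rewrite ltxx.
case/andP => rae pe lE ac; rewrite in_ivs ac /=.
have : (a, e) \in ivs u by move: rae; rewrite /r in_setU => /orP[/vu|/wu].
rewrite in_ivs => /andP[ae uea].
case: (eqVneq e c) => [<- //|nec]; apply: bef_trans uea.
have ec : (lab e < lab c)%R.
  by rewrite lt_neqAle -lab_eq nec con_le //; apply/connectP; exists p.
by have := IH _ pe lE ec; rewrite in_ivs => /andP[].
Qed.

Lemma meet_ex v w : v \in signedperms n -> w \in signedperms n ->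
  exists m, [/\ m \in signedperms n, wle m v, wle m w &
    forall u, u \in signedperms n -> wle u v -> wle u w -> wle u m].
Proof.
move=> sv sw; have [m [sm h1 h2 h3]] := join_ex (rv_signed sv) (rv_signed sw).
exists (rv m); split; rewrite ?rv_signed //.
- by rewrite -[v]rvK wle_rv.
- by rewrite -[w]rvK wle_rv.
move=> u su uv uw; rewrite -[u]rvK wle_rv; apply: h3; rewrite ?rv_signed ?wle_rv //.
Qed.

End Build.

(** * Word length and the weak order *)

Section Length.
Variable n : nat.
Notation L := (bool * 'I_n)%type.
Implicit Types (w v u x y : {perm L}) (a c e f : L) (k : 'I_n).

Lemma gpow_gen w m k : w \in gpow n m -> (w * gen k)%g \in gpow n m.+1.
Proof. by move=> h; apply: mem_mulg => //; apply: imset_f. Qed.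

Lemma gpowS w m : w \in gpow n m.+1 ->
  exists v k, v \in gpow n m /\ w = (v * gen k)%g.
Proof. by case/mulsgP => v g hv /imsetP[k _ ->] ->; exists v, k. Qed.

Lemma gpow_signed w m : w \in gpow n m -> w \in signedperms n.
Proof.
elim: m w => [|m IH] w; first by rewrite inE => /eqP ->; apply: signed1.
by case/gpowS => v [k [/IH sv ->]]; rewrite signedM ?gen_signed.
Qed.

(* The exchange condition: multiplying by the reflection of an inversion
   deletes a letter from a word of w. *)
Lemma gpow_exchange w m a c : w \in gpow n m -> (lab a < lab c)%R -> bef w c a ->
  rf a c \in refls n /\ exists2 j, j < m & (rf a c * w)%g \in gpow n j.
Proof.
elim: m w => [|m IH] w.
  by rewrite inE => /eqP -> ac; rewrite /bef !perm1 ltNge ltW.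
case/gpowS => v [k [hv ->]] ac wca.
have sv := gpow_signed hv.
case: (boolP (bef v c a)) => [vca|].
  have [h [j jm hj]] := IH _ hv ac vca; split => //.
  by exists j.+1 => //; rewrite mulgA gpow_gen.
have nac : a != c by rewrite lab_eq; lia.
rewrite bef_total 1?eq_sym // => vac.
(* Here the inversion is created by the last letter, so the reflection is a conjugate of that letter
   and deletes it. *)
have E : rf (v a) (v c) = gen k.
  move: wca; rewrite /bef !permM gen_lt -/(bef v c a) (bef_asym vac) /= genE.
  case/or4P => /andP[/eqP e1 /eqP e2]; rewrite e1 e2 ?rfN ?glo_neq //;
  by move: vac; rewrite /bef e1 e2 ?lab_neg; have := glo_ghi k; lia.
have Ev : (rf a c * v = v * gen k)%g by rewrite -E -rfJ // conjgE !mulgA mulgV mul1g.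
split.
  apply/imset2P; exists (gen k) (v^-1)%g; rewrite ?imset_f ?signedV //.
  by rewrite -E rfJ ?signedV // !permK.
by exists m => //; rewrite mulgA Ev -mulgA genK mulg1.
Qed.

(** Undoing a descent removes inversions. A pair and its mirror image are both counted, so the bound
    is generous; it serves to stay within the search range of [len]. *)
Lemma signed_gpow w : w \in signedperms n -> exists2 m, m <= #|ivs w| & w \in gpow n m.
Proof.
have [N leN] := ubnP #|ivs w|; elim: N w leN => // N IH w leN sw.
case: (eqVneq w 1%g) => [->|w1]; first by exists 0; rewrite ?inE.
have [|k hk] := signed_descent (signedV sw).
  by apply: contra w1 => /eqP e; rewrite -[w]invgK e invg1.
pose v := (w * gen k)%g.
have sv : v \in signedperms n by rewrite signedM ?gen_signed.
have wE : w = (v * gen k)%g by rewrite -mulgA genK mulg1.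
have vE z : (v^-1)%g z = (w^-1)%g (gen k z).
  by rewrite /v invMg permM -[(gen k)^-1%g]mulg1 -(genK k) mulKg.
have cv := @cov_gen n v k sv; rewrite -wE !vE genE !rfE ?glo_neq // !eqxx in cv.
have gg := glo_neq k; rewrite [_ == glo k]eq_sym (negbTE gg) in cv.
have {}cv := cv hk.
have lt_vw : #|ivs v| < #|ivs w|.
  apply: proper_card; rewrite properE -/(wle v w) (cov_wle cv); apply/subsetPn.
  by exists ((w^-1)%g (ghi k), (w^-1)%g (glo k)); rewrite ?(cov_in cv) ?(cov_notin cv).
have [m mv hm] := IH v (leq_trans lt_vw leN) sv.
by exists m.+1; rewrite ?(leq_ltn_trans mv) // wE gpow_gen.
Qed.

Lemma len_le w j : w \in gpow n j -> len w <= j.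
Proof.
move=> h; rewrite leqNgt; apply/negP => lt_j.
have jN : j < #|{perm L}|.
  by apply: leq_trans lt_j _; rewrite -[X in _ <= X](size_iota 0) find_size.
by have := before_find 0 lt_j; rewrite nth_iota // add0n h.
Qed.

Hypothesis n_ge2 : 2 <= n.

(** [len] searches below the number of permutations. There are at most (2n)^2 inversions, and (2n)^2
    < (2n)! from n = 2 on. *)
Lemma ivs_card w : #|ivs w| < #|{perm L}|.
Proof.
have cL : #|{: L}| = n.*2 by rewrite card_prod card_bool card_ord mul2n.
have cP : #|{perm L}| = (n.*2)`!.
  have := @card_perm _ [set: L]; rewrite cardsT cL => <-; apply: eq_card => p; rewrite inE.
  by apply/esym/subsetP => x _; rewrite inE.
apply: leq_ltn_trans (max_card _) _; rewrite card_prod cL cP.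
have : 4 <= n.*2 by rewrite -[4]/(2.*2) leq_double.
case: (n.*2) => [|[|[|m]]] // hm; rewrite 2!factS [m.+1`!]factS.
rewrite ltn_pmul2l //; have := fact_gt0 m; nia.
Qed.

Lemma len_mem w : w \in signedperms n -> w \in gpow n (len w).
Proof.
move=> sw; have [m mw hm] := signed_gpow sw.
have mN := leq_ltn_trans mw (ivs_card w).
have h : has (fun j => w \in gpow n j) (iota 0 #|{perm L}|).
  by apply/hasP; exists m => //; rewrite mem_iota.
have := nth_find 0 h; rewrite has_find size_iota in h.
by rewrite nth_iota // add0n.
Qed.

(** The longest element inverts every pair, so the exchange condition applied to it exhibits each
    reflection as a conjugate of a generator. *)
Lemma rf_refl a c : (lab a < lab c)%R -> rf a c \in refls n.
Proof.
move=> ac; have [m _ hm] := signed_gpow (w0_signed n).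
have [] // := gpow_exchange hm ac.
by rewrite /bef !permE !lab_neg; lia.
Qed.

Lemma reflsP t : t \in refls n -> exists a c, (lab a < lab c)%R /\ t = rf a c.
Proof.
case/imset2P => s w /imsetP[k _ ->] sw ->.
have gk := glo_neq k; rewrite genE rfJ //.
have wk : w (glo k) != w (ghi k) by rewrite (inj_eq perm_inj).
have [h|h] : (lab (w (glo k)) < lab (w (ghi k)) \/ lab (w (ghi k)) < lab (w (glo k)))%R.
  by move: wk; rewrite lab_eq; lia.
  by exists (w (glo k)), (w (ghi k)).
exists (negl (w (glo k))), (negl (w (ghi k))); split; first by rewrite !lab_neg; lia.
rewrite -[rf (w _) _]rfN //; apply/permP => x; rewrite !rfE ?(inj_eq (@negl_inj n)) //.
  by rewrite !neglK; do ![case: eqP => [->|] //].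
by rewrite eq_sym.
Qed.

(** If c precedes a, exchange shortens w. Otherwise c precedes a in the product, and exchange
    shortens the product back to w. *)
Lemma len_rf w a c : w \in signedperms n -> (lab a < lab c)%R ->
  (len (rf a c * w)%g < len w) = bef w c a.
Proof.
move=> sw ac; have nac : a != c by rewrite lab_eq; lia.
have dec v : v \in signedperms n -> bef v c a -> len (rf a c * v)%g < len v.
  move=> sv vca; have [_ [j jv hj]] := gpow_exchange (len_mem sv) ac vca.
  exact: leq_ltn_trans (len_le hj) jv.
apply/idP/idP => [|/dec]; last exact.
apply: contraLR; rewrite bef_total 1?eq_sym // => wac; rewrite -leqNgt ltnW //.
have := dec (rf a c * w)%g; rewrite mulgA rfK // mul1g; apply.
  by rewrite signedM ?rf_signed.
by rewrite /bef !permM !rfE // !eqxx eq_sym (negbTE nac).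
Qed.

Lemma weak_leE v w : v \in signedperms n -> w \in signedperms n -> weak_le v w = wle v w.
Proof.
move=> sv sw; apply/subsetP/wleP => h => [a c ac vca|t].
  have := h (rf a c); rewrite !in_set rf_refl // !len_rf // vca.
  by move/(_ isT).
rewrite !in_set => /andP[/[dup] ht /reflsP [a [c [ac ->]]]].
by rewrite rf_refl // !len_rf //=; exact: h.
Qed.

End Length.

(** * Diagonals and paths *)

Lemma ex_max (T : finType) (S : pred T) (F : T -> int) x0 : S x0 ->
  exists2 x, S x & forall y, S y -> (F y <= F x)%R.
Proof.
move=> Sx0; exists ([arg max_(x > x0 | S x) F x]%O);
by case: Order.TotalTheory.arg_maxP => // x.
Qed.

Section Diagonals.
Variables (n : nat) (up : bool * 'I_n -> bool).
Notation L := (bool * 'I_n)%type.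
Notation V := (bool * 'I_n.+1)%type.
Implicit Types (w : {perm L}) (a b c e u v z : L) (p q r s : V) (P : {set L}).

(* The labels passed by the sweep before the path can use the edge pq, and those
   passed only after it: among the vertices between p and q, the path avoids the
   down ones once they are passed and the up ones as long as they are not. *)
Definition inA p q u : bool :=
  up u && ((lab u == lab p) || (lab u == lab q)) ||
  ~~ up u && (lab p < lab u < lab q)%R.

Definition inB p q u : bool :=
  ~~ up u && ((lab u == lab p) || (lab u == lab q)) ||
  up u && (lab p < lab u < lab q)%R.

Lemma inAE p q u : inA p q u =
  up u && ((lab u == lab p) || (lab u == lab q)) || ~~ up u && (lab p < lab u < lab q)%R.
Proof. by []. Qed.

Lemma inBE p q u : inB p q u =
  ~~ up u && ((lab u == lab p) || (lab u == lab q)) || up u && (lab p < lab u < lab q)%R.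
Proof. by []. Qed.

Definition compat w p q : bool :=
  [forall u, forall v, (inA p q u && inB p q v) ==> bef w u v].

Lemma compatP w p q :
  reflect (forall u v, inA p q u -> inB p q v -> bef w u v) (compat w p q).
Proof.
apply: (iffP forallP) => h u; last by apply/forallP => v; apply/implyP => /andP[]; apply: h.
by move=> v hu hv; have /forallP /(_ v) /implyP := h u; apply; rewrite hu.
Qed.

Definition pdiag p q : bool :=
  [&& (lab p < lab q)%R, [exists u, inA p q u] & [exists u, inB p q u]].

Lemma pdiagP p q u v : (lab p < lab q)%R -> inA p q u -> inB p q v -> pdiag p q.
Proof.
by move=> pq hu hv; apply/and3P; split => //; apply/existsP; [exists u | exists v].
Qed.

Lemma inAB p q u : inA p q u -> inB p q u = false.
Proof. rewrite /inA /inB; lia. Qed.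

Lemma inA_int p q u : (lab p < lab q)%R -> inA p q u -> (lab p <= lab u <= lab q)%R.
Proof. rewrite /inA; lia. Qed.

Lemma inB_int p q u : (lab p < lab q)%R -> inB p q u -> (lab p <= lab u <= lab q)%R.
Proof. rewrite /inB; lia. Qed.

Lemma mid_AB p q u : (lab p < lab u < lab q)%R -> (inA p q u = ~~ up u) * (inB p q u = up u).
Proof. by move=> h; split; rewrite /inA /inB; lia. Qed.

(* A cut P, with the down labels outside P and the up labels in P, spans a path
   from v_{-n-1} to v_{n+1}; [pathedge P p q] says that pq is an edge of it. *)
Definition pathedge P p q : Prop :=
  [/\ (lab p < lab q)%R, forall z, inA p q z -> z \in P &
      forall z, inB p q z -> z \notin P].

Definition initial w P : Prop := forall z z', z' \in P -> bef w z z' -> z \in P.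

Lemma pathedge_compat w P p q : initial w P -> pathedge P p q -> compat w p q.
Proof.
move=> iP [pq hA hB]; apply/compatP => u v /hA uP /hB vP.
have nuv : v != u by apply: contraNneq vP => ->.
by rewrite -bef_total //; apply: contra vP; apply: iP.
Qed.

(** The hypothesis on b says that no label between u and v is on the path. The edge goes from the
    last path vertex weakly left of both labels to the first one weakly right of both; these exist
    since the extreme vertices are always on the path. *)
Lemma pathedge_ex P u v : u \notin P -> v \in P ->
  (forall b, (lab u < lab b < lab v)%R || (lab v < lab b < lab u)%R -> up b != (b \in P)) ->
  exists p q, [/\ pathedge P p q, inA p q v & inB p q u].
Proof.
move=> uP vP hb.
have nuv : lab u != lab v by rewrite -lab_eq; apply: contraNneq uP => ->.
pose onp (z : int) := (`|z|%N == n.+1) || [exists b, (lab b == z) && (up b == (b \in P))].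
have onl b : onp (lab b) = (up b == (b \in P)).
  rewrite /onp; have -> : (`|lab b|%N == n.+1) = false by have := lab_bound b; lia.
  apply/existsP/idP => [[b' /andP[]]|h]; first by rewrite -lab_eq => /eqP ->.
  by exists b; rewrite eqxx.
pose lo := Num.min (lab u) (lab v); pose hi := Num.max (lab u) (lab v).
have bu := lab_bound u; have bv := lab_bound v.
have [x0 x0E] : exists x : V, lab x = (- Posz n.+1)%R by apply: lab_ex; lia.
have [x1 x1E] : exists x : V, lab x = Posz n.+1 by apply: lab_ex; lia.
have [|p /andP[onP p_lo] pmax] :=
  @ex_max V (fun x => onp (lab x) && (lab x <= lo)%R) (@lab n.+1) x0.
  by rewrite /onp x0E /lo; lia.
have [|q /andP[onq q_hi] qmin] :=
  @ex_max V (fun x => onp (lab x) && (hi <= lab x)%R) (fun x => - lab x)%R x1.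
  by rewrite /onp x1E /hi; lia.
have embed b : exists x : V, lab x = lab b.
  by apply: lab_ex; have := lab_bound b; have := lab_neq0 b; lia.
have ends b (x : V) : onp (lab x) -> lab b = lab x -> up b = (b \in P).
  by move=> h e; rewrite -e onl in h; apply/eqP.
have mids b : (lab p < lab b < lab q)%R -> up b != (b \in P).
  move=> /andP[pb bq]; apply/negP => ob; have [x xE] := embed b.
  have := pmax x; have := qmin x; rewrite xE onl ob /=.
  have := hb b; rewrite ob /= /lo /hi in p_lo q_hi *; lia.
have AP z : inA p q z -> z \in P.
  rewrite /inA => /orP[/andP[uz /orP[]/eqP e]|/andP[uz /mids]].
  - by rewrite -(ends _ _ onP e).
  - by rewrite -(ends _ _ onq e).
  by rewrite (negbTE uz); case: (z \in P).
have BP z : inB p q z -> z \notin P.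
  rewrite /inB => /orP[/andP[uz /orP[]/eqP e]|/andP[uz /mids]].
  - by rewrite -(ends _ _ onP e).
  - by rewrite -(ends _ _ onq e).
  by rewrite uz; case: (z \in P).
have pq : (lab p < lab q)%R by rewrite /lo /hi in p_lo q_hi; lia.
have cl b : b = u \/ b = v -> up b = (b \in P) -> (lab b == lab p) || (lab b == lab q).
  move=> bE ob; have [x xE] := embed b.
  have := pmax x; have := qmin x; rewrite xE onl ob eqxx /=.
  by rewrite /lo /hi in p_lo q_hi *; case: bE => ->; lia.
have lq b : b = u \/ b = v -> (lab p <= lab b <= lab q)%R.
  by rewrite /lo /hi in p_lo q_hi *; case=> ->; lia.
exists p, q; split => //.
- have := cl v; have := lq v; rewrite vP /inA; case: (boolP (up v)) => uv /=.
    by move=> _ ->; rewrite ?orbT //; right.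
  have : ~~ ((lab v == lab p) || (lab v == lab q)).
    by apply: contra uv => /orP[]/eqP /ends ->.
  move=> h1 /(_ (or_intror erefl)) h2 _; rewrite /inB; lia.
- have := cl u; have := lq u; rewrite (negbTE uP) /inB; case: (boolP (up u)) => uu /=.
    have : ~~ ((lab u == lab p) || (lab u == lab q)).
      by apply/negP => /orP[]/eqP /ends e; rewrite e // (negbTE uP) in uu.
    move=> h1 /(_ (or_introl erefl)) h2 _; lia.
  by move=> _ ->; rewrite ?orbT //; left.
Qed.

(** An end of one edge strictly inside the span of the other would be both on and off the path, so
    edges whose spans share two labels coincide. *)
Lemma pathedge_uniq P p q p' q' u v : pathedge P p q -> pathedge P p' q' -> u != v ->
  (lab p <= lab u <= lab q)%R -> (lab p <= lab v <= lab q)%R ->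
  (lab p' <= lab u <= lab q')%R -> (lab p' <= lab v <= lab q')%R -> p = p' /\ q = q'.
Proof.
move=> [pq hA hB] [pq' hA' hB'] nuv u1 v1 u2 v2.
have nl : lab u != lab v by rewrite -lab_eq.
have key (p1 q1 p2 q2 t : V) : (forall z, inA p1 q1 z -> z \in P) ->
    (forall z, inB p1 q1 z -> z \notin P) -> (forall z, inA p2 q2 z -> z \in P) ->
    (forall z, inB p2 q2 z -> z \notin P) -> (t == p2) || (t == q2) ->
    (lab p1 < lab t < lab q1)%R -> False.
  move=> A1 B1 A2 B2 tE ht; have [z zE] : exists z : L, lab z = lab t.
    apply: lab_ex; first exact: lab_neq0.
    by have := lab_bound p1; have := lab_bound q1; lia.
  rewrite -zE in ht; have [hA1 hB1] := mid_AB ht.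
  have ze : (lab z == lab p2) || (lab z == lab q2) by rewrite !lab_eq -zE in tE.
  case: (boolP (up z)) => uz.
    have /B1 : inB p1 q1 z by rewrite hB1.
    by rewrite A2 // /inA uz ze.
  have /A1 : inA p1 q1 z by rewrite hA1.
  by apply/negP/B2; rewrite /inB uz ze.
have k1 := key p q p' q' _ hA hB hA' hB'; have k2 := key p' q' p q _ hA' hB' hA hB.
have := k1 p'; have := k1 q'; have := k2 p; have := k2 q.
rewrite !eqxx !orbT => /(_ isT) h1 /(_ isT) h2 /(_ isT) h3 /(_ isT) h4.
split; apply: lab_inj.
  case: (ltgtP (lab p) (lab p')) => // h; [case: h4|case: h2]; lia.
case: (ltgtP (lab q) (lab q')) => // h; [case: h1|case: h3]; lia.
Qed.

Lemma initial_le w a : initial w [set z | ~~ bef w a z].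
Proof.
move=> z z'; rewrite !inE => h zz'; apply: contra h => h.
exact: bef_trans h zz'.
Qed.

(** What precedes c cannot follow its neighbour a, so the cut between a and c separates [inA] from
    [inB]. *)
Lemma compat_pathedge w a c p q : (lab p < lab q)%R -> compat w p q -> bef w a c ->
  (forall e, bef w a e -> bef w e c = false) -> inA p q a -> inB p q c ->
  pathedge [set z | ~~ bef w a z] p q.
Proof.
move=> pq /compatP h ac adj Aa Bc; split => // z hz; rewrite inE.
  by apply/negP => /adj; rewrite h.
by rewrite negbK h.
Qed.

(* The diagonals pq and rs require u and v in opposite orders. *)
Definition cross p q r s : Prop :=
  exists u v, [/\ inA p q u, inB r s u, inB p q v & inA r s v].

Lemma compat_noncross w p q r s : compat w p q -> compat w r s -> ~ cross p q r s.
Proof.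
move=> /compatP h1 /compatP h2 [u [v [Au Bu Bv Av]]].
by have := h1 _ _ Au Bv; rewrite bef_asym // h2.
Qed.

(** A path vertex b between the two labels can replace v if b is in P, and u otherwise. The closest
    pair admits no such b, and the order is retained because b lies between. *)
Lemma close_pair P p q v u : (lab p < lab q)%R ->
  inB p q v -> v \in P -> inA p q u -> u \notin P ->
  exists v' u', [/\ inB p q v', v' \in P, inA p q u' & u' \notin P] /\
    (lab v' < lab u')%R = (lab v < lab u)%R /\
    forall b, (lab u' < lab b < lab v')%R || (lab v' < lab b < lab u')%R -> up b != (b \in P).
Proof.
move=> pq; have [N leN] := ubnP `|(lab v - lab u)%R|%N.
elim: N v u leN => // N IH v u leN Bv vP Au uP.
have Iv := inB_int pq Bv; have Iu := inA_int pq Au.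
pose T b := ((lab u < lab b < lab v)%R || (lab v < lab b < lab u)%R) && (up b == (b \in P)).
case: (pickP T) => [b /andP[hb ob]|noT]; last first.
  exists v, u; split => //; split => // b hb.
  by have := noT b; rewrite /T hb /= => /negbT.
have [hA hB] : (inA p q b = ~~ up b) * (inB p q b = up b) by apply: mid_AB; lia.
case: (boolP (b \in P)) => bP; rewrite ?bP ?(negbTE bP) in ob.
  have [|||||v' [u' [h1 [h2 h3]]]] := IH b u; rewrite ?hB //; try by move: ob; case: (up b).
    by lia.
  by exists v', u'; split => //; rewrite h2; split => //; lia.
have [|||||v' [u' [h1 [h2 h3]]]] := IH v b; rewrite ?hA //; try by move: ob; case: (up b).
  by lia.
by exists v', u'; split => //; rewrite h2; split => //; lia.
Qed.

(* A diagonal violated by w is crossed by a diagonal satisfied by w, and the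
   middle vertices of the crossing can be taken in the order of the violation. *)
Lemma violated_cross w p q v u : (lab p < lab q)%R ->
  inB p q v -> inA p q u -> bef w v u ->
  exists r s u' v', [/\ pdiag r s, compat w r s, inA p q u' & inB r s u'] /\
    [/\ inB p q v', inA r s v' & (lab v' < lab u')%R = (lab v < lab u)%R].
Proof.
move=> pq Bv Au vu; pose P := [set z | ~~ bef w v z].
have [|//||v' [u' [[Bv' vP' Au' uP'] [o hb]]]] := @close_pair P _ _ v u pq Bv.
- by rewrite inE bef_irr.
- by rewrite inE vu.
have [r [s [rs Ar Br]]] := pathedge_ex uP' vP' hb.
have rs' := pathedge_compat (@initial_le w v) rs.
have rd : pdiag r s by case: rs => rs _ _; apply: pdiagP Ar Br.
by exists r, s, u', v'; split; split.
Qed.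

Lemma notcompat_cross w p q : (lab p < lab q)%R -> ~~ compat w p q ->
  exists r s, [/\ pdiag r s, compat w r s & cross p q r s].
Proof.
move=> pq; rewrite negb_forall => /existsP[u]; rewrite negb_forall => /existsP[v].
rewrite negb_imply => /andP[/andP[Au Bv]].
have nvu : u != v by apply: contraTneq Au => ->; apply/negP => /inAB; rewrite Bv.
rewrite bef_total // => vu.
have [r [s [u' [v' [[h1 h2 h3 h4] [h5 h6 _]]]]]] := violated_cross pq Bv Au vu.
by exists r, s; split => //; exists u', v'.
Qed.

Definition diags w : {set {set V}} :=
  [set D : {set V} | [exists p : V, exists q : V,
     [&& D == [set p; q], pdiag p q & compat w p q]]].

Lemma pair_inj p q p' q' : (lab p < lab q)%R -> (lab p' < lab q')%R ->
  [set p; q] = [set p'; q'] -> p = p' /\ q = q'.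
Proof.
move=> h h' /setP e.
have := e p; have := e q; have := e p'; have := e q'.
rewrite !in_set2 !eqxx !orbT /= => /orP e4 /orP e3 /esym /orP e2 /esym /orP e1.
by case: e1 => /eqP e1; case: e2 => /eqP e2; subst => //;
   case: e3 => /eqP e3; case: e4 => /eqP e4; subst => //; lia.
Qed.

Lemma pdiag_lt p q : pdiag p q -> (lab p < lab q)%R.
Proof. by case/and3P. Qed.

Lemma in_diags w p q : (lab p < lab q)%R -> ([set p; q] \in diags w) = pdiag p q && compat w p q.
Proof.
move=> pq; rewrite inE; apply/existsP/idP => [[p' /existsP[q' /and3P[/eqP e d' s']]]|h].
  by have [-> ->] := pair_inj pq (pdiag_lt d') e; rewrite d'.
by exists p; apply/existsP; exists q; rewrite eqxx.
Qed.

Lemma diagsP w (D : {set V}) :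
  D \in diags w -> exists p q, [/\ D = [set p; q], pdiag p q & compat w p q].
Proof. by rewrite inE => /existsP[p /existsP[q /and3P[/eqP]]]; exists p, q. Qed.

Definition sub_diags (x y : {perm L}) : Prop :=
  forall p q, pdiag p q -> compat x p q -> compat y p q.

(** A further diagonal of y would be crossed by a diagonal of x, which is also one of y. *)
Lemma sub_diags_eq (x y : {perm L}) : sub_diags x y -> diags x = diags y.
Proof.
move=> h; apply/setP => D; apply/idP/idP => /diagsP[p [q [-> d s]]].
  by rewrite in_diags ?pdiag_lt // d h.
rewrite in_diags ?pdiag_lt // d /=; apply/negPn/negP.
case/(notcompat_cross (pdiag_lt d)) => r [t [d' s' cr]].
exact: compat_noncross s (h _ _ d' s') cr.
Qed.

Lemma eq_diags_sub (x y : {perm L}) : diags x = diags y -> sub_diags x y.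
Proof.
move=> e p q d s; have : [set p; q] \in diags x by rewrite in_diags ?pdiag_lt // d.
by rewrite e in_diags ?pdiag_lt // d.
Qed.

End Diagonals.

(** * Fibres *)

Section Projection.
Variable n : nat.
Notation L := (bool * 'I_n)%type.
Notation V := (bool * 'I_n.+1)%type.
Implicit Types (w x y : {perm L}) (a b c e u v z : L) (p q r s : V).

(** An up label between a and c has to come after c, and a down one before a, lest its vertex
    separate a from c on the path. The mixed pairs of an up and a larger down label make the
    construction idempotent. *)
Definition inlo (up : L -> bool) a c z : bool :=
  (z == a) || (up z && (lab a < lab z < lab c)%R).
Definition inhi (up : L -> bool) a c z : bool :=
  (z == c) || (~~ up z && (lab a < lab z < lab c)%R).

(* The inversions of w that survive in the bottom element of its fibre. *)
Definition core_ivs up w : {set L * L} :=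
  [set ac : L * L | (lab ac.1 < lab ac.2)%R &&
    [forall a', forall c', [&& inlo up ac.1 ac.2 a', inhi up ac.1 ac.2 c' &
        (lab a' < lab c')%R] ==> bef w c' a']].

Lemma core_ivsP up w a c :
  reflect ((lab a < lab c)%R /\ forall a' c', inlo up a c a' -> inhi up a c c' ->
      (lab a' < lab c')%R -> bef w c' a') ((a, c) \in core_ivs up w).
Proof.
rewrite inE /=; apply: (iffP andP) => -[ac h]; split => //.
  move=> a' c' h1 h2 h3; have /forallP /(_ c') /implyP := forallP h a'.
  by apply; rewrite h1 h2.
by apply/forallP => a'; apply/forallP => c'; apply/implyP => /and3P[]; apply: h.
Qed.

Variable up : L -> bool.
Hypothesis up_neg : forall z, up (negl z) = ~~ up z.

(** Closed: a pair tested for (a, c) is tested for (a, b) or for (b, c), or else it straddles b and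
    is inverted through b. Coclosed: if b is up, all pairs tested for (b, c) are tested for (a, c);
    if b is down, the same holds for (a, b). *)
Lemma core_ivs_ex w : w \in signedperms n ->
  exists2 v, v \in signedperms n & ivs v = core_ivs up w.
Proof.
move=> sw; apply: build_ivs => [a c|a b c|a b c|a c].
- by case/core_ivsP.
- case/core_ivsP => ab h1 /core_ivsP[bc h2].
  apply/core_ivsP; split => [|a' c' ha hc ac]; first exact: lt_trans bc.
  have nb z : (z == b) = (lab z == lab b) by rewrite lab_eq.
  case: (boolP (inhi up a b c')) => hc1.
    apply: h1 => //; move: ha hc hc1; rewrite /inlo /inhi !lab_eq; lia.
  case: (boolP (inlo up b c a')) => ha1.
    apply: h2 => //; move: ha hc ha1; rewrite /inlo /inhi !lab_eq; lia.
  have hab : (lab a' < lab b)%R by move: ha hc ha1 hc1; rewrite /inlo /inhi !lab_eq; lia.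
  have hbc : (lab b < lab c')%R by move: ha hc ha1 hc1; rewrite /inlo /inhi !lab_eq; lia.
  apply: (@bef_trans _ w b).
    by apply: h2 => //; move: hc hbc; rewrite /inlo /inhi ?eqxx // !lab_eq; lia.
  by apply: h1 => //; move: ha hab; rewrite /inlo /inhi ?eqxx // !lab_eq; lia.
- case/core_ivsP => ac h /andP[ab bc]; case: (boolP (up b)) => ub; [right|left];
  apply/core_ivsP; split => // a' c' ha hc; apply: h.
  + by move: ha ub; rewrite /inlo => /orP[/eqP ->|]; [move->; lia | lia].
  + by move: hc; rewrite /inhi; lia.
  + by move: ha; rewrite /inlo; lia.
  by move: hc ub; rewrite /inhi => /orP[/eqP ->|]; [move=> ->; lia | lia].
case/core_ivsP => ac h; apply/core_ivsP; split; first by rewrite !lab_neg; lia.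
move=> a' c' ha hc ac'; rewrite -[a']neglK -[c']neglK bef_neg //; apply: h.
- move: hc; rewrite /inlo /inhi !lab_neg up_neg.
  by rewrite -(inj_eq (@negl_inj n)) neglK; lia.
- move: ha; rewrite /inlo /inhi !lab_neg up_neg.
  by rewrite -(inj_eq (@negl_inj n)) neglK; lia.
by rewrite !lab_neg; lia.
Qed.

Definition pd w : {perm L} :=
  odflt 1%g [pick v in signedperms n | ivs v == core_ivs up w].

Lemma pdP w : w \in signedperms n -> pd w \in signedperms n /\ ivs (pd w) = core_ivs up w.
Proof.
move=> /core_ivs_ex [v sv e]; rewrite /pd; case: pickP => [x /andP[sx /eqP] //|].
by move=> /(_ v); rewrite sv e eqxx.
Qed.

Lemma pd_signed w : w \in signedperms n -> pd w \in signedperms n.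
Proof. by case/pdP. Qed.

Lemma pd_ivs w : w \in signedperms n -> ivs (pd w) = core_ivs up w.
Proof. by case/pdP. Qed.

Lemma core_ivs_self w a c : (a, c) \in core_ivs up w -> bef w c a.
Proof. by case/core_ivsP => ac h; apply: h; rewrite /inlo /inhi ?eqxx. Qed.

Lemma pd_le w : w \in signedperms n -> wle (pd w) w.
Proof.
move=> sw; rewrite /wle pd_ivs //; apply/subsetP => -[a c] h.
by rewrite in_ivs (core_ivs_self h) andbT; case/core_ivsP: h.
Qed.

Lemma pd_mono x y : x \in signedperms n -> y \in signedperms n ->
  wle x y -> wle (pd x) (pd y).
Proof.
move=> sx sy /wleP xy; rewrite /wle !pd_ivs //; apply/subsetP => -[a c].
case/core_ivsP => ac h; apply/core_ivsP; split => // a' c' h1 h2 h3.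
by apply: xy => //; apply: h.
Qed.

Lemma core_ivs_pd w : w \in signedperms n -> core_ivs up (pd w) = ivs (pd w).
Proof.
move=> sw; apply/setP => -[a c]; apply/idP/idP => [h|].
  by rewrite in_ivs (core_ivs_self h) andbT; case/core_ivsP: h.
rewrite pd_ivs // => /core_ivsP[ac h]; apply/core_ivsP; split => // a' c' h1 h2 h3.
have : (a', c') \in ivs (pd w).
  rewrite pd_ivs //; apply/core_ivsP; split => // a'' c'' h4 h5; apply: h.
    by move: h1 h2 h4; rewrite /inlo /inhi => /orP[/eqP->|?] /orP[/eqP->|?] /orP[/eqP->|?];
      rewrite ?eqxx //; apply/orP; lia.
  by move: h1 h2 h5; rewrite /inlo /inhi => /orP[/eqP->|?] /orP[/eqP->|?] /orP[/eqP->|?];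
    rewrite ?eqxx //; apply/orP; lia.
by rewrite in_ivs => /andP[].
Qed.

(** If pq is compatible with w, an inversion that pq separates survives in [pd w], since the labels
    tested for it lie on the matching sides of pq. *)
Lemma diags_pd w : w \in signedperms n -> diags up (pd w) = diags up w.
Proof.
move=> sw; apply/esym/sub_diags_eq => p q d /compatP h; have pq := pdiag_lt d.
apply/compatP => u v Au Bv; have wuv := h _ _ Au Bv.
have Iu := inA_int pq Au; have Iv := inB_int pq Bv.
case: (ltgtP (lab u) (lab v)) => [uv|vu|/lab_inj e]; last first.
- by rewrite e bef_irr in wuv.
- have : (v, u) \in ivs (pd w); last by rewrite in_ivs => /andP[].
  rewrite pd_ivs //; apply/core_ivsP; split => // a' c' h1 h2 _; apply: h.
    by case/orP: h2 => [/eqP -> //|h2]; rewrite /inA; lia.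
  by case/orP: h1 => [/eqP -> //|h1]; rewrite /inB; lia.
rewrite -bef_total; last by rewrite lab_eq; lia.
apply/negP => /(wleP _ _ (pd_le sw) _ _ uv); by rewrite (bef_asym wuv).
Qed.

(** An inversion of [pd w] refines into a chain of inversions each separated by a diagonal of w. If
    no z with label between a and c stands between the entries c and a, then no label between a and
    c is on the path just after c is passed, and the path edge spanning a and c separates them. *)
Lemma pd_separated w y a c : w \in signedperms n ->
  (forall p q a c, pdiag up p q -> compat up w p q -> inA up p q c -> inB up p q a ->
     (lab a < lab c)%R -> bef y c a) ->
  (a, c) \in ivs (pd w) -> bef y c a.
Proof.
move=> sw; move/eq_diags_sub: (diags_pd sw) => pw wy.
have {pw}wy p q e f : pdiag up p q -> compat up (pd w) p q -> inA up p q f ->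
    inB up p q e -> (lab e < lab f)%R -> bef y f e.
  by move=> d h; apply: wy (d) _; apply: pw.
have Iw := core_ivs_pd sw; move: (pd w) wy Iw => {w sw}w wy Iw.
have [N leN] := ubnP `|(lab (w a) - lab (w c))%R|%N.
elim: N a c leN => // N IH a c leN hac.
have /core_ivsP[ac h] : (a, c) \in core_ivs up w by rewrite Iw.
have wca : bef w c a by move: hac; rewrite in_ivs => /andP[].
pose T z := [&& (lab a < lab z < lab c)%R, bef w c z & bef w z a].
case: (pickP T) => [z /and3P[/andP[az zc] cz za]|noT].
  apply: (@bef_trans _ _ z); apply: IH; rewrite ?in_ivs ?az ?zc ?cz ?za //;
  move: leN wca cz za; rewrite /bef; lia.
have [||b hb|p [q [[pq hA hB] Ac Ba]]] := @pathedge_ex n up [set z | ~~ bef w c z] a c.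
- by rewrite inE wca.
- by rewrite inE bef_irr.
- have {}hb : (lab a < lab b < lab c)%R by lia.
  have := noT b; rewrite /T hb inE /=; case: (boolP (up b)) => ub.
    by have -> : bef w c b by apply: h; rewrite /inlo /inhi ?eqxx // ?ub ?hb ?orbT //; lia.
  have -> : bef w b a by apply: h; rewrite /inlo /inhi ?eqxx // ?ub ?hb ?orbT //; lia.
  by rewrite andbT => ->.
apply: (wy p q) => //; [exact: pdiagP Ac Ba | exact: pathedge_compat (@initial_le _ w c) _].
Qed.

Lemma pd_eq x y : x \in signedperms n -> y \in signedperms n ->
  diags up x = diags up y <-> pd x = pd y.
Proof.
move=> sx sy; split=> [e|e]; last by rewrite -(diags_pd sx) e diags_pd.
have key (y1 y2 : {perm L}) : y1 \in signedperms n -> y2 \in signedperms n ->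
    diags up y1 = diags up y2 -> wle (pd y1) (pd y2).
  move=> s1 s2 e12; apply/subsetP => -[a c] h.
  rewrite in_ivs; have -> : (lab a < lab c)%R by move: h; rewrite in_ivs => /andP[].
  apply: pd_separated h => // p q a' c' d xD Ac Ba _.
  have e13 : diags up y1 = diags up (pd y2) by rewrite diags_pd.
  by have /compatP := eq_diags_sub e13 d xD; apply.
by apply: wle_anti; apply: key.
Qed.

Lemma pd_idem w : w \in signedperms n -> pd (pd w) = pd w.
Proof. by move=> sw; apply/pd_eq; rewrite ?pd_signed ?diags_pd. Qed.

End Projection.

(** * Top elements of the fibres *)

Section Dual.
Variables (n : nat) (up : bool * 'I_n -> bool).
Notation L := (bool * 'I_n)%type.
Notation V := (bool * 'I_n.+1)%type.
Implicit Types (w x y : {perm L}) (u v z : L) (p q : V).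
Hypothesis up_neg : forall z, up (negl z) = ~~ up z.

Let dn z := ~~ up z.

Let dn_neg z : dn (negl z) = ~~ dn z.
Proof. by rewrite /dn up_neg. Qed.

Lemma inA_dn p q u : inA dn p q u = inB up p q u.
Proof. by rewrite /inA /inB /dn negbK. Qed.

Lemma inB_dn p q u : inB dn p q u = inA up p q u.
Proof. by rewrite /inA /inB /dn negbK. Qed.

Lemma pdiag_dn p q : pdiag dn p q = pdiag up p q.
Proof.
rewrite /pdiag; congr andb; rewrite andbC.
by congr andb; apply: eq_existsb => u; rewrite ?inA_dn ?inB_dn.
Qed.

Lemma compat_dn w p q : compat dn (rv w) p q = compat up w p q.
Proof.
by apply/compatP/compatP => h u v; have := h v u; rewrite inA_dn inB_dn bef_rv; auto.
Qed.

Lemma diags_dn w : diags dn (rv w) = diags up w.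
Proof.
apply/setP => D; rewrite !inE; apply: eq_existsb => p; apply: eq_existsb => q.
by rewrite pdiag_dn compat_dn.
Qed.

(** Reversing the order while exchanging up and down labels preserves all diagonals and turns
    bottoms of fibres into tops. *)
Definition pu w := rv (pd dn (rv w)).

Lemma pu_signed w : w \in signedperms n -> pu w \in signedperms n.
Proof. by move=> sw; rewrite rv_signed // pd_signed // rv_signed. Qed.

Lemma pu_ge w : w \in signedperms n -> wle w (pu w).
Proof. by move=> sw; rewrite -wle_rv rvK pd_le // rv_signed. Qed.

Lemma pu_mono x y : x \in signedperms n -> y \in signedperms n ->
  wle x y -> wle (pu x) (pu y).
Proof. by move=> sx sy xy; rewrite wle_rv pd_mono ?rv_signed // wle_rv. Qed.

Lemma diags_pu w : w \in signedperms n -> diags up (pu w) = diags up w.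
Proof. by move=> sw; rewrite -diags_dn rvK diags_pd ?rv_signed // diags_dn. Qed.

Lemma pu_eq x y : x \in signedperms n -> y \in signedperms n ->
  diags up x = diags up y -> pu x = pu y.
Proof.
move=> sx sy e; congr rv; apply/pd_eq; rewrite ?rv_signed //.
by rewrite !diags_dn.
Qed.

End Dual.

(** * Flips *)

Section Flips.
Variables (n : nat) (up : bool * 'I_n -> bool).
Notation L := (bool * 'I_n)%type.
Notation V := (bool * 'I_n.+1)%type.
Implicit Types (w x y : {perm L}) (a b c e f u v z : L) (p q r s : V).
Hypothesis up_neg : forall z, up (negl z) = ~~ up z.

Local Notation inA := (inA up).
Local Notation inB := (inB up).
Local Notation pdiag := (pdiag up).
Local Notation compat := (compat up).
Local Notation cross := (cross up).
Local Notation diags := (diags up).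

Lemma inA_neg p q u : inA (negl q) (negl p) u = inB p q (negl u).
Proof. rewrite inAE inBE up_neg !lab_neg; lia. Qed.

Lemma inB_neg p q u : inB (negl q) (negl p) u = inA p q (negl u).
Proof. rewrite inAE inBE up_neg !lab_neg; lia. Qed.

Lemma pdiag_neg p q : pdiag p q -> pdiag (negl q) (negl p).
Proof.
case/and3P => pq /existsP[u Au] /existsP[v Bv].
by apply: (@pdiagP _ _ _ _ (negl v) (negl u));
   rewrite ?inA_neg ?inB_neg ?neglK // !lab_neg; lia.
Qed.

Lemma compat_neg w p q : w \in signedperms n ->
  compat w (negl q) (negl p) = compat w p q.
Proof.
move=> sw; apply/compatP/compatP => h u v Au Bv; last first.
  by rewrite -bef_neg // h // -?inA_neg -?inB_neg.
by rewrite -bef_neg // h // ?inA_neg ?inB_neg neglK.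
Qed.

Lemma diags_neg w (D : {set V}) : w \in signedperms n ->
  D \in diags w -> (@negl n.+1) @: D \in diags w.
Proof.
move=> sw /diagsP[r [s [-> d h]]]; have d' := pdiag_neg d.
rewrite imsetU1 imset_set1 setUC in_diags ?(pdiag_lt d') // d'.
by rewrite compat_neg.
Qed.

(* For a < c adjacent in x: b is a vertex of the path when a and c are swapped. *)
Definition onpath x a c b : bool :=
  (lab a < lab b < lab c)%R && (if up b then bef x b a else bef x c b).

Lemma onpathE x a c b : onpath x a c b =
  (lab a < lab b < lab c)%R && (if up b then bef x b a else bef x c b).
Proof. by []. Qed.

(* If b lies between a and c on the path, the triangles added for a and for c
   are on different sides of b, so the order in which they are added is irrelevant. *)
Lemma onpath_diags x y a c b : cov x y a c -> onpath x a c b -> diags x = diags y.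
Proof.
move=> cv /andP[abc ob]; apply: sub_diags_eq => p q d /compatP h.
have pq := pdiag_lt d.
have key a' c' b' : inA p q a' -> inB p q c' -> (lab a' < lab b' < lab c')%R ->
    (if up b' then bef x b' a' else bef x c' b') -> False.
  move=> Aa Bc abc'; have Ia := inA_int pq Aa; have Ic := inB_int pq Bc.
  have [hA hB] : (inA p q b' = ~~ up b') * (inB p q b' = up b') by apply: mid_AB; lia.
  case: ifP => ub bb.
    by have := h _ _ Aa _; move=> /(_ b'); rewrite hB ub (bef_asym bb) => /(_ isT).
  by have := h b' _ _ Bc; rewrite hA ub (bef_asym bb) => /(_ isT).
case: cv => sx sy ac xac yE; apply/compatP => u v Au Bv; rewrite yE (h u v) //=.
apply/negP; rewrite /swp => /or4P[] /andP[/eqP e1 /eqP e2]; subst u v.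
- exact: key Au Bv abc ob.
- by have := h _ _ Au Bv; rewrite (bef_asym xac).
- apply: (key _ _ (negl b) Au Bv); rewrite ?lab_neg; first by lia.
  by rewrite up_neg !bef_neg //; case: (up b) ob.
by have := h _ _ Au Bv; rewrite bef_neg // (bef_asym xac).
Qed.

Definition swp1 a c e f : bool := (e == a) && (f == c) || (e == c) && (f == a).

(* Unlike in [cov] the mirror pair is not exchanged, so y need not be signed. *)
Definition tpos x y a c : Prop :=
  [/\ bef x a c, bef y c a & forall e f, bef y e f = bef x e f (+) swp1 a c e f].

Lemma tposC x y a c : tpos x y a c -> tpos y x c a.
Proof.
case=> h1 h2 h3; split => // e f; rewrite h3 -addbA [X in _ = _ (+) X](_ : _ = false) ?addbF //.
by rewrite /swp1; do ![case: eqP => //=].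
Qed.

Lemma tpos_adj x y a c e : tpos x y a c -> bef x a e -> bef x e c = false.
Proof.
case=> h1 h2 h3 ae; apply/negP => ec.
have nae : e != a by apply: contraTneq ae => ->; rewrite bef_irr.
have nec : e != c by apply: contraTneq ec => ->; rewrite bef_irr.
have yae : bef y a e.
  by rewrite h3 ae /swp1 (negbTE nae) (negbTE nec) andbF andbF.
have yec : bef y e c by rewrite h3 ec /swp1 (negbTE nae) (negbTE nec).
by have := bef_trans yae yec; rewrite bef_asym.
Qed.

(** This is the absence of path vertices between a and c at the moment of their exchange. Both label
    orders are allowed because [tpos] is also read backwards. *)
Definition clear_between x a c : Prop :=
  forall b, (lab a < lab b < lab c)%R || (lab c < lab b < lab a)%R ->
    if up b then bef x a b else bef x b c.

Lemma tpos_other x y a c e : tpos x y a c -> e != a -> e != c ->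
  (bef x a e = bef x c e) * (bef x e a = bef x e c) *
  (bef y a e = bef x a e) * (bef y e a = bef x e a) *
  (bef y c e = bef x c e) * (bef y e c = bef x e c).
Proof.
move=> t nea nec; have adj := tpos_adj t.
case: (t) => xac yca yE.
rewrite !yE /swp1 (negbTE nea) (negbTE nec) !andbF !addbF /=.
have h1 : bef x a e = bef x c e.
  apply/idP/idP => [ae|]; last exact: bef_trans.
  by rewrite -bef_total // adj.
have h2 : bef x e a = bef x e c.
  by rewrite -![bef x e _]bef_total 1?eq_sym // h1.
by rewrite h1 h2.
Qed.

Lemma clear_tpos x y a c : tpos x y a c -> clear_between x a c -> clear_between y c a.
Proof.
move=> t h b hb; have := h b; rewrite orbC hb => /(_ isT).
have nba : b != a by rewrite lab_eq; lia.
have nbc : b != c by rewrite lab_eq; lia.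
by rewrite !(tpos_other t nba nbc).
Qed.

(** A diagonal of x separating a from c is an edge of the path that lies between these two steps of
    the sweep, and only one edge of a path spans both labels. *)
Lemma tpos_edge x y a c : tpos x y a c -> clear_between x a c ->
  exists p q, [/\ pdiag p q, compat x p q, inA p q a, inB p q c &
    (forall p' q', (lab p' < lab q')%R -> compat x p' q' -> inA p' q' a -> inB p' q' c ->
       p' = p /\ q' = q)].
Proof.
move=> t hb; have adj e := @tpos_adj _ _ _ _ e t; case: (t) => xac yca yE.
have nac : a != c by apply: contraTneq xac => ->; rewrite bef_irr.
have [||b bb|p [q [pe Aa Bc]]] := @pathedge_ex n up [set z | ~~ bef x a z] c a.
- by rewrite inE xac.
- by rewrite inE bef_irr.
- rewrite inE; have := hb b; rewrite orbC bb => /(_ isT).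
  by case: ifP => _ h; rewrite ?h //; apply/negP => /negP; apply; apply/negP => /adj; rewrite h.
have pq : (lab p < lab q)%R by case: pe.
exists p, q; split => //; first exact: pdiagP Aa Bc.
  exact: pathedge_compat (@initial_le _ x a) pe.
move=> p' q' pq' xp' Aa' Bc'.
have pe' := compat_pathedge pq' xp' xac adj Aa' Bc'.
by apply: (pathedge_uniq pe' pe nac); rewrite ?(inA_int _ Aa) ?(inA_int _ Aa')
  ?(inB_int _ Bc) ?(inB_int _ Bc').
Qed.

Definition cflip (T : {set {set V}}) p q r s T' : Prop :=
  [/\ [set p; q] \in T, T' = (T :\ [set p; q]) :|: [set [set r; s]] &
      [set r; s] != [set p; q]].

Lemma tpos_keep x y a c p q : tpos x y a c -> (forall p' q', (lab p' < lab q')%R ->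
    compat x p' q' -> inA p' q' a -> inB p' q' c -> p' = p /\ q' = q) ->
  forall p' q', pdiag p' q' -> compat x p' q' -> [set p'; q'] != [set p; q] -> compat y p' q'.
Proof.
case=> xac yca yE un p' q' d h /eqP ne; have pq := pdiag_lt d; apply/compatP => u v Au Bv.
rewrite yE (compatP _ _ _ _ h) //=; apply/negP => /orP[] /andP[/eqP eu /eqP ev]; subst u v.
  by have [e1 e2] := un _ _ pq h Au Bv; apply: ne; rewrite e1 e2.
by have := compatP _ _ _ _ h _ _ Au Bv; rewrite (bef_asym xac).
Qed.

Lemma tpos_cflip x y a c : tpos x y a c -> clear_between x a c ->
  exists p q r s, [/\ pdiag p q, pdiag r s, cflip (diags x) p q r s (diags y) &
   [/\ inA p q a, inB p q c, inA r s c & inB r s a] /\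
   [/\ forall p' q', (lab p' < lab q')%R -> compat x p' q' ->
         inA p' q' a -> inB p' q' c -> p' = p /\ q' = q &
       forall p' q', (lab p' < lab q')%R -> compat y p' q' ->
         inA p' q' c -> inB p' q' a -> p' = r /\ q' = s]].
Proof.
move=> t hb; have t' := tposC t; have hb' := clear_tpos t hb.
have [p [q [d xp Aa Bc un]]] := tpos_edge t hb.
have [r [s [d' yr Ac Ba un']]] := tpos_edge t' hb'.
have pq := pdiag_lt d; have rs := pdiag_lt d'.
have ne : [set r; s] != [set p; q].
  by apply/eqP => /(pair_inj rs pq) [e1 e2]; move: Ba; rewrite e1 e2 (inAB Aa).
exists p, q, r, s; split => //; split => //; first by rewrite in_diags // d.
apply/setP => D; apply/idP/idP => [/diagsP[p' [q' [-> d1 h1]]]|].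
  rewrite in_setU in_set1 in_setD1; case: (eqVneq [set p'; q'] [set r; s]) => [|ne1].
    by rewrite orbT.
  have pq' := pdiag_lt d1.
  rewrite orbF in_diags // d1 (tpos_keep t' un') //= andbT.
  apply/eqP => /(pair_inj pq' pq) [e1 e2]; subst p' q'.
  case: t => _ yca _; have := compatP _ _ _ _ h1 _ _ Aa Bc.
  by rewrite (bef_asym yca).
rewrite in_setU in_set1 in_setD1 => /orP[/andP[ne1 /diagsP[p' [q' [eD d1 h1]]]]|/eqP ->].
  by rewrite eD in ne1 *; rewrite in_diags ?(pdiag_lt d1) // d1 (tpos_keep t un).
by rewrite in_diags // d'.
Qed.

End Flips.

(** * Signed covers as symmetric flips *)

Section SignedFlips.
Variables (n : nat) (up : bool * 'I_n -> bool).
Notation L := (bool * 'I_n)%type.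
Notation V := (bool * 'I_n.+1)%type.
Implicit Types (w x y : {perm L}) (a c b e f t u v z : L) (p q r s : V).
Hypothesis up_neg : forall z, up (negl z) = ~~ up z.

#[local] Opaque inA inB compat pdiag diags.

Local Notation inA := (inA up).
Local Notation inB := (inB up).
Local Notation pdiag := (pdiag up).
Local Notation compat := (compat up).
Local Notation cross := (cross up).
Local Notation diags := (diags up).

Lemma cov_clear x y a c : cov x y a c -> diags x <> diags y -> clear_between up x a c.
Proof.
move=> cv ne b hb; have no : ~~ onpath up x a c b.
  by apply/negP => /(onpath_diags up_neg cv).
have abc : (lab a < lab b < lab c)%R by case: cv => _ _ ac _ _; lia.
move: no; rewrite /onpath abc /=; case: ifP => _; rewrite bef_total // lab_eq; move: abc; clear; lia.
Qed.

Lemma tpos_tperm x a c : bef x a c -> (forall e, bef x a e -> bef x e c = false) ->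
  tpos x (tperm a c * x)%g a c.
Proof.
move=> xac adj; have nac : a != c by apply: contraTneq xac => ->; rewrite bef_irr.
have oth e : e != a -> e != c -> (bef x c e = bef x a e) * (bef x e c = bef x e a).
  move=> nea nec; split.
    by apply/idP/idP => [|ae]; [apply: bef_trans | rewrite -bef_total // adj].
  apply/idP/idP => [ec|ea]; last exact: bef_trans ea xac.
  by rewrite -bef_total 1?eq_sym //; apply/negP => /adj; rewrite ec.
split => // [|e f]; first by rewrite /bef !permM tpermL tpermR.
rewrite /swp1 {1}/bef !permM -/(bef x _ _).
case: (tpermP a c e) => [->|->|/eqP e1 /eqP e2]; case: (tpermP a c f) => [->|->|/eqP f1 /eqP f2];
  rewrite ?eqxx ?(negbTE nac) ?[c == a]eq_sym ?(negbTE nac) ?(negbTE e1) ?(negbTE e2)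
    ?(negbTE f1) ?(negbTE f2) ?andbF ?addbF ?bef_irr ?xac ?(bef_asym xac) //=;
  by rewrite ?(oth _ e1 e2) ?(oth _ f1 f2).
Qed.

#[local] Opaque bef lab signedperms negl swp.

(** A signed cover is one transposition when c = -a, and otherwise two, passing through an unsigned
    [y1]. Uniqueness of the separating diagonals makes the second flip the mirror image of the
    first. *)
Lemma cov_cflip x y a c : cov x y a c -> diags x <> diags y ->
  exists p q r s, [/\ pdiag p q, pdiag r s, compat x p q & compat y r s] /\
   [/\ inA p q a, inB p q c, inA r s c & inB r s a] /\
   (p = negl q /\ cflip (diags x) p q r s (diags y) \/
    p <> negl q /\ exists y1, cflip (diags x) p q r s (diags y1) /\
      cflip (diags y1) (negl q) (negl p) (negl s) (negl r) (diags y)).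
Proof.
move=> cv ne; have cl := cov_clear cv ne; have adj := @cov_adj _ _ _ _ _ _ cv.
have adj' := @cov_adj _ _ _ _ _ _ (cov_neg cv).
have yca := cov_bef cv; have yac := cov_bef (cov_neg cv).
have [sx sy ac xac _] := cv.
have nac : a != c by move: ac; rewrite lab_eq; clear; lia.
have nna : negl a != a by apply: negl_neq.
have nnc : negl c != c by apply: negl_neq.
case: (eqVneq c (negl a)) => [ce|nce].
  have t : tpos x y a c.
    split => // e f; have [_ _ _ _ ->] := cv; congr addb.
    by rewrite swp_lab /swp1 !lab_eq ce lab_neg opprK; move: (lab e) (lab f) (lab a); clear; lia.
  have [p [q [r [s [d d' F [[Aa Bc Ac Ba] [un _]]]]]]] := tpos_cflip t cl.
  have xp : compat x p q.
    by case: F; rewrite in_diags ?(pdiag_lt d) // => /andP[].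
  have yr : compat y r s.
    case: F => _ F _; have : [set r; s] \in diags y by rewrite F !inE eqxx orbT.
    by rewrite in_diags ?(pdiag_lt d') // => /andP[].
  exists p, q, r, s; split => //; split => //; left; split => //.
  have [] := un (negl q) (negl p); rewrite ?(pdiag_lt (pdiag_neg up_neg d)) //.
  - by rewrite compat_neg.
  - by rewrite inA_neg // -ce.
  by rewrite inB_neg // ce neglK.
have t := tpos_tperm xac adj; set y1 := (tperm a c * x)%g in t.
have [p [q [r [s [d d' F [[Aa Bc Ac Ba] [un un']]]]]]] := tpos_cflip t cl.
have xp : compat x p q by case: F; rewrite in_diags ?(pdiag_lt d) // => /andP[].
have yr : compat y1 r s.
  case: F => _ F _; have : [set r; s] \in diags y1 by rewrite F !inE eqxx orbT.
  by rewrite in_diags ?(pdiag_lt d') // => /andP[].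
have nca : negl c != a.
  by move: nce; rewrite !lab_eq !lab_neg; clear; lia.
have t1 : tpos y1 y (negl c) (negl a).
  have [_ _ _ _ yE] := cv; have [_ _ y1E] := t.
  split; [by rewrite y1E bef_neg // xac /swp1 (negbTE nca) (negbTE nnc) | exact: yac |].
  move=> e f; rewrite yE y1E -addbA; congr addb; rewrite swp_lab /swp1.
  rewrite !lab_eq !lab_neg; move: nac nce (lab_neq0 a) (lab_neq0 c); rewrite !lab_eq lab_neg.
  by move: (lab a) (lab c) (lab e) (lab f) => A C E G; clear;
    do ![case: eqP => //=]; lia.
have cl1 : clear_between up y1 (negl c) (negl a).
  move=> b hb; have := cl (negl b); rewrite !lab_neg up_neg in hb *.
  have -> : ((lab a < - lab b)%R && (- lab b < lab c)%R ||
     (lab c < - lab b)%R && (- lab b < lab a)%R) by move: hb; clear; lia.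
  move=> /(_ isT).
  have [_ _ y1E] := t; rewrite !y1E /swp1 (negbTE nca) (negbTE nnc) (negbTE nna).
  rewrite [negl a == c]eq_sym (negbTE nce) !andbF !addbF.
  rewrite -[bef x (negl b) c]bef_neg // -[bef x a _]bef_neg // !neglK.
  by case: (up b).
have [p2 [q2 [r2 [s2 [d2 d2' F2 [_ [un2 un2']]]]]]] := tpos_cflip t1 cl1.
have dn := pdiag_neg up_neg d.
(* A diagonal equal to its mirror image would have -c in [inA] and -a in [inB]. Then a would follow
   -c and precede -a, which are neighbours. *)
have nD : [set negl q; negl p] != [set p; q].
  apply/eqP => /(pair_inj (pdiag_lt dn) (pdiag_lt d)) [e1 e2].
  have Anc : inA p q (negl c) by have := inA_neg up_neg p q (negl c); rewrite e1 e2 neglK => ->.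
  have Bna : inB p q (negl a) by have := inB_neg up_neg p q (negl a); rewrite e1 e2 neglK => ->.
  have h1 := compatP _ _ _ _ xp _ _ Anc Bc; have h2 := compatP _ _ _ _ xp _ _ Aa Bna.
  have h3 : bef x (negl c) a.
    by rewrite -bef_total 1?eq_sym //; apply/negP => /adj; rewrite h1.
  by rewrite (adj' _ h3) in h2.
have [|||| e1 e2] := un2 (negl q) (negl p); rewrite ?(pdiag_lt dn) //.
- by apply: (tpos_keep t un) => //; rewrite compat_neg.
- by rewrite inA_neg // neglK.
- by rewrite inB_neg // neglK.
(* Otherwise rs would already be a diagonal of x, which has a before c. *)
have nE : [set r; s] != [set p2; q2].
  apply/eqP => E.
  have : [set r; s] \in diags x.
    by rewrite E -e1 -e2 in_diags ?(pdiag_lt dn) // dn compat_neg.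
  rewrite in_diags ?(pdiag_lt d') // => /andP[_ /compatP /(_ _ _ Ac Ba)].
  by rewrite (bef_asym xac).
have yr' : compat y r s by apply: (tpos_keep t1 un2).
have dn' := pdiag_neg up_neg d'.
have [|||| e3 e4] := un2' (negl s) (negl r); rewrite ?(pdiag_lt dn') //.
- by rewrite compat_neg.
- by rewrite inA_neg // neglK.
- by rewrite inB_neg // neglK.
exists p, q, r, s; split => //; split => //; right; split.
  by move=> e; move/eqP: nD; apply; rewrite e neglK setUC.
by exists y1; split => //; rewrite e1 e2 e3 e4.
Qed.

(** As t precedes c, it precedes a. No vertex between a and t is on the path just before a is
    passed, so one edge of that path spans and separates both. *)
Lemma adj_force x a c p q t : bef x a c -> (forall e, bef x a e -> bef x e c = false) ->
  (lab p < lab q)%R -> compat x p q -> inA p q a -> inB p q c ->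
  inA p q t -> t != a -> exists r s, [/\ pdiag r s, compat x r s, inA r s t & inB r s a].
Proof.
move=> xac adj pq xp Aa Bc At nta.
have iP : initial x [set e | bef x e a].
  by move=> z z'; rewrite !inE => h1 h2; apply: bef_trans h1.
have xtc := compatP _ _ _ _ xp _ _ At Bc.
have xta : bef x t a by rewrite -bef_total 1?eq_sym //; apply/negP => /adj; rewrite xtc.
have [||b hb|r [s [pe At' Ba]]] := @pathedge_ex n up [set e | bef x e a] a t.
- by rewrite inE bef_irr.
- by rewrite inE.
- have Ia := inA_int pq Aa; have It := inA_int pq At.
  have [hA hB] : (inA p q b = ~~ up b) * (inB p q b = up b) by apply: mid_AB; lia.
  rewrite inE; case: (boolP (up b)) => ub.
    by rewrite bef_asym // (compatP _ _ _ _ xp) ?hB.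
  have xbc : bef x b c by rewrite (compatP _ _ _ _ xp) ?hA.
  suff -> : bef x b a by [].
  by rewrite -bef_total; [apply/negP => /adj; rewrite xbc | rewrite lab_eq; move: hb; clear; lia].
exists r, s; split => //; last exact: pathedge_compat iP pe.
by case: pe => rs _ _; apply: pdiagP At' Ba.
Qed.

(** Diagonals other than pq force every other label of [inA] before a in y, and by symmetry every
    other label of [inB] after c. This puts the removed diagonal of a flip back into the lower
    triangulation. *)
Lemma force_diag x y a c p q : x \in signedperms n -> y \in signedperms n ->
  bef x a c -> (forall e, bef x a e -> bef x e c = false) ->
  pdiag p q -> compat x p q -> inA p q a -> inB p q c ->
  (forall r s, pdiag r s -> compat x r s -> [set r; s] != [set p; q] ->
     [set r; s] != [set negl q; negl p] -> compat y r s) ->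
  bef y a c -> compat y p q.
Proof.
move=> sx sy; move: a c p q.
pose H a c p q := [/\ bef x a c, (forall e, bef x a e -> bef x e c = false),
  pdiag p q, compat x p q & [/\ inA p q a, inB p q c, 
  (forall r s, pdiag r s -> compat x r s -> [set r; s] != [set p; q] ->
     [set r; s] != [set negl q; negl p] -> compat y r s) & bef y a c]].
have Hneg a c p q : H a c p q -> H (negl c) (negl a) (negl q) (negl p).
  case=> xac adj d xp [Aa Bc hz zac]; split.
  - by rewrite bef_neg.
  - move=> e; rewrite -[e]neglK !bef_neg // => h; apply/negP => /adj; by rewrite h.
  - exact: pdiag_neg.
  - by rewrite compat_neg.
  split; rewrite ?inA_neg ?inB_neg ?neglK ?bef_neg // => r s d' xr n1 n2.
  by apply: hz.
have keyA a c p q t : H a c p q -> inA p q t -> t != a ->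
    exists r s, [/\ pdiag r s, compat x r s, inA r s t & inB r s a].
  by case=> xac adj d xp [Aa Bc _ _]; apply: adj_force xac adj (pdiag_lt d) xp Aa Bc.
have keyB a c p q t : H a c p q -> inB p q t -> t != c ->
    exists r s, [/\ pdiag r s, compat x r s, inA r s c & inB r s t].
  move=> /Hneg h Bt ntc.
  have [|| r [s [d xr Ar Br]]] := keyA _ _ _ _ (negl t) h.
  - by rewrite inA_neg // neglK.
  - by rewrite (inj_eq (@negl_inj n)).
  exists (negl s), (negl r); split; rewrite ?compat_neg ?inA_neg ?inB_neg //.
  exact: pdiag_neg.
have claim a c p q t : H a c p q -> inA p q t -> t != a -> bef y t a.
  move=> h At nta; have h' := Hneg _ _ _ _ h.
  have [r [s [d xr Ar Br]]] := keyA _ _ _ _ _ h At nta.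
  case: (h) => xac adj dp xp [Aa Bc hz zac].
  case: (eqVneq [set r; s] [set p; q]) => [e|n1].
    by have [e1 e2] := pair_inj (pdiag_lt d) (pdiag_lt dp) e; rewrite e1 e2 (inAB Aa) in Br.
  case: (eqVneq [set r; s] [set negl q; negl p]) => [e|n2]; last first.
    by have /compatP := hz _ _ d xr n1 n2; apply.
  have dn := pdiag_neg up_neg dp.
  have [e1 e2] := pair_inj (pdiag_lt d) (pdiag_lt dn) e; subst r s.
  (* The forcing diagonal is now the mirror image of pq, which y is not known to keep; the order is
     obtained along t, -c, -a, a instead. *)
  have z1 : bef y (negl c) (negl a) by rewrite bef_neg.
  have z2 : bef y (negl a) a.
    have [| r [s [d1 xr1 Ar1 Br1]]] := keyB _ _ _ _ a h' Br; first by rewrite eq_sym negl_neq.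
    apply: (compatP _ _ _ _ (hz _ _ d1 xr1 _ _)) => //; apply/eqP => e'.
      have [e1 e2] := pair_inj (pdiag_lt d1) (pdiag_lt dp) e'.
      by rewrite e1 e2 (inAB Aa) in Br1.
    have [e1 e2] := pair_inj (pdiag_lt d1) (pdiag_lt dn) e'.
    by have := inAB Ar1; rewrite e1 e2 inB_neg // neglK Aa.
  case: (eqVneq t (negl c)) => [->|ntc]; first exact: bef_trans z1 z2.
  suff z0 : bef y t (negl c) by apply: bef_trans (bef_trans z0 z1) z2.
  have [r [s [d1 xr1 Ar1 Br1]]] := keyA _ _ _ _ _ h' Ar ntc.
  apply: (compatP _ _ _ _ (hz _ _ d1 xr1 _ _)) => //; apply/eqP => e'.
    have [e1 e2] := pair_inj (pdiag_lt d1) (pdiag_lt dp) e'; subst r s.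
    have := compatP _ _ _ _ xp _ _ Aa Br1; rewrite bef_asym //.
    by apply: (compatP _ _ _ _ xr); rewrite // inA_neg // neglK.
  have [e1 e2] := pair_inj (pdiag_lt d1) (pdiag_lt dn) e'.
  by have := Br1; rewrite e1 e2 inB_neg // neglK => /inAB; rewrite Bc.
move=> a c p q xac adj d xp Aa Bc hz zac; have h : H a c p q by [].
apply/compatP => t t' At Bt'.
have h1 : t = a \/ bef y t a.
  by case: (eqVneq t a) => [->|nt]; [left | right; apply: claim h At nt].
have h2 : c = t' \/ bef y c t'.
  case: (eqVneq c t') => [->|nt]; [by left | right].
  rewrite -bef_neg //; apply: claim (Hneg _ _ _ _ h) _ _.
    by rewrite inA_neg // neglK.
  by rewrite (inj_eq (@negl_inj n)) eq_sym.
case: h1 => [->|h1]; case: h2 => [<-|h2] //.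
- exact: bef_trans zac h2.
- exact: bef_trans h1 zac.
exact: bef_trans (bef_trans h1 zac) h2.
Qed.

(** [violated_cross] preserves the order of the middle labels, so an inversion of [pd v] missing in
    w would yield a crossing in the opposite order. This is how slopes will imply weak order. *)
Lemma pd_le_of_cross (v w : {perm L}) : v \in signedperms n -> w \in signedperms n ->
  (forall p q r s a c, pdiag p q -> compat v p q -> ~~ compat w p q ->
     pdiag r s -> compat w r s -> inA p q a -> inB r s a -> inB p q c -> inA r s c ->
     (lab a < lab c)%R) ->
  wle (pd up v) w.
Proof.
move=> sv sw h; apply/subsetP => -[a c] hac.
have ac : (lab a < lab c)%R by move: hac; rewrite in_ivs => /andP[].
rewrite in_ivs ac /=; apply: (pd_separated up_neg sv) hac => {ac}p q {}a {}c d vp Ac Ba ac.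
case: (boolP (compat w p q)) => [/compatP|nw]; first by apply.
have nac : c != a by rewrite lab_eq; lia.
rewrite -bef_total 1?eq_sym //; apply/negP => wac.
have [r [s [u' [v' [[d' wr Au Bu] [Bv Av e]]]]]] := violated_cross (pdiag_lt d) Ba Ac wac.
have lt_uv := h _ _ _ _ _ _ d vp nw d' wr Au Bu Bv Av.
by rewrite ac in e; rewrite ltNge (ltW e) in lt_uv.
Qed.

End SignedFlips.

(** * Surjectivity *)

(* In a shortest cycle the smallest vertex could be skipped. *)
Lemma acyclic_shortcut (T : eqType) (F : T -> int) (r : rel T) :
  (forall x y, F x = F y -> x = y) -> irreflexive r ->
  (forall s m t, r s m -> r m t -> (F m < F s)%R -> (F m < F t)%R -> r s t) ->
  forall p, path.cycle r p -> p = [::].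
Proof.
move=> Finj irr short p; have [N leN] := ubnP (size p).
elim: N p leN => // N IH [//|x0 p0] leN cyc.
have [m mp mmin] : exists2 m, m \in x0 :: p0 & forall y, y \in x0 :: p0 -> (F m <= F y)%R.
  elim: (x0 :: p0) (isT : x0 :: p0 != [::]) => {leN cyc} // x s IHs _.
  case: (eqVneq s [::]) => [->|/IHs [m ms hm]].
    by exists x => [|y]; rewrite mem_seq1 // => /eqP ->.
  case: (leP (F x) (F m)) => h.
    exists x => [|y]; rewrite in_cons ?eqxx // => /orP[/eqP -> //|/hm].
    exact: le_trans.
  exists m => [|y]; rewrite in_cons ?ms ?orbT // => /orP[/eqP ->|/hm //].
  exact: ltW.
have [i q qE] := rot_to mp; rewrite -(path.rot_cycle i) qE in cyc.
have sq : size (m :: q) = size (x0 :: p0) by rewrite -qE size_rot.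
have qmin y : y \in q -> (F m <= F y)%R.
  by move=> yq; apply: mmin; rewrite -(mem_rot i) qE in_cons yq orbT.
case: q {qE} qmin sq cyc => [|t q] qmin sq; first by rewrite /= irr.
rewrite /= rcons_path => /and3P[mt pt lm].
have lt_m y : y \in t :: q -> y <> m -> (F m < F y)%R.
  by move=> yq ne; rewrite lt_neqAle qmin // andbT; apply/eqP => /Finj /esym.
have h : path.cycle r (t :: q).
  rewrite /= rcons_path pt /=; apply: (short _ _ _ lm mt).
    by apply: lt_m; [rewrite mem_last | move=> e; rewrite e irr in lm].
  by apply: lt_m; [rewrite mem_head | move=> e; rewrite e irr in mt].
by have : t :: q = [::] by [apply: IH h; rewrite -sq in leN].
Qed.

Section Surjectivity.
Variables (n : nat) (up : bool * 'I_n -> bool).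
Notation L := (bool * 'I_n)%type.
Notation V := (bool * 'I_n.+1)%type.
Implicit Types (w : {perm L}) (a c b e f t u v z : L) (p q r s : V).
Hypothesis up_neg : forall z, up (negl z) = ~~ up z.

Local Notation inA := (inA up).
Local Notation inB := (inB up).
Local Notation pdiag := (pdiag up).
Local Notation compat := (compat up).
Local Notation cross := (cross up).
Local Notation diags := (diags up).

Lemma label_between p q (x : V) : (lab p < lab x < lab q)%R -> exists z : L, lab z = lab x.
Proof.
move=> h; apply: lab_ex; first exact: lab_neq0.
by have := lab_bound p; have := lab_bound q; lia.
Qed.

(** Provides the hypothesis of [acyclic_shortcut]: if neither diagonal separated s from t, then m
    and one of s, t or the end q' would witness a crossing. *)
Lemma shortcut p' q' p q (s m t : L) : (lab p' < lab q')%R -> (lab p < lab q)%R ->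
  ~ cross p q p' q' -> inA p' q' s -> inB p' q' m -> inA p q m -> inB p q t ->
  (lab m < lab s)%R -> (lab m < lab t)%R -> inB p' q' t \/ inA p q s.
Proof.
move=> pq' pq ncr As Bm Am Bt ms mt.
case: (boolP (inB p' q' t)) => [|nB]; [by left | right].
apply/negPn/negP => nA.
have nx v : ~~ (inB p q v && inA p' q' v).
  by apply/negP => /andP[Bv Av]; apply: ncr; exists m, v.
have nt := nx t; have ns := nx s.
(* When q' is inside the span of pq, its label is one more candidate for a crossing. *)
case: (boolP ((lab p < lab q')%R && (lab q' < lab q)%R)) => [h|h].
  have [z zE] := label_between h; have nz := nx z.
  have sz : up z != up s -> lab s != lab z.
    by apply: contraNneq => /lab_inj ->.
  move: As Bm Am Bt nA nB nt ns nz sz; rewrite !(inAE, inBE) zE.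
  move: (lab p) (lab q) (lab p') (lab q') (lab s) (lab m) (lab t) pq pq' h ms mt.
  by case: (up s); case: (up m); case: (up t); case: (up z) => //=; clear; lia.
move: As Bm Am Bt nA nB nt ns; rewrite !(inAE, inBE).
move: (lab p) (lab q) (lab p') (lab q') (lab s) (lab m) (lab t) pq pq' h ms mt.
by case: (up s); case: (up m); case: (up t) => //=; clear; lia.
Qed.

Definition noncrossing_family (T : {set {set V}}) : Prop :=
  (forall D, D \in T -> exists p q, D = [set p; q] /\ pdiag p q) /\
  (forall p q r s, pdiag p q -> pdiag r s -> [set p; q] \in T -> [set r; s] \in T ->
     ~ cross p q r s).

Definition maximal_family (T : {set {set V}}) : Prop :=
  forall p q, pdiag p q -> [set p; q] \notin T ->
    exists r s, [/\ pdiag r s, [set r; s] \in T & cross p q r s].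

Definition centrally_symmetric (T : {set {set V}}) : Prop :=
  forall D : {set V}, D \in T -> (@negl n.+1) @: D \in T.

Lemma diags_noncrossing w : noncrossing_family (diags w).
Proof.
split=> [D /diagsP[p [q [-> d _]]]|p q r s d d']; first by exists p, q.
rewrite !in_diags ?(pdiag_lt d) ?(pdiag_lt d') // d d' => h h'.
exact: compat_noncross h h'.
Qed.

Lemma diags_maximal w : maximal_family (diags w).
Proof.
move=> p q d; rewrite in_diags ?(pdiag_lt d) // d /=.
case/(notcompat_cross (pdiag_lt d)) => r [s [d' h cr]].
by exists r, s; rewrite in_diags ?(pdiag_lt d') // d'.
Qed.

Lemma maximal_family_eq T T' : maximal_family T -> noncrossing_family T' ->
  T \subset T' -> T = T'.
Proof.
move=> mT [dT' nT'] /subsetP sub; apply/setP => D; apply/idP/idP => [/sub //|DT'].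
have [p [q [DE d]]] := dT' _ DT'; rewrite DE in DT' *.
apply/negPn/negP => /(mT _ _ d) [r [s [d' rs]]].
exact: (nT' _ _ _ _ d d' DT' (sub _ rs)).
Qed.

(** The number of predecessors minus the number of successors increases along r and changes sign
    under negation. Breaking ties by label keeps the order symmetric. *)
Lemma symmetric_extension (r : rel L) :
  (forall c : seq L, path.cycle r c -> c = [::]) -> (forall u v, r u v -> r (negl v) (negl u)) ->
  exists2 w, w \in signedperms n & forall u v, r u v -> bef w u v.
Proof.
move=> acyc rneg.
have cneg u v : connect r u v -> connect r (negl v) (negl u).
  case/connectP => l pp ->; elim: l u pp => [|e l IH] u /=; first by rewrite connect0.
  by case/andP => /rneg/connect1 h /IH h'; apply: connect_trans h' h.
have nback u v : r u v -> connect r v u = false.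
  move=> uv; apply/negP => /connectP[l pp uE].
  by have := acyc (v :: l); rewrite /= rcons_path pp -uE uv => /(_ isT).
pose below u := #|[set z | connect r z u]|; pose above u := #|[set z | connect r u z]|.
have below_neg u : below (negl u) = above u.
  rewrite /below /above -(card_imset [set z : L | connect r u z] (@negl_inj n)); apply: eq_card => z.
  rewrite inE; apply/idP/imsetP => [h|[t]]; rewrite ?inE.
    by exists (negl z); rewrite ?neglK // inE; have := cneg _ _ h; rewrite neglK.
  by move=> h ->; have := cneg _ _ h.
have above_neg u : above (negl u) = below u by rewrite -below_neg neglK.
pose h u : int := (Posz (below u) - Posz (above u))%R.
have h_lt u v : r u v -> (h u < h v)%R.
  move=> uv; have l1 : (below u < below v)%N.
    apply: proper_card; apply/properP; split.
      by apply/subsetP => z; rewrite !inE => zu; apply: connect_trans zu (connect1 uv).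
    by exists v; rewrite inE ?connect0 // nback.
  have l2 : (above v <= above u)%N.
    apply: subset_leq_card; apply/subsetP => z; rewrite !inE => vz.
    exact: connect_trans (connect1 uv) vz.
  by rewrite /h; lia.
have h_neg u : h (negl u) = (- h u)%R by rewrite /h below_neg above_neg opprB.
pose lt u v := (h u < h v)%R || (h u == h v) && (lab u < lab v)%R.
have [|y x z|x y|x y|w sw wE] := @build n lt.
- by move=> x; rewrite /lt !ltxx andbF.
- by rewrite /lt; clear; lia.
- by rewrite /lt lab_eq; clear; lia.
- by rewrite /lt !h_neg !lab_neg; clear; lia.
by exists w => // u v uv; rewrite wE /lt h_lt.
Qed.

(** Each diagonal of T requires its [inA] before its [inB]. Noncrossing makes the requirements
    acyclic, and maximality of T excludes further diagonals. *)
Lemma diags_surj T : noncrossing_family T -> maximal_family T -> centrally_symmetric T ->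
  exists2 w, w \in signedperms n & diags w = T.
Proof.
move=> nT mT sT; have [dT ncT] := nT.
pose r u v := [exists p : V, exists q : V,
  [&& [set p; q] \in T, pdiag p q, inA p q u & inB p q v]].
have rP u v : reflect (exists p q, [/\ [set p; q] \in T, pdiag p q, inA p q u & inB p q v])
    (r u v).
  apply: (iffP existsP) => [[p /existsP[q /and4P[]]]|[p [q [h1 h2 h3 h4]]]].
    by exists p, q.
  by exists p; apply/existsP; exists q; rewrite h1 h2 h3.
have [l cyc|u v|w sw wE] := @symmetric_extension r.
- apply: (acyclic_shortcut (F := @lab n) (@lab_inj n) _ _ cyc).
    move=> u; apply/rP => -[p1 [q1 [h1 h2 h3 h4]]].
    by rewrite (inAB h3) in h4.
  move=> s m t /rP[p1 [q1 [pT1 d1 As Bm]]] /rP[p2 [q2 [pT2 d2 Am Bt]]] ms mt.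
  apply/rP.
  have [] := shortcut (pdiag_lt d1) (pdiag_lt d2) (ncT _ _ _ _ d2 d1 pT2 pT1) As Bm Am Bt ms mt.
    by exists p1, q1.
  by exists p2, q2.
- move=> /rP[p [q [pT d Au Bv]]]; apply/rP; exists (negl q), (negl p); split.
  + by have := sT _ pT; rewrite imsetU1 imset_set1 setUC.
  + exact: pdiag_neg.
  + by rewrite inA_neg // neglK.
  by rewrite inB_neg // neglK.
exists w => //; apply/esym/maximal_family_eq => //; first exact: diags_noncrossing.
apply/subsetP => D DT; have [p [q [DE d]]] := dT _ DT; rewrite DE in_diags ?(pdiag_lt d) // d.
by apply/compatP => u v Au Bv; apply: wE; apply/rP; exists p, q; rewrite -DE.
Qed.
End Surjectivity.

(** * Forcing *)

Section Rearrangements.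
Variable n : nat.
Notation L := (bool * 'I_n)%type.
Implicit Types (w x y M : {perm L}) (a c b d e f p q r u v z : L) (i j k : int).

Lemma lab_signed x e : x \in signedperms n -> lab (x (negl e)) = (- lab (x e))%R.
Proof. by move/signedP => ->; rewrite lab_neg. Qed.

Lemma pos_neq x e f : (lab (x e) < lab (x f))%R -> e != f.
Proof. by apply: contraTneq => ->; rewrite ltxx. Qed.

Lemma cov_uniq x y y' a c : cov x y a c -> cov x y' a c -> y = y'.
Proof. by move=> h h'; apply: ivs_inj; rewrite (cov_ivs h) (cov_ivs h'). Qed.

Lemma rf_posL x u v : u != v -> ((rf u v * x)%g u = x v) * ((rf u v * x)%g v = x u).
Proof. by move=> uv; rewrite !permM !rfE // !eqxx eq_sym (negbTE uv). Qed.

Lemma rf_posO x u v e : u != v -> (lab e != lab u) && (lab e != lab v) &&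
  (lab e != - lab u)%R && (lab e != - lab v)%R -> (rf u v * x)%g e = x e.
Proof.
move=> uv; rewrite permM rfE // !lab_eq !lab_neg.
by case/andP => /andP[/andP[/negbTE -> /negbTE ->] /negbTE ->] /negbTE ->.
Qed.

Lemma swap_up x u v : x \in signedperms n -> (lab u < lab v)%R ->
  nxt (lab (x u)) (lab (x v)) -> exists2 y, cov x y u v & y = (rf u v * x)%g.
Proof. by move=> sx uv h; exists (rf u v * x)%g => //; apply: cov_rf. Qed.

Lemma swap_down x u v : x \in signedperms n -> (lab v < lab u)%R ->
  nxt (lab (x u)) (lab (x v)) -> exists2 y, cov y x v u & y = (rf u v * x)%g.
Proof.
move=> sx vu h; have nvu : v != u by rewrite lab_eq lt_eqF.
have nuv : u != v by rewrite eq_sym.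
have rC : rf u v = rf v u.
  apply/permP => z; rewrite !rfE //; apply: lab_inj.
  move: nvu (lab_neq0 u) (lab_neq0 v).
  rewrite !lab_eq !(lab_neg, fun_if (@negl n), fun_if (@lab n)).
  by move: (lab u) (lab v) (lab z); clear => U W Z; do ![case: eqP => //=]; lia.
exists (rf u v * x)%g => //; rewrite rC.
have := @cov_rf n (rf v u * x)%g v u; rewrite mulgA rfK // mul1g; apply => //.
  by rewrite signedM ?rf_signed.
by rewrite !(rf_posL _ nvu).
Qed.

(* Entries in consecutive positions; [oct] is about the first two positive ones. *)
Definition blk x i p q r : Prop :=
  [/\ lab (x p) = i, lab (x q) = (i + 1)%R & lab (x r) = (i + 2)%R].

Definition oct x p q : Prop := lab (x p) = 1%R /\ lab (x q) = 2%R.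

Variable up : L -> bool.

(* The label b lies on the path while the entries in positions i to j are being
   rearranged. *)
Definition bout x i j b : bool :=
  if up b then (lab (x b) < i)%R else (j < lab (x b))%R.

Lemma boutE x i j b : bout x i j b = if up b then (lab (x b) < i)%R else (j < lab (x b))%R.
Proof. by []. Qed.


(** The reflection also moves the mirror entries, so the block must avoid its mirror image or equal
    it; hence the condition on i and j. *)
Lemma bout_rf x i j b u v : x \in signedperms n -> u != v ->
  (i <= lab (x u) <= j)%R -> (i <= lab (x v) <= j)%R -> (0 < i)%R || (j == - i)%R ->
  bout x i j b -> bout (rf u v * x)%g i j b.
Proof.
move=> sx uv hu hv ij; rewrite /bout permM rfE //.
case: eqP => [->|_]; first by case: ifP; move: hu hv ij; clear; lia.
case: eqP => [->|_]; first by case: ifP; move: hu hv ij; clear; lia.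
case: eqP => [->|_]; first by rewrite !lab_signed //; case: ifP; move: hu hv ij; clear; lia.
case: eqP => [->|_] //; by rewrite !lab_signed //; case: ifP; move: hu hv ij; clear; lia.
Qed.

Lemma bout_onpath x i j a c b : bout x i j b -> (lab a < lab b < lab c)%R ->
  (i <= lab (x a))%R -> (lab (x c) <= j)%R -> onpath up x a c b.
Proof.
rewrite /bout /onpath => h -> h1 h2; rewrite /bef /=; move: h; case: ifP => _;
by move: h1 h2; clear; lia.
Qed.

Lemma blk_facts x i p q r : x \in signedperms n -> blk x i p q r -> (0 < i)%R ->
  [/\ p != q, q != r, p != r &
      [/\ (lab r != lab p) && (lab r != lab q) && (lab r != - lab p)%R && (lab r != - lab q)%R &
          (lab p != lab q) && (lab p != lab r) && (lab p != - lab q)%R && (lab p != - lab r)%R]].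
Proof.
move=> sx [hp hq hr] i0; have key e f : (lab (x e) + lab (x f) > 0)%R -> lab (x e) != lab (x f) ->
    (lab e != lab f) && (lab e != - lab f)%R.
  move=> h1 h2; rewrite -lab_neg -!lab_eq; apply/andP; split.
    by apply: contraNneq h2 => ->.
  by apply: contraTneq h1 => ->; rewrite lab_signed //; clear; lia.
have [||k1 k1'] := andP (key p q _ _); rewrite ?hp ?hq; try by move: i0; clear; lia.
have [||k2 k2'] := andP (key q r _ _); rewrite ?hr ?hq; try by move: i0; clear; lia.
have [||k3 k3'] := andP (key p r _ _); rewrite ?hr ?hp; try by move: i0; clear; lia.
rewrite !lab_eq; split => //; split; move: k1 k1' k2 k2' k3 k3'; clear; lia.
Qed.

(** The direction of the exchange is left open until the labels are compared. *)
Definition swapped x y u v : Prop :=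
  [/\ y \in signedperms n, (lab u < lab v)%R -> cov x y u v &
      (lab v < lab u)%R -> cov y x v u].

Lemma swap_ex x u v : x \in signedperms n -> nxt (lab (x u)) (lab (x v)) ->
  u != v /\ swapped x (rf u v * x)%g u v.
Proof.
move=> sx h; have uv : u != v.
  by apply: contraTneq h => ->; rewrite /nxt; move: (lab (x v)) => k; clear; lia.
split => //; split; first by rewrite signedM ?rf_signed.
  by move=> luv; have [y cv <-] := swap_up sx luv h.
by move=> lvu; have [y cv <-] := swap_down sx lvu h.
Qed.

(** [blk12] and [blk23] are the steps around a hexagon of the weak order; [octc] and [octp] are
    those around an octagon. *)
Lemma blk12 x i p q r : x \in signedperms n -> blk x i p q r -> (0 < i)%R ->
  exists y, [/\ swapped x y p q, blk y i q p r &
    forall b, bout x i (i + 2) b -> bout y i (i + 2) b].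
Proof.
move=> sx B i0; have [pq qr pr [rO _]] := blk_facts sx B i0; case: (B) => hp hq hr.
have [|_ sw] := @swap_ex x p q sx; first by rewrite hp hq /nxt; move: i0; clear; lia.
exists (rf p q * x)%g; split => //; first by rewrite /blk !(rf_posL _ pq) rf_posO.
by move=> b; apply: bout_rf => //; rewrite ?hp ?hq ?hr; move: i0; clear; lia.
Qed.

Lemma blk23 x i p q r : x \in signedperms n -> blk x i p q r -> (0 < i)%R ->
  exists y, [/\ swapped x y q r, blk y i p r q &
    forall b, bout x i (i + 2) b -> bout y i (i + 2) b].
Proof.
move=> sx B i0; have [pq qr pr [_ pO]] := blk_facts sx B i0; case: (B) => hp hq hr.
have [|_ sw] := @swap_ex x q r sx; first by rewrite hr hq /nxt; move: i0; clear; lia.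
exists (rf q r * x)%g; split => //; first by rewrite /blk !(rf_posL _ qr) rf_posO.
by move=> b; apply: bout_rf => //; rewrite ?hp ?hq ?hr; move: i0; clear; lia.
Qed.

Lemma oct_facts x p q : x \in signedperms n -> oct x p q ->
  [/\ p != q, lab q != lab p & lab q != - lab p]%R.
Proof.
move=> sx [hp hq].
have pq : p != q by apply: (@pos_neq x); rewrite hp hq.
have npq : negl p != q by apply: (@pos_neq x); rewrite lab_signed // hp hq.
by split; rewrite // -?lab_neg -lab_eq eq_sym.
Qed.

Lemma octc x p q : x \in signedperms n -> oct x p q ->
  exists y, [/\ swapped x y (negl p) p, oct y (negl p) q &
    forall b, bout x (-2) 2 b -> bout y (-2) 2 b].
Proof.
move=> sx O; have [pq h1 h2] := oct_facts sx O; case: (O) => hp hq.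
have hn : lab (x (negl p)) = (- 1)%R by rewrite lab_signed // hp.
have [|np sw] := @swap_ex x (negl p) p sx; first by rewrite hp hn.
exists (rf (negl p) p * x)%g; split => //.
  rewrite /oct !(rf_posL _ np) rf_posO // lab_neg; move: h1 h2; clear; lia.
by move=> b; apply: bout_rf; rewrite ?hp ?hn.
Qed.

Lemma octp x p q : x \in signedperms n -> oct x p q ->
  exists y, [/\ swapped x y p q, oct y q p &
    forall b, bout x (-2) 2 b -> bout y (-2) 2 b].
Proof.
move=> sx O; have [pq h1 h2] := oct_facts sx O; case: (O) => hp hq.
have [|_ sw] := @swap_ex x p q sx; first by rewrite hp hq.
exists (rf p q * x)%g; split => //; first by rewrite /oct !(rf_posL _ pq).
by move=> b; apply: bout_rf; rewrite ?hp ?hq.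
Qed.

Lemma relocate M d k : M \in signedperms n -> (forall z : int, k != 2 * z)%R ->
  exists2 x, x \in signedperms n & forall e f,
    let K z := if lab z == lab d then k else if lab z == (- lab d)%R then (- k)%R
               else (2 * lab (M z))%R in
    bef x e f = (K e < K f)%R.
Proof.
move=> sM odd_k.
pose K z := if lab z == lab d then k else if lab z == (- lab d)%R then (- k)%R
            else (2 * lab (M z))%R.
have Kneg z : K (negl z) = (- K z)%R.
  rewrite /K lab_neg lab_signed //; have := lab_neq0 d.
  by do ![case: eqP => //]; move: (lab z) (lab d) (lab (M z)); clear; lia.
have Kinj e f : K e = K f -> e = f.
  have h e' f' : lab e' = lab f' \/ lab (M e') = lab (M f') -> e' = f'.
    by case=> [/lab_inj // | /lab_inj /perm_inj].
  have o1 := odd_k (lab (M e)); have o2 := odd_k (lab (M f)).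
  have o3 := odd_k (- lab (M e))%R; have o4 := odd_k (- lab (M f))%R; have o5 := odd_k 0%R.
  move=> E; apply: h; move: E; rewrite /K.
  by do ![case: eqP => //]; move: o1 o2 o3 o4 o5; move: (lab e) (lab f) (lab d) (lab (M e)) (lab (M f)); clear; lia.
have [|y x z|x y|x y|w sw wE] := @build n (fun e f => K e < K f)%R.
- by move=> x; rewrite ltxx.
- exact: lt_trans.
- by move=> xy; case: (ltgtP (K x) (K y)) => // /Kinj e; rewrite e eqxx in xy.
- by rewrite !Kneg ltrN2.
by exists w.
Qed.

End Rearrangements.

(** * Forcing around hexagons and octagons *)

Section Congruence.
Variables (n : nat) (Rl : {perm bool * 'I_n} -> {perm bool * 'I_n} -> Prop).
Notation L := (bool * 'I_n)%type.
Implicit Types (w x y z m t u : {perm L}) (a c b d e f v : L).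
Hypothesis n_ge2 : 2 <= n.
Hypothesis cong : lattice_congruence Rl.

Lemma is_meetP x y m : x \in signedperms n -> y \in signedperms n -> m \in signedperms n ->
  wle m x -> wle m y ->
  (forall t, t \in signedperms n -> wle t x -> wle t y -> wle t m) -> is_meet x y m.
Proof.
move=> sx sy sm mx my h; split => //; rewrite !weak_leE //; split => //; split => // t st.
by rewrite !weak_leE //; apply: h.
Qed.

Lemma is_joinP x y m : x \in signedperms n -> y \in signedperms n -> m \in signedperms n ->
  wle x m -> wle y m ->
  (forall t, t \in signedperms n -> wle x t -> wle y t -> wle m t) -> is_join x y m.
Proof.
move=> sx sy sm mx my h; split => //; rewrite !weak_leE //; split => //; split => // t st.
by rewrite !weak_leE //; apply: h.
Qed.

Lemma cong_sym x y : x \in signedperms n -> y \in signedperms n -> Rl x y -> Rl y x.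
Proof. by case: cong => _ [h _]; apply: h. Qed.

Lemma cong_trans y x z : x \in signedperms n -> y \in signedperms n ->
  z \in signedperms n -> Rl x y -> Rl y z -> Rl x z.
Proof. by case: cong => _ [_ [h _]]; apply: h. Qed.

Lemma cong_convex x y z : x \in signedperms n -> y \in signedperms n ->
  z \in signedperms n -> wle x y -> wle y z -> Rl x z -> Rl x y /\ Rl y z.
Proof.
move=> sx sy sz xy yz xz.
have R : Rl x y.
  case: cong => _ [_ [_ [h _]]]; apply: (h x z y) => //.
    by apply: is_meetP => //; apply: wle_refl.
  by apply: is_meetP => //; apply: wle_refl.
split => //; apply: (@cong_trans x) => //; exact: cong_sym.
Qed.

(* Meeting u, u' with y contracts the cover x < y as soon as the inversion (a, c)
   is lost in the meet with u; [contract_above] is the dual statement. *)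
Lemma contract_below x y a c u u' : cov x y a c -> u \in signedperms n ->
  u' \in signedperms n -> Rl u u' -> wle y u' ->
  (forall m, m \in signedperms n -> wle m y -> wle m u -> bef m c a = false) -> Rl x y.
Proof.
move=> cv su su' uu' yu' h; have [sx sy ac _ _] := cv.
have [m [sm my mu hm]] := meet_ex sy su.
have my' : Rl m y.
  have [_ [_ [_ [hh _]]]] := cong; apply: (hh u u' y) => //.
    by apply: is_meetP => // t st tu ty; apply: hm.
  by apply: is_meetP => //; apply: wle_refl.
have mx : wle m x by apply: (cov_wle_below cv) => //; rewrite in_ivs h // andbF.
by have [] := cong_convex sm sx sy mx (cov_wle cv) my'.
Qed.

Lemma contract_above x y a c m m' : cov x y a c -> m \in signedperms n ->
  m' \in signedperms n -> Rl m m' -> wle m x ->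
  (forall t, t \in signedperms n -> wle x t -> wle m' t -> bef t c a) -> Rl x y.
Proof.
move=> cv sm sm' mm' mx h; have [sx sy ac _ _] := cv.
have [t [st xt m't ht]] := join_ex sx sm'.
have xt' : Rl x t.
  have [_ [_ [_ [_ hh]]]] := cong; apply: (hh m m' x) => //.
    by apply: is_joinP => //; apply: wle_refl.
  by apply: is_joinP => // t' st' h1 h2; apply: ht.
have yt : wle y t by apply: (cov_wle_above cv) => //; rewrite in_ivs h // ac.
by have [] := cong_convex sx sy st (cov_wle cv) yt xt'.
Qed.

Lemma wle_bef x y e f : wle x y -> (lab e < lab f)%R -> bef x f e -> bef y f e.
Proof. by move/wleP => h; apply: h. Qed.

Lemma wle_nbef x y e f : wle x y -> (lab e < lab f)%R -> bef y e f -> bef x e f.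
Proof.
move=> xy ef yef; rewrite -bef_total; last by rewrite lab_eq eq_sym lt_eqF.
by apply/negP => /(wle_bef xy ef); rewrite bef_asym.
Qed.

(** Below both u and y, a precedes d and d precedes c, so the pair a, c stays uninverted. In the
    four variants the contracted cover exchanges a, d or d, c, and acts from above or from below. *)
Lemma contract_below_lo x y a c d u u' : cov x y a c -> cov u u' a d -> Rl u u' ->
  wle y u' -> (lab a < lab d < lab c)%R -> bef y d c -> Rl x y.
Proof.
move=> cv cu uu' yu' /andP[ad dc] ydc; have [su su' _ uad _] := cu.
apply: (contract_below cv su su' uu' yu') => m sm my mu; apply: bef_asym.
exact: bef_trans (wle_nbef mu ad uad) (wle_nbef my dc ydc).
Qed.

Lemma contract_below_hi x y a c d u u' : cov x y a c -> cov u u' d c -> Rl u u' ->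
  wle y u' -> (lab a < lab d < lab c)%R -> bef y a d -> Rl x y.
Proof.
move=> cv cu uu' yu' /andP[ad dc] yad; have [su su' _ udc _] := cu.
apply: (contract_below cv su su' uu' yu') => m sm my mu; apply: bef_asym.
exact: bef_trans (wle_nbef my ad yad) (wle_nbef mu dc udc).
Qed.

Lemma contract_above_lo x y a c d m m' : cov x y a c -> cov m m' a d -> Rl m m' ->
  wle m x -> (lab a < lab d < lab c)%R -> bef x c d -> Rl x y.
Proof.
move=> cv cm mm' mx /andP[ad dc] xcd; have [sm sm' _ _ _] := cm.
apply: (contract_above cv sm sm' mm' mx) => t st xt m't.
exact: bef_trans (wle_bef xt dc xcd) (wle_bef m't ad (cov_bef cm)).
Qed.

Lemma contract_above_hi x y a c d m m' : cov x y a c -> cov m m' d c -> Rl m m' ->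
  wle m x -> (lab a < lab d < lab c)%R -> bef x d a -> Rl x y.
Proof.
move=> cv cm mm' mx /andP[ad dc] xda; have [sm sm' _ _ _] := cm.
apply: (contract_above cv sm sm' mm' mx) => t st xt m't.
exact: bef_trans (wle_bef m't dc (cov_bef cm)) (wle_bef xt ad xda).
Qed.

Variable up : L -> bool.
Hypothesis up_neg : forall e : L, up (negl e) = ~~ up e.
Local Notation onpath := (onpath up).
Local Notation bout := (bout up).

Definition contracted a c b : Prop :=
  forall x y, cov x y a c -> onpath x a c b -> Rl x y.

Lemma onpath_neg x a c b : x \in signedperms n -> onpath x a c b ->
  onpath x (negl c) (negl a) (negl b).
Proof.
move=> sx; rewrite ?onpathE !lab_neg up_neg !bef_neg // => /andP[h hb].
apply/andP; split; first by move: h; clear; lia.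
by case: (up b) hb.
Qed.

Lemma contracted_neg a c b : contracted a c b -> contracted (negl c) (negl a) (negl b).
Proof.
move=> h x y cv ob; have [sx _ _ _ _] := cv; have cv' := cov_neg cv.
have := onpath_neg sx ob; rewrite !neglK in cv' *; exact: h.
Qed.

Section Step.
Variables (a c b : L).
Hypothesis IH : forall a' c', (lab c' - lab a' < lab c - lab a)%R -> contracted a' c' b.
Hypothesis abc : (lab a < lab b < lab c)%R.

Lemma use_IH x y i j a' c' : cov x y a' c' -> bout x i j b ->
  (lab c' - lab a' < lab c - lab a)%R -> (lab a' < lab b < lab c')%R ->
  (i <= lab (x a'))%R -> (lab (x c') <= j)%R -> Rl x y.
Proof.
by move=> cv ob lt_ac abc' ia cj; apply: (IH lt_ac cv); apply: bout_onpath ob abc' ia cj.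
Qed.

Lemma swapped_cov x y y' p q : (lab p < lab q)%R -> cov x y p q -> swapped x y' p q -> y' = y.
Proof. by move=> pq cv [_ h _]; apply: cov_uniq (h pq) cv. Qed.

(** The cover is the middle edge of one side of the hexagon on d, a, c. On the other side, the top
    edge exchanges a, d and the bottom edge exchanges d, c; either one forces it, and the one
    enclosing b is contracted by induction. *)
Lemma hexagon_left x y d i : cov x y a c -> (lab a < lab d < lab c)%R -> b != d ->
  blk x i d a c -> (0 < i)%R -> bout x i (i + 2) b -> Rl x y.
Proof.
move=> cv /[dup] adc /andP[ad dc]; rewrite lab_eq => nbd B i0 ob; have [sx sy ac _ _] := cv.
case: (ltP (lab b) (lab d)) => bd.
  have [y' [sw By oy]] := blk23 up sx B i0.
  rewrite (swapped_cov ac cv sw) {y' sw} in By oy.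
  have [u' [[su' cv1 _] Bu' ou']] := blk12 up sy By i0; have {}cv1 := cv1 dc.
  have [u [[su _ cv2] Bu ou]] := blk23 up su' Bu' i0; have {}cv2 := cv2 ad.
  have [p1 p2 p3] := Bu; have [q1 q2 q3] := By.
  have R : Rl u u'.
    apply: (use_IH cv2 (ou _ (ou' _ (oy _ ob)))); rewrite ?p1 ?p2 ?p3;
    by move: abc adc bd i0; clear; lia.
  apply: (contract_below_lo cv cv2 R (cov_wle cv1) adc).
  by rewrite /bef q1 q2; clear; lia.
have {nbd}bd : (lab d < lab b)%R by move: nbd bd; clear; lia.
have [m [[sm _ cv1] Bm om]] := blk12 up sx B i0; have {}cv1 := cv1 ad.
have [m' [[sm' cv2 _] Bm' om']] := blk23 up sm Bm i0; have {}cv2 := cv2 dc.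
have [p1 p2 p3] := Bm; have [q1 q2 q3] := B.
have R : Rl m m'.
  apply: (use_IH cv2 (om _ ob)); rewrite ?p1 ?p2 ?p3;
  by move: abc adc bd i0; clear; lia.
apply: (contract_above_hi cv cv2 R (cov_wle cv1) adc).
by rewrite /bef q1 q2; clear; lia.
Qed.

Lemma hexagon_right x y d i : cov x y a c -> (lab a < lab d < lab c)%R -> b != d ->
  blk x i a c d -> (0 < i)%R -> bout x i (i + 2) b -> Rl x y.
Proof.
move=> cv /[dup] adc /andP[ad dc]; rewrite lab_eq => nbd B i0 ob; have [sx sy ac _ _] := cv.
case: (ltP (lab b) (lab d)) => bd.
  have [m [[sm _ cv1] Bm om]] := blk23 up sx B i0; have {}cv1 := cv1 dc.
  have [m' [[sm' cv2 _] Bm' om']] := blk12 up sm Bm i0; have {}cv2 := cv2 ad.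
  have [p1 p2 p3] := Bm; have [q1 q2 q3] := B.
  have R : Rl m m'.
    apply: (use_IH cv2 (om _ ob)); rewrite ?p1 ?p2 ?p3;
    by move: abc adc bd i0; clear; lia.
  apply: (contract_above_lo cv cv2 R (cov_wle cv1) adc).
  by rewrite /bef q2 q3; clear; lia.
have {nbd}bd : (lab d < lab b)%R by move: nbd bd; clear; lia.
have [y' [sw By oy]] := blk12 up sx B i0.
rewrite (swapped_cov ac cv sw) {y' sw} in By oy.
have [u' [[su' cv1 _] Bu' ou']] := blk23 up sy By i0; have {}cv1 := cv1 ad.
have [u [[su _ cv2] Bu ou]] := blk12 up su' Bu' i0; have {}cv2 := cv2 dc.
have [p1 p2 p3] := Bu; have [q1 q2 q3] := By.
have R : Rl u u'.
  apply: (use_IH cv2 (ou _ (ou' _ (oy _ ob)))); rewrite ?p1 ?p2 ?p3;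
  by move: abc adc bd i0; clear; lia.
apply: (contract_below_hi cv cv2 R (cov_wle cv1) adc).
by rewrite /bef q2 q3; clear; lia.
Qed.

Lemma oct_pos x p q : x \in signedperms n -> oct x p q ->
  [/\ lab (x p) = 1, lab (x q) = 2, lab (x (negl p)) = -1 & lab (x (negl q)) = -2]%R.
Proof. by move=> sx [hp hq]; rewrite !lab_signed // hp hq. Qed.

(* Octagon with middle value -a, for a < -a < c. *)
Lemma octagon_nega x y : cov x y a c -> (lab a < 0)%R -> (- lab a < lab c)%R ->
  b != negl a -> oct x a c -> bout x (-2) 2 b -> Rl x y.
Proof.
move=> cv a0 ac'; rewrite lab_eq lab_neg => nb O ob; have [sx sy ac _ _] := cv.
have mid : (lab a < lab (negl a) < lab c)%R by rewrite lab_neg; move: a0 ac'; clear; lia.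
case: (ltP (lab b) (- lab a)%R) => bd.
  have [y' [sw Oy oy]] := octp up sx O.
  rewrite (swapped_cov ac cv sw) {y' sw} in Oy oy.
  have [u1 [[su1 cv1 _] Ou1 ou1]] := octc up sy Oy.
  have {}cv1 : cov y u1 (negl c) c by apply: cv1; rewrite lab_neg; move: ac' a0; clear; lia.
  have [u2 [[su2 cv2 _] Ou2 ou2]] := octp up su1 Ou1.
  have {}cv2 : cov u1 u2 (negl c) a by apply: cv2; rewrite lab_neg; move: ac' a0; clear; lia.
  have [u [[su _ cv3] Ou ou]] := octc up su2 Ou2.
  have {}cv3 : cov u u2 a (negl a) by apply: cv3; rewrite lab_neg; move: a0; clear; lia.
  have [p1 p2 p3 p4] := oct_pos su Ou; have [q1 q2 q3 q4] := oct_pos sy Oy.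
  rewrite !neglK in p3 p4.
  have R : Rl u u2.
    apply: (use_IH cv3 (ou _ (ou2 _ (ou1 _ (oy _ ob))))); rewrite ?lab_neg ?p3 ?p1 //;
    by move: abc ac' bd; clear; lia.
  apply: (contract_below_lo cv cv3 R (wle_trans (cov_wle cv1) (cov_wle cv2)) mid).
  by rewrite /bef q4 q1.
have [m [[sm _ cv1] Om om]] := octc up sx O.
have {}cv1 : cov m x a (negl a) by apply: cv1; rewrite lab_neg; move: a0; clear; lia.
have [m' [[sm' cv2 _] Om' om']] := octp up sm Om.
have {}cv2 : cov m m' (negl a) c by apply: cv2; rewrite lab_neg.
have [p1 p2 p3 p4] := oct_pos sm Om; have [q1 q2 q3 q4] := oct_pos sx O.
have R : Rl m m'.
  apply: (use_IH cv2 (om _ ob)); rewrite ?lab_neg ?p1 ?p2 //;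
  by move: abc ac' bd nb a0; clear; lia.
apply: (contract_above_hi cv cv2 R (cov_wle cv1) mid).
by rewrite /bef q1 q3.
Qed.

(* Octagon with middle value -c, for 0 < c < -a. *)
Lemma octagon_negc x y : cov x y a c -> (0 < lab c)%R -> (lab c < - lab a)%R ->
  b != negl c -> oct x a c -> bout x (-2) 2 b -> Rl x y.
Proof.
move=> cv c0 ac'; rewrite lab_eq lab_neg => nb O ob; have [sx sy ac _ _] := cv.
have mid : (lab a < lab (negl c) < lab c)%R by rewrite lab_neg; move: c0 ac'; clear; lia.
case: (ltP (lab b) (- lab c)%R) => bd.
  have [y' [sw Oy oy]] := octp up sx O.
  rewrite (swapped_cov ac cv sw) {y' sw} in Oy oy.
  have [u1 [[su1 cv1 _] Ou1 ou1]] := octc up sy Oy.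
  have {}cv1 : cov y u1 (negl c) c by apply: cv1; rewrite lab_neg; move: c0; clear; lia.
  have [u [[su _ cv2] Ou ou]] := octp up su1 Ou1.
  have {}cv2 : cov u u1 a (negl c) by apply: cv2; rewrite lab_neg; move: ac'; clear; lia.
  have [p1 p2 p3 p4] := oct_pos su Ou; have [q1 q2 q3 q4] := oct_pos sy Oy.
  have R : Rl u u1.
    apply: (use_IH cv2 (ou _ (ou1 _ (oy _ ob)))); rewrite ?lab_neg ?p1 ?p2 //;
    by move: abc ac' bd c0; clear; lia.
  apply: (contract_below_lo cv cv2 R (cov_wle cv1) mid).
  by rewrite /bef q3 q1.
have [m1 [[sm1 _ cv1] Om1 om1]] := octc up sx O.
have {}cv1 : cov m1 x a (negl a) by apply: cv1; rewrite lab_neg; move: c0 ac'; clear; lia.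
have [m [[sm _ cv2] Om om]] := octp up sm1 Om1.
have {}cv2 : cov m m1 c (negl a) by apply: cv2; rewrite lab_neg.
have [m' [[sm' cv3 _] Om' om']] := octc up sm Om.
have {}cv3 : cov m m' (negl c) c by apply: cv3; rewrite lab_neg; move: c0; clear; lia.
have [p1 p2 p3 p4] := oct_pos sm Om; have [q1 q2 q3 q4] := oct_pos sx O.
have R : Rl m m'.
  apply: (use_IH cv3 (om _ (om1 _ ob))); rewrite ?lab_neg ?p1 ?p3 //;
  by move: abc ac' bd nb c0; clear; lia.
apply: (contract_above_hi cv cv3 R (wle_trans (cov_wle cv2) (cov_wle cv1)) mid).
by rewrite /bef q4 q1.
Qed.

(* Octagons for the central swap of a = -c and c, with the entries -c and c
   surrounded by d and -d. *)
Lemma octagon_central x y d : a = negl c -> cov x y a c -> (lab a < lab d < lab c)%R ->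
  (0 < lab b)%R -> b != d -> b != negl d -> oct x c (negl d) -> bout x (-2) 2 b -> Rl x y.
Proof.
move=> ae cv adc b0; rewrite !lab_eq lab_neg => nb1 nb2 O ob; have [sx sy ac _ _] := cv.
have [c0 dc cd] : [/\ 0 < lab c, lab d < lab c & - lab c < lab d]%R.
  by move: adc; rewrite ae lab_neg; clear; split; lia.
have [y' [sw Oy oy]] := octc up sx O; rewrite -ae in sw Oy.
rewrite (swapped_cov ac cv sw) {y' sw} in Oy oy.
have [px1 px2 px3 px4] := oct_pos sx O; have [py1 py2 py3 py4] := oct_pos sy Oy.
rewrite ae !neglK in px4 py1 py3 py4 Oy.
have d0 := lab_neq0 d; case: (ltP 0%R (lab d)) => ds.
  case: (ltP (lab b) (lab d)) => bd.
    have [u' [[su' cv1 _] Ou' ou']] := octp up sy Oy.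
    have {}cv1 : cov y u' (negl c) (negl d) by apply: cv1; rewrite !lab_neg; move: dc; clear; lia.
    have [u [[su _ cv2] Ou ou]] := octc up su' Ou'; rewrite !neglK in cv2 Ou.
    have {}cv2 : cov u u' (negl d) d by apply: cv2; rewrite lab_neg; move: ds; clear; lia.
    have [p1 p2 p3 p4] := oct_pos su Ou.
    have R : Rl u u'.
      apply: (use_IH cv2 (ou _ (ou' _ (oy _ ob)))); rewrite ?lab_neg ?p3 ?p1 //;
      by move: abc adc bd b0; rewrite ?ae ?lab_neg; clear; lia.
    apply: (contract_below cv su su' R (cov_wle cv1)) => m sm my mu; apply: bef_asym.
    have mdc : bef m d c by apply: (wle_nbef my dc); rewrite /bef py4 py3.
    have mcd : bef m a (negl d) by rewrite ae bef_neg.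
    have mdd : bef m (negl d) d.
      apply: (wle_nbef mu); first by rewrite lab_neg; move: ds; clear; lia.
      by rewrite /bef p1 p3.
    exact: bef_trans (bef_trans mcd mdd) mdc.
  have {nb1}bd : (lab d < lab b)%R by move: nb1 bd; clear; lia.
  have [m1 [[sm1 _ cv1] Om1 om1]] := octp up sx O.
  have {}cv1 : cov m1 x (negl d) c by apply: cv1; rewrite lab_neg; move: cd; clear; lia.
  have [m [[sm _ cv2] Om om]] := octc up sm1 Om1; rewrite !neglK in cv2 Om.
  have {}cv2 : cov m m1 (negl d) d by apply: cv2; rewrite lab_neg; move: ds; clear; lia.
  have [m' [[sm' cv3 _] Om' om']] := octp up sm Om; have {}cv3 := cv3 dc.
  have [p1 p2 p3 p4] := oct_pos sm Om.
  have R : Rl m m'.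
    apply: (use_IH cv3 (om _ (om1 _ ob))); rewrite ?p1 ?p2 //; rewrite ?ae ?lab_neg;
    by move: abc adc bd; rewrite ae lab_neg; clear; lia.
  apply: (contract_above_hi cv cv3 R (wle_trans (cov_wle cv2) (cov_wle cv1)) adc).
  by rewrite /bef ae px3 px4.
have {d0}ds : (lab d < 0)%R by move: d0 ds; clear; lia.
have {nb2}nb2 : lab b != (- lab d)%R by move: nb2; clear; lia.
case: (ltP (lab b) (- lab d)%R) => bd.
  have [m [[sm _ cv1] Om om]] := octp up sx O.
  have {}cv1 : cov m x (negl d) c by apply: cv1; rewrite lab_neg; move: cd; clear; lia.
  have [m' [[sm' cv2 _] Om' om']] := octc up sm Om; rewrite !neglK in cv2 Om'.
  have {}cv2 : cov m m' d (negl d) by apply: cv2; rewrite lab_neg; move: ds; clear; lia.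
  have [p1 p2 p3 p4] := oct_pos sm Om; rewrite !neglK in p3.
  have R : Rl m m'.
    apply: (use_IH cv2 (om _ ob)); rewrite ?lab_neg ?p3 ?p1 //;
    by move: abc adc bd b0 ds; rewrite ?ae ?lab_neg; clear; lia.
  apply: (contract_above cv sm sm' R (cov_wle cv1)) => t st xt m't.
  have tcd : bef t c (negl d).
    apply: (wle_bef xt); first by rewrite lab_neg; move: cd; clear; lia.
    by rewrite /bef px1 px2.
  have tda : bef t d a by rewrite ae -[d]neglK bef_neg.
  have tdd : bef t (negl d) d.
    apply: (wle_bef m't _ (cov_bef cv2)); rewrite lab_neg; move: ds; clear; lia.
  exact: bef_trans (bef_trans tcd tdd) tda.
have {nb2}bd : (- lab d < lab b)%R by move: nb2 bd; clear; lia.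
have [u1 [[su1 cv1 _] Ou1 ou1]] := octp up sy Oy.
have {}cv1 : cov y u1 (negl c) (negl d) by apply: cv1; rewrite !lab_neg; move: dc; clear; lia.
have [u' [[su' cv2 _] Ou' ou']] := octc up su1 Ou1; rewrite !neglK in cv2 Ou'.
have {}cv2 : cov u1 u' d (negl d) by apply: cv2; rewrite lab_neg; move: ds; clear; lia.
have [u [[su _ cv3] Ou ou]] := octp up su' Ou'.
have {}cv3 : cov u u' (negl c) d by apply: cv3; rewrite lab_neg; move: cd; clear; lia.
have {}cv3 := cov_neg cv3; rewrite !neglK in cv3.
have [p1 p2 p3 p4] := oct_pos su Ou; rewrite !neglK in p3 p4.
have R : Rl u u'.
  apply: (use_IH cv3 (ou _ (ou' _ (ou1 _ (oy _ ob))))); rewrite ?lab_neg ?p3 ?p4 //;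
  by move: abc adc bd ds; rewrite ?ae ?lab_neg; clear; lia.
apply: (contract_below cv su su' R (wle_trans (cov_wle cv1) (cov_wle cv2))) => m sm my mu.
apply: bef_asym.
have mdc : bef m (negl d) c.
  apply: (wle_nbef mu); first by rewrite lab_neg; move: cd; clear; lia.
  by rewrite /bef p3 p4.
have mad : bef m a d by rewrite ae -[d]neglK bef_neg.
have mdd : bef m d (negl d).
  apply: (wle_nbef my); first by rewrite lab_neg; move: ds; clear; lia.
  by rewrite /bef py2 py4.
exact: bef_trans (bef_trans mad mdd) mdc.
Qed.

End Step.
End Congruence.

(** * Maximal covers and moving a label *)

Section MaximalCovers.
Variables (n : nat).
Notation L := (bool * 'I_n)%type.
Implicit Types (w x y m t u M : {perm L}) (a c b d e f v z : L) (i j k : int).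

Definition only_ascent M a c : Prop := forall e f, (lab (M e) < lab (M f))%R ->
  (lab e < lab f)%R ->
  ((lab (M e) <= lab (M a)) && (lab (M c) <= lab (M f)) ||
   (lab (M e) <= - lab (M c)) && (- lab (M a) <= lab (M f)))%R.

(* A maximal element above x in which a, c is not inverted has no ascents but
   (a, c) and its mirror image. *)
Lemma maximal_cover x y a c : cov x y a c ->
  exists M M', [/\ cov M M' a c, wle x M & only_ascent M a c].
Proof.
move=> cv; have [sx sy ac xac _] := cv.
have [|M /and3P[sM xM nac] Mmax] := @ex_max _
  (fun w => [&& w \in signedperms n, wle x w & (a, c) \notin ivs w])
  (fun w => Posz #|ivs w|) x; first by rewrite sx wle_refl (cov_notin cv).
have asc M2 e f : cov M M2 e f -> (a = e /\ c = f) \/ (a = negl f /\ c = negl e).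
  move=> cv2; have [_ s2 _ _ _] := cv2; have iE := cov_ivs cv2.
  case: (boolP ((a, c) \in ivs M2)) => h.
    by move: h; rewrite iE in_setU (negbTE nac) in_set2 !xpair_eqE /= =>
      /orP[] /andP[/eqP -> /eqP ->]; [left | right].
  have := Mmax M2; rewrite s2 h (wle_trans xM (cov_wle cv2)) => /(_ isT).
  have lt_card : #|ivs M| < #|ivs M2|.
    apply: proper_card; rewrite properE -/(wle M M2) (cov_wle cv2); apply/subsetPn.
    by exists (e, f); rewrite ?(cov_in cv2) ?(cov_notin cv2).
  by rewrite lez_nat leqNgt lt_card.
have [||||M' [e [f [cv' _]]]] := @chain_up n M (w0 n).
- exact: sM.
- exact: w0_signed.
- by apply/wleP => e f ef _; rewrite /bef !permE !lab_neg ltrN2.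
- by apply: contraNneq nac => ->; rewrite in_ivs ac /bef !permE !lab_neg ltrN2.
exists M, M'; split=> //.
  by have [[-> ->] //|[-> ->]] := asc _ _ _ cv'; apply: cov_neg.
(* An increasing pair that is not adjacent yields a shorter one at the entry g following e1: (e1, g)
   if g is larger than e1, and (g, f1) otherwise. *)
move=> e1 f1; have [N leN] := ubnP `|(lab (M f1) - lab (M e1))%R|%N.
elim: N e1 f1 leN => // N IHN e1 f1 leN Mef ef.
case: (boolP (nxt (lab (M e1)) (lab (M f1)))) => nx.
  have cv2 := cov_rf sM ef nx.
  by have [[-> ->]|[-> ->]] := asc _ _ _ cv2; rewrite ?(lab_signed _ sM) ?opprK !lexx ?orbT.
have [g' gE] : exists g : L, lab g = (if lab (M e1) == -1 then 1 else lab (M e1) + 1)%R.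
  have := lab_bound (M e1); have := lab_bound (M f1); have := lab_neq0 (M e1).
  have := lab_neq0 (M f1); move: Mef; move: (lab (M e1)) (lab (M f1)) => E F.
  by move=> h1 h2 h3 h4 h5; apply: lab_ex; case: ifP; move: h1 h2 h3 h4 h5; clear; lia.
pose g := (M^-1)%g g'; have {}gE : lab (M g) = (if lab (M e1) == -1 then 1 else lab (M e1) + 1)%R.
  by rewrite permKV.
have [h1 h2] : (lab (M e1) < lab (M g))%R /\ (lab (M g) < lab (M f1))%R.
  have := lab_neq0 (M f1); move: nx Mef gE; rewrite /nxt.
  move: (lab (M e1)) (lab (M f1)) (lab (M g)) => E F G; case: ifP; clear; lia.
case: (ltgtP (lab e1) (lab g)) => [eg|ge|/lab_inj eg]; last by rewrite eg ltxx in h1.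
  have := IHN e1 g _ h1 eg; move: leN h1 h2; clear.
  by move: (lab (M e1)) (lab (M f1)) (lab (M g)) (lab (M a)) (lab (M c)) => E F G A C; lia.
have gf := lt_trans ge ef; have := IHN g f1 _ h2 gf; move: leN h1 h2; clear.
by move: (lab (M e1)) (lab (M f1)) (lab (M g)) (lab (M a)) (lab (M c)) => E F G A C; lia.
Qed.

Lemma only_ascent_neg M a c : M \in signedperms n -> only_ascent M a c ->
  only_ascent M (negl c) (negl a).
Proof. by move=> sM h e f h1 h2; rewrite !(lab_signed _ sM) !opprK orbC h. Qed.

(* The labels d and -d are moved elsewhere in M. Old positions are doubled, so that
   an odd key k inserts d strictly between two entries. *)
Definition relocated M x d k : Prop := forall e f,
  let K z := if lab z == lab d then k else if lab z == (- lab d)%R then (- k)%R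
             else (2 * lab (M z))%R in
  bef x e f = (K e < K f)%R.

(** The conditions say that the move creates no inversion of d with a larger label, with a smaller
    one, or with -d for either sign of d; the inversions of -d follow by symmetry. *)
Lemma relocated_wle M x d k : M \in signedperms n -> relocated M x d k ->
  (forall f, (lab d < lab f)%R -> (2 * lab (M f) < k)%R -> (lab (M f) < lab (M d))%R) ->
  (forall e, (lab e < lab d)%R -> (k < 2 * lab (M e))%R -> (lab (M d) < lab (M e))%R) ->
  ((0 < lab d)%R -> (k < 0)%R -> (lab (M d) < 0)%R) ->
  ((lab d < 0)%R -> (0 < k)%R -> (0 < lab (M d))%R) -> wle x M.
Proof.
move=> sM xE W1 W2 W3 W4; apply/wleP => e f ef; rewrite xE /bef.
have P e' : lab e' = lab d \/ lab e' = (- lab d)%R ->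
    lab (M e') = (if lab e' == lab d then lab (M d) else - lab (M d))%R.
  case: eqP => [/lab_inj -> //|ne []// h].
  have -> : e' = negl d by apply: lab_inj; rewrite lab_neg.
  by rewrite lab_signed.
have d0 := lab_neq0 d.
have W1e := W1 e; have W2e := W2 e; have W1f := W1 f; have W2f := W2 f.
have W1e' := W1 (negl e); have W2e' := W2 (negl e).
have W1f' := W1 (negl f); have W2f' := W2 (negl f).
rewrite !lab_neg !(lab_signed _ sM) in W1e' W2e' W1f' W2f'.
case: (eqVneq (lab e) (lab d)) => [e1|e1].
  have Pe := P e (or_introl e1); rewrite e1 eqxx in Pe.
  case: (eqVneq (lab f) (lab d)) => [f1|f1]; first by move: ef; rewrite e1 f1 ltxx.
  case: (eqVneq (lab f) (- lab d)%R) => [f2|f2].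
    have Pf := P f (or_intror f2); rewrite f2 in Pf *; move: Pe Pf W3 W4 ef; rewrite e1 f2.
    have -> : (- lab d == lab d)%R = false by move: d0; clear; lia.
    by move=> -> -> ; move: d0; clear; lia.
  by rewrite Pe; move: W1f ef; rewrite e1; clear; lia.
case: (eqVneq (lab e) (- lab d)%R) => [e2|e2].
  have Pe := P e (or_intror e2); rewrite (negbTE e1) in Pe.
  case: (eqVneq (lab f) (lab d)) => [f1|f1].
    have Pf := P f (or_introl f1); rewrite f1 eqxx in Pf.
    by rewrite Pe Pf; move: W3 W4 ef d0; rewrite e2 f1; clear; lia.
  case: (eqVneq (lab f) (- lab d)%R) => [f2|f2]; first by move: ef; rewrite e2 f2 ltxx.
  by rewrite Pe; move: W2f' ef; rewrite e2; clear; lia.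
case: (eqVneq (lab f) (lab d)) => [f1|f1].
  have Pf := P f (or_introl f1); rewrite f1 eqxx in Pf.
  by rewrite Pf; move: W2e ef; rewrite f1; clear; lia.
case: (eqVneq (lab f) (- lab d)%R) => [f2|f2].
  have Pf := P f (or_intror f2); rewrite (negbTE f1) in Pf.
  by rewrite Pf; move: W1e' ef; rewrite f2; clear; lia.
by clear; lia.
Qed.

End MaximalCovers.

Section RelocatedFacts.
Variables (n : nat) (M x : {perm bool * 'I_n}) (d : bool * 'I_n) (k : int).
Notation L := (bool * 'I_n)%type.
Implicit Types (e f : L).
Hypotheses (sM : M \in signedperms n) (sx : x \in signedperms n).
Hypothesis xE : relocated M x d k.

Let away e := (lab e != lab d) && (lab e != - lab d)%R.

Lemma reloc_out e f : away e -> away f -> bef x e f = (lab (M e) < lab (M f))%R.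
Proof.
move=> /andP[/negbTE e1 /negbTE e2] /andP[/negbTE f1 /negbTE f2].
by rewrite xE /= e1 e2 f1 f2; clear; lia.
Qed.

Lemma reloc_l f : away f -> bef x d f = (k < 2 * lab (M f))%R.
Proof. by move=> /andP[/negbTE f1 /negbTE f2]; rewrite xE /= f1 f2 eqxx. Qed.

Lemma reloc_r f : away f -> bef x f d = (2 * lab (M f) < k)%R.
Proof. by move=> /andP[/negbTE f1 /negbTE f2]; rewrite xE /= f1 f2 eqxx. Qed.

Lemma reloc_nl f : away f -> bef x (negl d) f = (- k < 2 * lab (M f))%R.
Proof.
move=> /andP[/negbTE f1 /negbTE f2]; rewrite xE /= f1 f2 lab_neg eqxx.
by have -> : (- lab d == lab d)%R = false by have := lab_neq0 d; clear; lia.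
Qed.

Lemma reloc_nr f : away f -> bef x f (negl d) = (2 * lab (M f) < - k)%R.
Proof.
move=> /andP[/negbTE f1 /negbTE f2]; rewrite xE /= f1 f2 lab_neg eqxx.
by have -> : (- lab d == lab d)%R = false by have := lab_neq0 d; clear; lia.
Qed.

Lemma reloc_nd : bef x (negl d) d = (0 < k)%R.
Proof.
rewrite xE /= lab_neg !eqxx.
have -> : (- lab d == lab d)%R = false by have := lab_neq0 d; clear; lia.
by clear; lia.
Qed.

Lemma reloc_case e : [\/ e = d, e = negl d | away e].
Proof.
rewrite /away -lab_neg -!lab_eq.
by case: eqVneq => [|_]; [constructor 1 | case: eqVneq; [constructor 2 | constructor 3]].
Qed.

Lemma reloc_pos : (0 < k)%R -> (0 < lab (x d))%R.
Proof. by rewrite -reloc_nd /bef lab_signed //; move: (lab (x d)); clear; lia. Qed.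

Lemma reloc_away e : (lab (M e) != lab (M d)) && (lab (M e) != - lab (M d))%R -> away e.
Proof.
case/andP => h1 h2; case: (reloc_case e) => // eE; first by rewrite eE eqxx in h1.
by rewrite eE lab_signed // eqxx in h2.
Qed.

Lemma reloc_away_nd e : away e -> (lab (M e) != lab (M d)) && (lab (M e) != - lab (M d))%R.
Proof.
case/andP => h1 h2; rewrite -lab_signed // !(inj_eq (@lab_inj n)) !(inj_eq perm_inj).
by rewrite !lab_eq lab_neg h1.
Qed.

Lemma reloc_nxt_l e : away e -> k = (2 * lab (M e) - 1)%R -> nxt (lab (x d)) (lab (x e)).
Proof.
move=> ae kE; apply: adj_nxt; first by rewrite reloc_l // kE; clear; lia.
move=> f; case: (reloc_case f) => [->|->|af]; first by rewrite bef_irr.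
  by rewrite reloc_nl // kE /bef => h; have := reloc_nd; rewrite /bef kE;
    have := lab_neq0 (M e); move: h; clear; lia.
by rewrite reloc_l // reloc_out // kE; clear; lia.
Qed.

Lemma reloc_nxt_r e : away e -> k = (2 * lab (M e) + 1)%R -> nxt (lab (x e)) (lab (x d)).
Proof.
move=> ae kE; apply: adj_nxt; first by rewrite reloc_r // kE; clear; lia.
move=> f; case: (reloc_case f) => [->|->|af]; first by move=> _; rewrite bef_irr.
  by rewrite reloc_nr // kE /bef => h; have := reloc_nd; rewrite /bef kE;
    have := lab_neq0 (M e); move: h; clear; lia.
by rewrite reloc_r // reloc_out // kE; clear; lia.
Qed.

Lemma reloc_nxt e f : away e -> away f -> nxt (lab (M e)) (lab (M f)) ->
  ~~ (2 * lab (M e) < k < 2 * lab (M f))%R -> ~~ (2 * lab (M e) < - k < 2 * lab (M f))%R ->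
  nxt (lab (x e)) (lab (x f)).
Proof.
move=> ae af nx h1 h2; apply: adj_nxt.
  by rewrite reloc_out //; move: nx; rewrite /nxt; clear; lia.
move=> g; case: (reloc_case g) => [->|->|ag].
- by rewrite reloc_r // reloc_l // => h; move: h1; rewrite h /= => /negbTE.
- by rewrite reloc_nr // reloc_nl // => h; move: h2; rewrite h /= => /negbTE.
rewrite !reloc_out //; move: nx; rewrite /nxt; have := lab_neq0 (M g).
by move: (lab (M e)) (lab (M f)) (lab (M g)); clear; lia.
Qed.

End RelocatedFacts.

(** * Contraction of maximal covers *)

Section Contraction.
Variables (n : nat) (Rl : {perm bool * 'I_n} -> {perm bool * 'I_n} -> Prop).
Notation L := (bool * 'I_n)%type.
Implicit Types (w x y m t u : {perm L}) (d e f v : L).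
Hypothesis n_ge2 : 2 <= n.
Hypothesis cong : lattice_congruence Rl.
Variable up : L -> bool.
Hypothesis up_neg : forall e : L, up (negl e) = ~~ up e.
Local Notation onpath := (onpath up).
Local Notation bout := (bout up).
Local Notation contracted := (contracted Rl up).

Lemma contract_transport x y m m' a c : cov x y a c -> cov m m' a c -> wle m x ->
  Rl m m' -> Rl x y.
Proof.
move=> cv cm mx mm'; have [sm sm' ac _ _] := cm.
apply: (contract_above n_ge2 cong cv sm sm' mm' mx) => t st xt m't.
exact: wle_bef m't ac (cov_bef cm).
Qed.

Section Maximal.
Variables (a c b : L) (M M' : {perm L}).
Hypothesis IH : forall a' c', (lab c' - lab a' < lab c - lab a)%R -> contracted a' c' b.
Hypothesis abc : (lab a < lab b < lab c)%R.
Hypothesis cvM : cov M M' a c.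
Hypothesis asc : only_ascent M a c.
Hypothesis ob : onpath M a c b.

Let sM : M \in signedperms n. Proof. by case: cvM. Qed.
Let ac : (lab a < lab c)%R. Proof. by case: cvM. Qed.

Let pos_ne e f : lab e != lab f -> lab (M e) != lab (M f).
Proof. by rewrite -!lab_eq (inj_eq perm_inj). Qed.

Section Right.
Hypothesis pa0 : (0 < lab (M a))%R.
Local Notation i := (lab (M a)).

Let pc : lab (M c) = (i + 1)%R.
Proof. by have := cov_nxt cvM; rewrite /nxt; move: pa0; clear; lia. Qed.

Let pb : if up b then (lab (M b) < i)%R else (i + 1 < lab (M b))%R.
Proof. by move: ob; rewrite ?onpathE /bef pc => /andP[_]. Qed.

(** The key 2i - 1 puts d immediately before a. On the way d passes only smaller labels, and the
    sign condition handles -d. The condition on b excludes that b = -d is carried off the path. *)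
Lemma hex_left d : (lab a < lab d < lab c)%R -> b != d -> (~~ up b -> b != negl d) ->
  (lab (M d) < i)%R -> lab (M d) != (- i)%R -> lab (M d) != (- i - 1)%R ->
  (forall f, (lab (M d) < lab (M f) < i)%R -> (lab f < lab d)%R) ->
  ((lab d < 0)%R -> (0 < lab (M d))%R) -> Rl M M'.
Proof.
move=> adc bd bnd di dni dnc H S; pose k := (2 * i - 1)%R.
have k0 : (0 < k)%R by move: pa0; rewrite /k; clear; lia.
have [|x sx xE] := @relocate n M d k sM.
  by move=> z; rewrite /k; move: (lab (M a)); clear; lia.
have aa : (lab a != lab d) && (lab a != - lab d)%R.
  by apply: (reloc_away sM); move: di dni; clear; lia.
have ca : (lab c != lab d) && (lab c != - lab d)%R.
  by apply: (reloc_away sM); rewrite pc; move: di dnc; clear; lia.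
have xd0 := reloc_pos sx xE k0.
have n1 := reloc_nxt_l xE aa (erefl k).
have n2 : nxt (lab (x a)) (lab (x c)).
  apply: (reloc_nxt xE aa ca (cov_nxt cvM)); rewrite pc /k; move: pa0; clear; lia.
have B : blk x (lab (x d)) d a c.
  by move: n1 n2 xd0; rewrite /blk /nxt; clear; split; lia.
have cx := cov_rf sx ac n2.
have xM : wle x M.
  apply: (relocated_wle sM xE) => [f df|e ed|d0|d0]; rewrite /k.
  - move=> fk; rewrite ltNge le_eqVlt negb_or pos_ne /=; last by move: df; clear; lia.
    apply/negP => h; have := H f; move: df fk h; clear; lia.
  - by move: di; clear; lia.
  - by move: k0; rewrite /k; clear; lia.
  by move=> _; apply: S.
apply: (contract_transport cvM cx xM).
apply: (hexagon_left n_ge2 cong IH abc cx adc bd B xd0).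
rewrite ?boutE; move: pb bnd; case: ifP => ub hb bnd.
  suff : bef x b d by [].
  case: (reloc_case d b) => [e|e|ab]; first by rewrite e eqxx in bd.
    by rewrite e (reloc_nd xE).
  by rewrite (reloc_r xE) // /k; move: hb; clear; lia.
have -> : (lab (x d) + 2 = lab (x c))%R by case: B.
suff : bef x c b by [].
case: (reloc_case d b) => [e|e|ab]; first by rewrite e eqxx in bd.
  by have := bnd isT; rewrite e eqxx.
by rewrite (reloc_out xE) // pc; move: hb; clear; lia.
Qed.

(** The key 2i + 3 puts d immediately after c, which has position i + 1. The labels passed are
    larger than d, since a smaller one would form with d an ascent that M does not allow. *)
Lemma hex_right d : (lab a < lab d < lab c)%R -> b != d -> (i + 1 < lab (M d))%R -> Rl M M'.
Proof.
move=> adc bd di; pose k := (2 * lab (M c) + 1)%R.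
have kE : k = (2 * i + 3)%R by rewrite /k pc; clear; lia.
have k0 : (0 < k)%R by rewrite kE; move: pa0; clear; lia.
have H f : (i + 1 < lab (M f) < lab (M d))%R -> (lab d < lab f)%R.
  move=> /andP[h1 h2]; case: (ltgtP (lab d) (lab f)) => // [fd|/lab_inj e].
    by have := asc h2 fd; rewrite pc; move: h1 pa0; clear; lia.
  by rewrite e ltxx in h2.
have [|x sx xE] := @relocate n M d k sM.
  by move=> z; rewrite kE; move: (lab (M a)); clear; lia.
have aa : (lab a != lab d) && (lab a != - lab d)%R.
  by apply: (reloc_away sM); move: di pa0; clear; lia.
have ca : (lab c != lab d) && (lab c != - lab d)%R.
  by apply: (reloc_away sM); rewrite pc; move: di pa0; clear; lia.
have n1 := reloc_nxt_r xE ca (erefl k).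
have n2 : nxt (lab (x a)) (lab (x c)).
  apply: (reloc_nxt xE aa ca (cov_nxt cvM)); rewrite pc kE; move: pa0; clear; lia.
have xa0 : (0 < lab (x a))%R.
  have ana : (lab (negl a) != lab d) && (lab (negl a) != - lab d)%R.
    by rewrite lab_neg; move: aa; clear; lia.
  have := reloc_out xE ana aa; rewrite /bef !(lab_signed _ sM) (lab_signed _ sx).
  by move: pa0; clear; lia.
have B : blk x (lab (x a)) a c d.
  by move: n1 n2 xa0; rewrite /blk /nxt; clear; split; lia.
have cx := cov_rf sx ac n2.
have xM : wle x M.
  apply: (relocated_wle sM xE) => [f df|e ed|d0|d0]; rewrite kE.
  - by move: di; clear; lia.
  - move=> ke; rewrite ltNge le_eqVlt negb_or pos_ne /=; last by move: ed; clear; lia.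
    apply/negP => h; have := H e; move: ed ke h; clear; lia.
  - by move: k0; rewrite kE; clear; lia.
  by move=> _; move: di pa0; clear; lia.
apply: (contract_transport cvM cx xM).
apply: (hexagon_right n_ge2 cong IH abc cx adc bd B xa0).
rewrite ?boutE; move: pb; case: ifP => ub hb.
  suff : bef x b a by [].
  case: (reloc_case d b) => [e|e|ab]; first by rewrite e eqxx in bd.
    by rewrite e (reloc_nl xE) // kE; move: pa0; clear; lia.
  by rewrite (reloc_out xE).
have -> : (lab (x a) + 2 = lab (x d))%R by case: B.
suff : bef x d b by [].
case: (reloc_case d b) => [e|e|ab]; first by rewrite e eqxx in bd.
  by move: hb; rewrite e (lab_signed _ sM); move: di pa0; clear; lia.
by rewrite (reloc_l xE) // kE; move: hb; clear; lia.
Qed.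

Lemma hex_mid d : (lab a < lab d < lab c)%R -> b != d -> (~~ up b -> b != negl d) ->
  (- i < lab (M d) < i)%R -> Rl M M'.
Proof.
move=> adc bd bnd /andP[di1 di2]; apply: (hex_left adc bd bnd) => //.
- by move: di1; clear; lia.
- by move: di1; clear; lia.
- move=> f /andP[h1 h2]; case: (ltgtP (lab f) (lab d)) => // [df|/lab_inj e].
    by have := asc h1 df; rewrite pc; move: h2 di1; clear; lia.
  by rewrite e ltxx in h1.
move=> d0; rewrite ltNge le_eqVlt negb_or lab_neq0 /=; apply/negP => dn.
have := asc (e := d) (f := negl d); rewrite lab_neg (lab_signed _ sM) pc.
by move: d0 dn di1 di2; clear; lia.
Qed.

(** A label between a and c other than b, -b, -a, -c gives a hexagon wherever it stands. Without
    one, so few labels can stand between -a and a in M that -b helps or an octagon appears. *)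
Lemma right_step d0 : (lab a < lab d0 < lab c)%R -> b != d0 -> Rl M M'.
Proof.
move=> adc0 bd0.
have la0 : (lab a < 0)%R.
  have := lab_neq0 a; have := asc (e := negl a) (f := a).
  by rewrite lab_neg (lab_signed _ sM) pc; move: pa0; clear; lia.
have nca : lab c != (- lab a)%R.
  apply/eqP => e; have ce : c = negl a by apply: lab_inj; rewrite lab_neg.
  by have := pc; rewrite ce (lab_signed _ sM); move: pa0; clear; lia.
have pos0 d : lab (M d) != 0%R by apply: lab_neq0.
pose T d := (lab a < lab d < lab c)%R &&
  [&& lab d != lab b, lab d != - lab b, lab d != - lab a & lab d != - lab c]%R.
case: (pickP T) => [d /andP[adc /and4P[d1 d2 d3 d4]]|noT].
  have nda : lab (M d) != i by apply: pos_ne; move: adc; clear; lia.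
  have ndc : lab (M d) != (i + 1)%R by rewrite -pc; apply: pos_ne; move: adc; clear; lia.
  have ndna : lab (M d) != (- i)%R by rewrite -(lab_signed _ sM); apply: pos_ne; rewrite lab_neg.
  have ndnc : lab (M d) != (- i - 1)%R.
    rewrite -opprD -pc -(lab_signed _ sM); apply: pos_ne; rewrite lab_neg.
    exact: d4.
  have bd : b != d by rewrite lab_eq eq_sym.
  have bnd : b != negl d by rewrite lab_eq lab_neg; move: d2; clear; lia.
  case: (ltP (i + 1)%R (lab (M d))) => [h|h]; first exact: hex_right adc bd h.
  have di : (lab (M d) < i)%R by move: h nda ndc; clear; lia.
  case: (ltP (- i)%R (lab (M d))) => [h1|h1].
    by apply: (hex_mid adc bd) => //; rewrite h1.
  have h2 : (lab (M d) < - i - 1)%R by move: h1 ndna ndnc; clear; lia.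
  (* Here d stands before -c. Either -d, which then stands after c, also lies between a and c, or d
     exceeds -a and can be moved up to a past smaller labels. *)
  case: (ltP (lab d) (- lab a)%R) => dna.
    apply: (@hex_right (negl d)) => //; last by rewrite (lab_signed _ sM); move: h2; clear; lia.
    rewrite lab_neg; have := asc (e := c) (f := negl d).
    rewrite lab_neg (lab_signed _ sM) pc; move: dna h2 pa0 d4 adc; clear; lia.
  apply: (hex_left adc bd) => //.
    move=> f /andP[h3 h4]; rewrite ltNge le_eqVlt negb_or; apply/andP; split.
      by apply: contraTneq h3 => /lab_inj ->; rewrite ltxx.
    apply/negP => df; have := asc h3 df; rewrite pc.
    have := asc (e := negl a) (f := f); rewrite lab_neg (lab_signed _ sM) pc.
    have : lab (M f) = (- i)%R -> lab f = (- lab a)%R.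
      by rewrite -(lab_signed _ sM) => /lab_inj/perm_inj ->; rewrite lab_neg.
    by move: df dna h4 pa0 d3; clear; lia.
  by move: dna la0; clear; lia.
have inT d : (lab a < lab d < lab c)%R -> [|| lab d == lab b, lab d == - lab b,
    lab d == - lab a | lab d == - lab c]%R.
  by move=> h; have := noT d; rewrite /T h /=; clear; lia.
have b0 := lab_neq0 b; have c0 := lab_neq0 c.
have ndb e : lab e = (- lab b)%R -> e = negl b by move=> h; apply: lab_inj; rewrite lab_neg.
(* With no other label available, -b can play the role of d if it lies between a and c and stands in
   the inner positions. *)
case: (boolP ((lab a < - lab b < lab c)%R && (- i < lab (M b) < i)%R)) => [/andP[hb1 hb2]|nmid].
  apply: (@hex_mid (negl b)); rewrite ?lab_neg ?(lab_signed _ sM) //.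
  - by rewrite eq_sym negl_neq.
  - by move: pb hb2; case: (up b) => //; clear; lia.
  by move: hb2; clear; lia.
have inner e : (- i < lab (M e) < i)%R -> (lab a < lab e < - lab a)%R.
  move=> he; have h1 := asc (e := e) (f := a); have h2 := asc (e := negl a) (f := e).
  rewrite lab_neg (lab_signed _ sM) pc in h2; rewrite pc in h1.
  have h3 : lab e != lab a.
    by apply: contraTneq he => /lab_inj ->; rewrite ltxx andbF.
  have h4 : lab e != (- lab a)%R.
    rewrite -lab_neg; apply: contraTneq he => /lab_inj ->.
    by rewrite (lab_signed _ sM) ltxx.
  by move: he h1 h2 h3 h4 pa0; clear; lia.
have posb e : lab e = lab b \/ lab e = (- lab b)%R ->
    lab (M e) = lab (M b) \/ lab (M e) = (- lab (M b))%R.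
  case=> [/lab_inj ->|/ndb ->]; [by left | right; exact: lab_signed].
have posna e : lab e = (- lab a)%R -> lab (M e) = (- i)%R.
  by rewrite -lab_neg => /lab_inj ->; rewrite lab_signed.
have posnc e : lab e = (- lab c)%R -> lab (M e) = (- i - 1)%R.
  by rewrite -lab_neg => /lab_inj ->; rewrite lab_signed // pc opprD.
have outer : i = 1%R -> lab b != (- lab a)%R -> lab b != (- lab c)%R -> bout M (-2) 2 b.
  move=> i1 h1 h2; have p1 : lab (M b) != (- i)%R.
    by rewrite -(lab_signed _ sM); apply: pos_ne; rewrite lab_neg.
  have p2 : lab (M b) != (- i - 1)%R.
    rewrite -opprD -pc -(lab_signed _ sM); apply: pos_ne; rewrite lab_neg; exact: h2.
  move: pb p1 p2 (pos0 b); rewrite ?boutE i1; case: ifP => _; clear; lia.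
have small j : (0 < j < i)%R -> exists e, lab (M e) = j.
  move=> hj; have [z zE] : exists z : L, lab z = j.
    by apply: lab_ex; have := lab_bound (M a); move: hj; clear; lia.
  by exists ((M^-1)%g z); rewrite permKV.
case: (boolP ((- lab a < lab c)%R && (lab b != - lab a)%R)) => [/andP[h1 h2]|n2].
  have i1 : i = 1%R.
    case: (ltP 1%R i) => [i1|]; last by move: pa0; clear; lia.
    have [|e eE] := @small 1%R; first by rewrite i1.
    have hin : (- i < lab (M e) < i)%R by rewrite eE; move: i1; clear; lia.
    have hie := inner _ hin; have [|pe|pe] := posb e.
    - have := inT e; have := posna e; have := posnc e; rewrite eE.
      by move: hie h1 i1; clear; lia.
    - exfalso; move: nmid; have hinb : (- i < lab (M b) < i)%R.
        by move: hin; rewrite pe.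
      by rewrite hinb andbT; have := inner _ hinb; move: h1; clear; lia.
    exfalso; move: nmid; have hinb : (- i < lab (M b) < i)%R.
      by move: hin; rewrite pe; clear; lia.
    by rewrite hinb andbT; have := inner _ hinb; move: h1; clear; lia.
  apply: (octagon_nega n_ge2 cong IH abc cvM la0 h1); rewrite ?lab_eq ?lab_neg //.
    by rewrite /oct pc i1.
  by apply: outer => //; move: abc h1; clear; lia.
case: (boolP ((lab a < - lab c)%R && (0 < lab c)%R && (lab b != - lab c)%R)); last first.
  have := inT _ adc0; move: n2 adc0 bd0 abc nca la0; rewrite lab_eq; clear; lia.
case/andP => /andP[h1 h2] h3.
have h4 : (lab c < - lab a)%R by move: h1; clear; lia.
have bna : lab b != (- lab a)%R by move: abc h4; clear; lia.
(* As 0 < c < -a, the negative one of e and -e lies between a and c; among the labels left there,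
   only b and -b can stand in inner positions. This bounds i by 2. *)
have innb e : (- i < lab (M e) < i)%R -> lab (M e) = lab (M b) \/ lab (M e) = (- lab (M b))%R.
  move=> hin; have hie := inner _ hin; have e0 := lab_neq0 e.
  case: (ltP (lab e) 0%R) => en.
    apply: posb; have := inT e; have := posna e; have := posnc e.
    by move: hin hie en h2 la0; clear; lia.
  have := inT (negl e); have := posna (negl e); have := posnc (negl e).
  have := posb (negl e); rewrite lab_neg (lab_signed _ sM).
  by move: hin hie en e0 h2 la0; clear; lia.
case: (ltP 1%R i) => [i1|]; last first.
  move=> i1; have {}i1 : i = 1%R by move: i1 pa0; clear; lia.
  apply: (octagon_negc n_ge2 cong IH abc cvM h2 h4); rewrite ?lab_eq ?lab_neg //.
    by rewrite /oct pc i1.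
  exact: outer.
have [|e1 e1E] := @small 1%R; first by rewrite i1.
have pb1 : lab (M b) = 1%R \/ lab (M b) = (- 1)%R.
  have := innb e1; rewrite e1E; move: i1; clear; lia.
have i2 : i = 2%R.
  case: (ltP 2%R i) => [i2|]; last by move: i1; clear; lia.
  have [|e2 e2E] := @small 2%R; first by rewrite i2.
  by have := innb e2; rewrite e2E; move: pb1 i2; clear; lia.
have bc : (lab b < - lab c)%R.
  have hinb : (- i < lab (M b) < i)%R by rewrite i2; move: pb1; clear; lia.
  have := inner _ hinb; move: nmid; rewrite hinb andbT; move: h3; clear; lia.
(* Now b or -b has position 1, and a, c have positions 2, 3. The doubled position of -c is -6, so
   the key -7 puts b just before -c and leaves a, c as the first two positive entries. *)
pose k : int := (- 7)%R.
have [|x sx xE] := @relocate n M b k sM; first by move=> z; rewrite /k; clear; lia.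
have aa : (lab a != lab b) && (lab a != - lab b)%R by move: abc bna; clear; lia.
have ca : (lab c != lab b) && (lab c != - lab b)%R by move: abc h3; clear; lia.
have nxac : nxt (lab (x a)) (lab (x c)).
  by apply: (reloc_nxt xE aa ca (cov_nxt cvM)); rewrite pc i2.
have nax : nxt (lab (x (negl a))) (lab (x a)).
  have ana : (lab (negl a) != lab b) && (lab (negl a) != - lab b)%R.
    by rewrite lab_neg; move: aa; clear; lia.
  apply: adj_nxt; first by rewrite (reloc_out xE ana aa) (lab_signed _ sM) i2.
  move=> g; case: (reloc_case b g) => [->|->|ag].
  - by rewrite (reloc_r xE) // (lab_signed _ sM) i2.
  - by rewrite (reloc_nl xE) // i2.
  rewrite !(reloc_out xE) // (lab_signed _ sM) i2 => hg.
  have := reloc_away_nd sM ag; have := pos0 g; move: hg pb1; clear; lia.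
have O : oct x a c.
  move: nax nxac; rewrite lab_signed // /oct /nxt; move: (lab (x a)) (lab (x c)).
  by clear; lia.
have cx := cov_rf sx ac nxac.
have xM : wle x M.
  apply: (relocated_wle sM xE) => [f bf|e eb|bp|bn]; rewrite /k.
  - by move: pb1; clear; lia.
  - have := posnc e; have := posna e; have := pos0 e; have := innb e.
    have : lab (M e) != lab (M b) by apply: pos_ne; move: eb; clear; lia.
    have ne3 : lab (M e) = (- 3)%R -> lab e = (- lab c)%R.
      have -> : (- 3 = lab (M (negl c)))%R by rewrite lab_signed // pc i2.
      by move=> /lab_inj/perm_inj ->; rewrite lab_neg.
    have ne2 : lab (M e) = (- 2)%R -> lab e = (- lab a)%R.
      have -> : (- 2 = lab (M (negl a)))%R by rewrite lab_signed // i2.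
      by move=> /lab_inj/perm_inj ->; rewrite lab_neg.
    have neb : lab (M e) = (- lab (M b))%R -> lab e = (- lab b)%R.
      by rewrite -(lab_signed _ sM) => /lab_inj/perm_inj ->; rewrite lab_neg.
    rewrite i2; move: ne3 ne2 neb eb bc h2 la0 h4 pb1; clear; lia.
  - by move: bp bc h2; clear; lia.
  by [].
apply: (contract_transport cvM cx xM).
apply: (octagon_negc n_ge2 cong IH abc cx h2 h4); rewrite ?lab_eq ?lab_neg //.
rewrite ?boutE; move: pb; case: ifP => ub hb; last first.
  by move: hb pb1; rewrite i2; clear; lia.
suff : bef x b (negl c).
  by rewrite /bef lab_signed //; case: O => _ ->.
by rewrite (reloc_l xE) ?lab_neg ?lab_signed // ?pc ?i2 //; move: ca; clear; lia.
Qed.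

End Right.

Lemma central_step d0 : c = negl a -> lab (M a) = (- 1)%R -> (0 < lab b)%R ->
  (lab a < lab d0 < lab c)%R -> b != d0 -> b != negl d0 -> Rl M M'.
Proof.
move=> ce pa b0.
have pc : lab (M c) = 1%R by rewrite ce lab_signed // pa.
wlog d0a : d0 / (lab (M d0) < - 1)%R => [W|].
  move=> h n1 n2; case: (ltP (lab (M d0)) (- 1)%R) => hd; first exact: (W d0).
  apply: (W (negl d0)); rewrite ?neglK //; last first.
    by move: h; rewrite ce !lab_neg; clear; lia.
  have p0 := lab_neq0 (M d0).
  have : lab (M d0) != lab (M a) by apply: pos_ne; move: h; clear; lia.
  have : lab (M d0) != lab (M c) by apply: pos_ne; move: h; clear; lia.
  by rewrite pa pc lab_signed //; move: hd p0; clear; lia.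
(* The doubled position of a is -2, so the key -3 puts d0 immediately before a. *)
move=> adc bd bnd; pose k : int := (- 3)%R.
have [|x sx xE] := @relocate n M d0 k sM; first by move=> z; rewrite /k; clear; lia.
have aa : (lab a != lab d0) && (lab a != - lab d0)%R.
  by move: adc; rewrite ce lab_neg; clear; lia.
have ca : (lab c != lab d0) && (lab c != - lab d0)%R.
  by move: adc; rewrite ce lab_neg; clear; lia.
have n1 : nxt (lab (x d0)) (lab (x a)) by apply: (reloc_nxt_l xE aa); rewrite pa.
have n2 : nxt (lab (x a)) (lab (x c)).
  by apply: (reloc_nxt xE aa ca (cov_nxt cvM)); rewrite pa pc.
have O : oct x c (negl d0).
  move: n1 n2; rewrite /oct /nxt ce !lab_signed //; move: (lab (x a)) (lab (x d0)).
  by clear; lia.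
have cx := cov_rf sx ac n2.
have xM : wle x M.
  apply: (relocated_wle sM xE) => [f df|e ed|dp|dn]; rewrite /k.
  - move=> fk; rewrite ltNge le_eqVlt negb_or pos_ne /=; last by move: df; clear; lia.
    by apply/negP => h; have := asc h df; rewrite pa pc; move: fk; clear; lia.
  - by move: d0a; clear; lia.
  - by move: d0a; clear; lia.
  by [].
apply: (contract_transport cvM cx xM).
have ae : a = negl c by rewrite ce neglK.
apply: (octagon_central n_ge2 cong IH abc ae cx adc b0 bd bnd O).
have [ox1 ox2] := O; have xnd : lab (x d0) = (- 2)%R.
  by move: ox2; rewrite lab_signed //; clear; lia.
have ab : (lab b != lab d0) && (lab b != - lab d0)%R.
  by rewrite -lab_neg -!lab_eq bd.
have pb1 := lab_neq0 (M b).
have pba : lab (M b) != lab (M a) by apply: pos_ne; move: abc; clear; lia.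
have pbc : lab (M b) != lab (M c) by apply: pos_ne; move: abc; clear; lia.
move: ob; rewrite ?boutE ?onpathE /bef abc /=; case: ifP => ub hb.
  suff : bef x b d0 by rewrite /bef xnd.
  by rewrite (reloc_r xE) // /k; move: hb pba; rewrite pa; clear; lia.
suff : bef x (negl d0) b by rewrite /bef ox2.
by rewrite (reloc_nl xE) // /k; move: hb pbc; rewrite pc; clear; lia.
Qed.

End Maximal.
End Contraction.

(** * The Cambrian congruence *)

Section Generators.
Variable n : nat.
Notation L := (bool * 'I_n)%type.
Implicit Types (k : 'I_n) (z e : L).

Lemma gen_glo k : gen k (glo k) = ghi k.
Proof. by rewrite genE rfE ?glo_neq // eqxx. Qed.

Lemma gen_ghi k : gen k (ghi k) = glo k.
Proof. by rewrite genE rfE ?glo_neq // eqxx eq_sym (negbTE (glo_neq k)). Qed.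

Lemma gen_out k z : [&& lab z != lab (glo k), lab z != lab (ghi k),
  lab z != - lab (glo k) & lab z != - lab (ghi k)]%R -> gen k z = z.
Proof.
case/and4P => /negbTE h1 /negbTE h2 /negbTE h3 /negbTE h4.
by rewrite genE rfE ?glo_neq // !lab_eq !lab_neg h1 h2 h3 h4.
Qed.

Lemma gen_negl k z : gen k (negl z) = negl (gen k z).
Proof. by have /signedP := gen_signed k; apply. Qed.

Lemma genV k : ((gen k)^-1 = gen k)%g.
Proof. by rewrite -[(gen k)^-1%g]mulg1 -(genK k) mulKg. Qed.

Lemma cov_1gen k : cov 1%g (gen k) (glo k) (ghi k).
Proof. by have := @cov_gen n 1%g k (signed1 n); rewrite invg1 !perm1 mul1g; apply; apply: glo_ghi. Qed.

Lemma cov_gen2 k k2 : (lab (gen k (glo k2)) < lab (gen k (ghi k2)))%R ->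
  cov (gen k) (gen k * gen k2)%g (gen k (glo k2)) (gen k (ghi k2)).
Proof. by have := @cov_gen n (gen k) k2 (gen_signed k); rewrite genV. Qed.

Lemma cov_gen3 k k2 : (lab (gen k (gen k2 (glo k))) < lab (gen k (gen k2 (ghi k))))%R ->
  cov (gen k * gen k2)%g (gen k * gen k2 * gen k)%g
    (gen k (gen k2 (glo k))) (gen k (gen k2 (ghi k))).
Proof.
have := @cov_gen n (gen k * gen k2)%g k; rewrite invMg !permM !genV; apply.
by rewrite signedM ?gen_signed.
Qed.

Lemma glo_pred k : 0 < val k -> glo k = ghi (predord k).
Proof. by case: k => -[|m] hm //= _; apply: lab_inj; rewrite lab_glo lab_ghi. Qed.

Lemma lab_glo_pred k : 0 < val k ->
  lab (glo (predord k)) = if val k == 1 then (-1)%R else (Posz (val k) - 1)%R.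
Proof. by case: k => -[|[|m]] hm //= _; rewrite lab_glo //=; clear; lia. Qed.

Lemma gen_pred_ghi k : 0 < val k -> gen (predord k) (ghi k) = ghi k.
Proof.
move=> k0; apply: gen_out; rewrite -glo_pred // lab_glo_pred // lab_glo lab_ghi.
by move: k0; move: (val k) => m; clear; do ![case: ifP]; lia.
Qed.

Lemma gen_glo_pred k : 1 < val k -> gen k (glo (predord k)) = glo (predord k).
Proof.
move=> k1; apply: gen_out; rewrite lab_glo_pred ?(ltnW k1) // lab_glo lab_ghi.
by move: k1; move: (val k) => m; clear; do ![case: ifP]; lia.
Qed.

Lemma glo_pred1 k : val k = 1 -> glo (predord k) = negl (glo k).
Proof. by move=> k1; apply: lab_inj; rewrite lab_neg lab_glo_pred ?k1 // lab_glo k1. Qed.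

(** These covers form the chains from t to the second word of [camb_pair]: one chain for each
    direction of the edge, with an additional cover for the bond of order 4. *)
Lemma cov_up2 k : 0 < val k ->
  cov (gen (predord k)) (gen (predord k) * gen k)%g (glo (predord k)) (ghi k).
Proof.
move=> k0; have := @cov_gen2 (predord k) k.
rewrite !(glo_pred k0) gen_ghi gen_pred_ghi //; apply.
by apply: lt_trans (glo_ghi (predord k)) _; rewrite -glo_pred // glo_ghi.
Qed.

Lemma cov_up3 k : val k = 1 ->
  cov (gen (predord k) * gen k)%g (gen (predord k) * gen k * gen (predord k))%g
    (negl (ghi k)) (ghi k).
Proof.
move=> k1; have k0 : 0 < val k by rewrite k1.
have := @cov_gen3 (predord k) k; rewrite glo_pred1 // !gen_negl -glo_pred // !gen_glo.
rewrite !gen_pred_ghi // lab_neg; apply.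
by rewrite lab_ghi; clear; lia.
Qed.

Lemma cov_down2 k : 1 < val k ->
  cov (gen k) (gen k * gen (predord k))%g (glo (predord k)) (ghi k).
Proof.
move=> k1; have k0 := ltnW k1; have := @cov_gen2 k (predord k).
rewrite -glo_pred // gen_glo gen_glo_pred //; apply.
by apply: lt_trans (glo_ghi (predord k)) _; rewrite -glo_pred // glo_ghi.
Qed.

Lemma cov_down2_1 k : val k = 1 ->
  cov (gen k) (gen k * gen (predord k))%g (negl (ghi k)) (ghi k).
Proof.
move=> k1; have k0 : 0 < val k by rewrite k1.
have := @cov_gen2 k (predord k).
rewrite -glo_pred // gen_glo glo_pred1 // gen_negl gen_glo; apply.
by rewrite lab_neg lab_ghi.
Qed.

Lemma cov_down3 k : val k = 1 ->
  cov (gen k * gen (predord k))%g (gen k * gen (predord k) * gen k)%g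
    (glo (predord k)) (ghi k).
Proof.
move=> k1; have k0 : 0 < val k by rewrite k1.
have := @cov_gen3 k (predord k).
rewrite !(glo_pred k0) gen_ghi gen_pred_ghi // gen_ghi glo_pred1 // gen_negl gen_glo => h.
have := cov_neg (h _); rewrite neglK; apply.
by rewrite lab_neg lab_ghi lab_glo k1.
Qed.

End Generators.

(** * Contraction of all covers with a path vertex between *)

Section Forcing.
Variables (n : nat) (o : nat -> bool).
Variable Rl : {perm bool * 'I_n} -> {perm bool * 'I_n} -> Prop.
Notation L := (bool * 'I_n)%type.
Implicit Types (w x y m t u : {perm L}) (a b c d e f v : L) (k : 'I_n).
Hypothesis n_ge2 : 2 <= n.
Hypothesis cong : lattice_congruence Rl.
Hypothesis gensR : forall k, 0 < val k -> Rl (camb_pair o k).1 (camb_pair o k).2.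
Variable up : L -> bool.
Hypothesis up_neg : forall e : L, up (negl e) = ~~ up e.
Hypothesis upE : forall i : 'I_n, (val i).+1 < n -> up (false, i) = o (val i).+1.
Local Notation onpath := (onpath up).
Local Notation contracted := (contracted Rl up).

Let S2 k k2 : (gen k * gen k2)%g \in signedperms n.
Proof. by rewrite signedM ?gen_signed. Qed.
Let S3 k k2 : (gen k * gen k2 * gen k)%g \in signedperms n.
Proof. by rewrite !signedM ?gen_signed. Qed.

Lemma up_glo k : 0 < val k -> up (glo k) = o (val k).
Proof.
move=> k0; rewrite /glo; have -> : (val k == 0) = false by case: eqP k0 => // ->.
by rewrite upE /= prednK.
Qed.

Lemma contract_gen x y m m' a c : cov x y a c -> cov m m' a c -> Rl m m' -> wle m x -> Rl x y.
Proof. by move=> cv cm mm' mx; apply: (contract_transport n_ge2 cong cv cm mx mm'). Qed.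

Lemma wle1 x : x \in signedperms n -> wle 1%g x.
Proof. by move=> sx; apply/wleP => e f ef; rewrite /bef !perm1 ltNge ltW. Qed.

Lemma wle_gen x k : x \in signedperms n -> bef x (ghi k) (glo k) -> wle (gen k) x.
Proof.
move=> sx h; apply: (cov_wle_above (cov_1gen k) sx (wle1 sx)).
by rewrite in_ivs glo_ghi.
Qed.

Section UpCase.
Variable k : 'I_n.
Hypothesis k0 : 0 < val k.
Local Notation k' := (predord k).
Hypothesis ok : o (val k).

Let c2 := cov_up2 k0.

(** A congruence relating the ends of a chain relates its consecutive elements, so each cover in the
    chain of the generating pair is contracted. *)
Lemma up_gens2 : Rl (gen k') (gen k' * gen k)%g /\
  (val k = 1 -> cov (gen k' * gen k)%g (gen k' * gen k * gen k')%g (negl (ghi k)) (ghi k) /\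
     Rl (gen k' * gen k)%g (gen k' * gen k * gen k')%g).
Proof.
have := gensR k0; rewrite /camb_pair ok /=; case: eqP => [k1 R|]; last by split.
have c3 := cov_up3 k1.
have [] := cong_convex n_ge2 cong (gen_signed k') (S2 k' k) (S3 k' k)
  (cov_wle c2) (cov_wle c3) R.
by split.
Qed.

Lemma base_up : contracted (glo k') (ghi k) (glo k).
Proof.
move=> x y cv /andP[_]; rewrite up_glo // ok => h.
have [sx _ _ _ _] := cv; have [R _] := up_gens2.
by apply: (contract_gen cv c2 R); apply: wle_gen; rewrite // -glo_pred.
Qed.

Lemma base_central_up : val k = 1 -> contracted (negl (ghi k)) (ghi k) (glo k).
Proof.
move=> k1 x y cv ob; have [sx _ _ xac _] := cv.
have [_ /(_ k1) [c3 R]] := up_gens2; apply: (contract_gen cv c3 R).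
move: ob => /andP[_]; rewrite up_glo // ok => h.
have h2 : bef x (ghi k) (negl (glo k)) by rewrite -bef_neg // neglK.
have n1 := glo_pred1 k1.
apply: (cov_wle_above c2 sx); last by rewrite in_ivs n1 h2 andbT; case: c2; rewrite n1.
apply: wle_gen => //; rewrite n1 -glo_pred //.
exact: bef_trans (bef_trans h xac) h2.
Qed.

End UpCase.

Section DownCase.
Variable k : 'I_n.
Hypothesis k0 : 0 < val k.
Local Notation k' := (predord k).
Hypothesis ok : o (val k) = false.

Lemma base_down_big : 1 < val k -> contracted (glo k') (ghi k) (glo k).
Proof.
move=> k1 x y cv /andP[_]; rewrite up_glo // ok => h; have [sx _ ac _ _] := cv.
have := gensR k0; rewrite /camb_pair ok /=.
have -> : (val k == 1) = false by case: eqP k1 => // ->.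
have c2 := cov_down2 k1.
by move=> R; apply: (contract_gen cv c2 R); apply: wle_gen.
Qed.

Section One.
Hypothesis k1 : val k = 1.

Let c2 := cov_down2_1 k1.
Let c3 := cov_down3 k1.

Let RR : Rl (gen k) (gen k * gen k')%g /\ Rl (gen k * gen k')%g (gen k * gen k' * gen k)%g.
Proof.
have := gensR k0; rewrite /camb_pair ok k1 /= => R.
exact: (cong_convex n_ge2 cong (gen_signed k) (S2 k k') (S3 k k') (cov_wle c2) (cov_wle c3) R).
Qed.

Lemma base_central_down : contracted (negl (ghi k)) (ghi k) (glo k).
Proof.
move=> x y cv /andP[_]; rewrite up_glo // ok => h; have [sx _ _ _ _] := cv.
by have [R _] := RR; apply: (contract_gen cv c2 R); apply: wle_gen.
Qed.

Lemma base_down_one : contracted (glo k') (ghi k) (glo k).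
Proof.
move=> x y cv /andP[_]; rewrite up_glo // ok => h; have [sx _ _ xac _] := cv.
have [_ R] := RR; apply: (contract_gen cv c3 R).
have n1 := glo_pred1 k1; have adj := @cov_adj _ _ _ _ _ _ cv.
apply: (cov_wle_above c2 sx); first exact: wle_gen.
rewrite in_ivs; have [_ _ -> _ _] := c2.
have ne : negl (ghi k) != ghi k by apply: negl_neq.
(* As 2 precedes 1, -2 follows -1, and hence it also follows 2, the neighbour of -1. *)
rewrite -bef_total //; apply/negP => hn; move: (adj (negl (ghi k))); rewrite hn n1 => W.
by have := W _; rewrite bef_neg // h => /(_ isT).
Qed.
End One.

End DownCase.

Lemma base_consecutive k : 0 < val k -> contracted (glo (predord k)) (ghi k) (glo k).
Proof.
move=> k0; case: (boolP (o (val k))) => [ok|/negbTE ok]; first exact: base_up.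
case: (ltngtP 1 (val k)) => k1; first exact: base_down_big.
  by move: k0 k1; clear; lia.
exact: base_down_one (esym k1).
Qed.

Lemma base_central k : val k = 1 -> contracted (negl (ghi k)) (ghi k) (glo k).
Proof.
move=> k1; have k0 : 0 < val k by rewrite k1.
by case: (boolP (o (val k))) => [ok|/negbTE ok]; [apply: base_central_up | apply: base_central_down].
Qed.

(** With only b between them, a and c are the labels next to b; up to negation the three are those
    of a generating pair. *)
Lemma contracted_base a b c : (lab a < lab b < lab c)%R ->
  (forall d, (lab a < lab d < lab c)%R -> d = b) -> contracted a c b.
Proof.
suff pos a' b' c' : (0 < lab b')%R -> (lab a' < lab b' < lab c')%R ->
    (forall d, (lab a' < lab d < lab c')%R -> d = b') -> contracted a' c' b'.
  move=> abc h; case: (ltP 0%R (lab b)) => b0; first exact: pos.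
  have := @pos (negl c) (negl b) (negl a); rewrite !lab_neg => W.
  rewrite -[a]neglK -[b]neglK -[c]neglK; apply: (contracted_neg up_neg); apply: W.
  - by have := lab_neq0 b; move: b0; clear; lia.
  - by move: abc; clear; lia.
  move=> d hd; rewrite -(h (negl d)) ?neglK // lab_neg; move: hd; clear; lia.
move=> {a b c} b0 abc h.
have cb : lab c' = (lab b' + 1)%R.
  have [d dE] : exists d : L, lab d = (lab b' + 1)%R.
    by apply: lab_ex; have := lab_bound c'; move: abc b0; clear; lia.
  case: (ltP (lab d) (lab c')) => dc; last by move: dc abc; rewrite dE; clear; lia.
  by have := h d; rewrite dc dE => /(_ _) e; move: dE; rewrite e; move: abc; clear; lia.
have ab : lab a' = (if lab b' == 1 then -1 else lab b' - 1)%R.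
  have [d dE] : exists d : L, lab d = (if lab b' == 1 then -1 else lab b' - 1)%R.
    by apply: lab_ex; have := lab_bound b'; move: b0; case: ifP; clear; lia.
  case: (ltP (lab a') (lab d)) => ad; last first.
    by have := lab_neq0 a'; move: ad abc; rewrite dE; case: ifP; clear; lia.
  have := h d; rewrite ad dE => W; have e : d = b'.
    by apply: W; move: abc b0; case: ifP; clear; lia.
  by move: dE; rewrite e; move: b0; case: ifP; clear; lia.
have kn : `|lab b'|%N < n by have := lab_bound c'; move: cb b0; clear; lia.
pose k := Ordinal kn; have k0 : 0 < val k by rewrite /=; move: b0; clear; lia.
have vk : lab b' = Posz (val k) by rewrite /=; move: b0; clear; lia.
have -> : b' = glo k.
  by apply: lab_inj; rewrite lab_glo vk; case: eqP k0 => // ->.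
have -> : c' = ghi k by apply: lab_inj; rewrite lab_ghi cb vk; clear; lia.
have -> : a' = glo (predord k) by apply: lab_inj; rewrite lab_glo_pred // ab vk.
exact: base_consecutive.
Qed.

(** If a label other than b lies between a and c, pass to a maximal cover. Its pair stands in
    positive positions, in negative ones, which negation reduces to the former, or in the centre. *)
Lemma contracted_all a b c : contracted a c b.
Proof.
have [N leN] := ubnP `|(lab c - lab a)%R|%N; elim: N a b c leN => // N IHN a b c leN.
move=> x y cv ob; have abc : (lab a < lab b < lab c)%R by case/andP: ob.
have IH b' a' c' : (lab c' - lab a' < lab c - lab a)%R -> contracted a' c' b'.
  move=> lt_ac; case: (ltP (lab a') (lab c')) => ac'.
    by apply: IHN; move: leN abc lt_ac ac'; clear; lia.
  by move=> x1 y1 [_ _]; rewrite ltNge ac'.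
case: (pickP (fun d => (lab a < lab d < lab c)%R && (b != d))) => [d /andP[adc bd]|nod].
  have [M [M' [cvM xM asc]]] := maximal_cover cv.
  have [sM _ _ _ _] := cvM; have [sx _ _ xac _] := cv.
  have obM : onpath M a c b.
    rewrite ?onpathE abc /=; case/andP: ob => _; case: ifP => ub hb.
      by apply: (wle_bef xM) hb; case/andP: abc.
    by apply: (wle_bef xM) hb; case/andP: abc.
  suff R : Rl M M'.
    have [_ sM' _ _ _] := cvM; have [_ sy ac _ _] := cv.
    have yM' : wle y M'.
      apply: (cov_wle_above cv) => //; first exact: wle_trans xM (cov_wle cvM).
      exact: cov_in cvM.
    apply: (contract_below n_ge2 cong cv sM sM' R yM') => m sm my mM.
    by apply/negP => /(wle_bef mM ac); case: cvM => _ _ _ /bef_asym ->.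
  have nx := cov_nxt cvM.
  case: (ltgtP 0%R (lab (M a))) => pa; last by have := lab_neq0 (M a); rewrite -pa eqxx.
    exact: (right_step n_ge2 cong (IH b) abc cvM asc obM pa adc bd).
  case: (eqVneq (lab (M a)) (- 1)%R) => pa1.
    have ce : c = negl a.
      apply: (@perm_inj _ M); apply: lab_inj; rewrite lab_signed //.
      by move: nx; rewrite /nxt pa1; clear; lia.
    have cen b1 : (0 < lab b1)%R -> (lab a < lab b1 < lab c)%R -> onpath M a c b1 ->
        (forall d1, (lab a < lab d1 < lab c)%R -> b1 != d1 -> b1 != negl d1 -> Rl M M') ->
        Rl M M'.
      move=> b0 abc1 ob1 W.
      case: (pickP (fun d => (lab a < lab d < lab c)%R && (b1 != d) && (b1 != negl d))).
        by move=> d1 /andP[/andP[h1 h2] h3]; apply: W h1 h2 h3.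
      (* A central exchange enclosing only one label and its negative is that of -2 and 2, which the
         generators contract. *)
      move=> nod; have small e : (lab a < lab e < lab c)%R -> lab e = lab b1 \/ lab e = (- lab b1)%R.
        by move=> h; have := nod e; rewrite h /= !lab_eq lab_neg; clear; lia.
      have lc : lab c = (- lab a)%R by rewrite ce lab_neg.
      have b11 : lab b1 = 1%R.
        have [e eE] : exists e : L, lab e = 1%R by apply: lab_ex; move: n_ge2; clear; lia.
        by have := small e; rewrite eE; move: abc1 b0 lc; clear; lia.
      have c2 : lab c = 2%R.
        have [e eE] : exists e : L, lab e = 2%R by apply: lab_ex; move: n_ge2; clear; lia.
        by have := small e; rewrite eE; move: abc1 b11 lc; clear; lia.
      pose k := Ordinal (n_ge2 : 1 < n).
      have bE : b1 = glo k by apply: lab_inj; rewrite b11 lab_glo.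
      have cE : c = ghi k by apply: lab_inj; rewrite c2 lab_ghi.
      have aE : a = negl (ghi k) by rewrite -cE ce neglK.
      by move: cvM ob1; rewrite aE cE bE; apply: base_central.
    case: (ltP 0%R (lab b)) => b0.
      apply: (cen b) => // d1 h1 h2 h3.
      exact: (central_step n_ge2 cong (IH b) abc cvM asc obM ce pa1 b0 h1 h2 h3).
    have b0' : (0 < lab (negl b))%R by rewrite lab_neg; have := lab_neq0 b; move: b0; clear; lia.
    have abc' : (lab a < lab (negl b) < lab c)%R.
      by move: abc; rewrite ce !lab_neg; clear; lia.
    have obM' : onpath M a c (negl b).
      by have := onpath_neg up_neg sM obM; rewrite ce neglK.
    apply: (cen (negl b)) => // d1 h1 h2 h3.
    exact: (central_step n_ge2 cong (IH (negl b)) abc' cvM asc obM' ce pa1 b0' h1 h2 h3).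
  have cvM' := cov_neg cvM; have asc' := only_ascent_neg sM asc.
  have obM' := onpath_neg up_neg sM obM.
  apply: (@right_step n Rl n_ge2 cong up (negl c) (negl a) (negl b) M M') (negl d) _ _ => //.
  - by move=> a' c'; rewrite !lab_neg => h; apply: IH; move: h; clear; lia.
  - by rewrite !lab_neg; move: abc; clear; lia.
  - by rewrite lab_signed //; move: nx pa pa1; rewrite /nxt; clear; lia.
  - by rewrite !lab_neg; move: adc; clear; lia.
  by rewrite (inj_eq (@negl_inj n)).
apply: (contracted_base abc _ cv ob) => d adc.
by have := nod d; rewrite adc /= => /negbFE /eqP.
Qed.

(** Descend to the bottom by covers inside the fibre. Each of them has some b on the path: otherwise
    a diagonal of the lower element would separate a from c and be violated by the upper one. *)
Lemma forced_pd x : x \in signedperms n -> Rl x (pd up x).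
Proof.
have [N leN] := ubnP #|ivs x|; elim: N x leN => // N IHN x leN sx.
have spd := pd_signed up_neg sx.
case: (eqVneq (pd up x) x) => [->|ne]; first by case: cong => h _; apply: h.
have [y [a [c [cv py]]]] := chain_down spd sx (pd_le up_neg sx) ne.
have [sy _ ac _ _] := cv.
have pE : pd up y = pd up x.
  apply: wle_anti; first exact: (pd_mono up_neg sy sx (cov_wle cv)).
  by rewrite -{1}(pd_idem up_neg sx); apply: (pd_mono up_neg).
have dE : diags up y = diags up x by apply/(pd_eq up_neg).
have R : Rl y x.
  case: (pickP (onpath y a c)) => [b ob|nop]; first exact: (@contracted_all a b c).
  exfalso; have [_ _ _ yac _] := cv; have adj := @cov_adj _ _ _ _ _ _ cv.
  have cl : clear_between up y a c.
    move=> b hb; have := nop b; rewrite ?onpathE.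
    have -> /= : (lab a < lab b < lab c)%R by move: hb ac; clear; lia.
    have nba : b != a by rewrite lab_eq; move: hb; clear; lia.
    have nbc : b != c by rewrite lab_eq; move: hb; clear; lia.
    by case: ifP => _ /negbT; rewrite bef_total // eq_sym.
  have [p [q [d yp Aa Bc _]]] := tpos_edge (tpos_tperm yac adj) cl.
  have := eq_diags_sub dE d yp => /compatP /(_ _ _ Aa Bc).
  by rewrite (bef_asym (cov_bef cv)).
have lt_card : #|ivs y| < #|ivs x|.
  apply: proper_card; rewrite properE -/(wle y x) (cov_wle cv); apply/subsetPn.
  by exists (a, c); rewrite ?(cov_in cv) ?(cov_notin cv).
have := IHN y (leq_trans lt_card leN) sy; rewrite pE.
by apply: (cong_trans cong) => //; apply: (cong_sym cong).
Qed.


End Forcing.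

(** * The fibres are the classes of the Cambrian congruence *)

Section FibreCongruence.
Variables (n : nat) (o : nat -> bool) (up : bool * 'I_n -> bool).
Notation L := (bool * 'I_n)%type.
Implicit Types (w x y z m : {perm L}) (k : 'I_n).
Hypothesis n_ge2 : 2 <= n.
Hypothesis up_neg : forall e : L, up (negl e) = ~~ up e.
Hypothesis upE : forall i : 'I_n, (val i).+1 < n -> up (false, i) = o (val i).+1.

(** The monotone projection [pd] to the bottom of the fibre gives compatibility with meets, and [pu]
    to the top gives compatibility with joins. *)
Lemma fibre_congruence : lattice_congruence (fun x y => diags up x = diags up y).
Proof.
split; first by [].
split; first by move=> x y _ _ ->.
split; first by move=> x y z _ _ _ -> ->.
split=> x y z m m' sx sy sz e [sm [mx [mz hm]]] [sm' [my' [mz' hm']]].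
  have key x1 y1 m1 m2 : x1 \in signedperms n -> y1 \in signedperms n ->
      m1 \in signedperms n -> m2 \in signedperms n -> diags up x1 = diags up y1 ->
      weak_le m1 x1 -> weak_le m1 z ->
      (forall u, u \in signedperms n -> weak_le u y1 -> weak_le u z -> weak_le u m2) ->
      wle (pd up m1) (pd up m2).
    move=> s1 s2 s3 s4 e1 h1 h2 h3; rewrite weak_leE // in h1; rewrite weak_leE // in h2.
    have sp := pd_signed up_neg s3; rewrite -(pd_idem up_neg s3).
    apply: (pd_mono up_neg) => //; rewrite -weak_leE //; apply: h3 => //.
      rewrite weak_leE //; apply: wle_trans (pd_le up_neg s2).
      by rewrite -((pd_eq up_neg s1 s2).1 e1); apply: (pd_mono up_neg).
    by rewrite weak_leE //; apply: wle_trans h2; apply: (pd_le up_neg).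
  apply/(pd_eq up_neg sm sm'); apply: wle_anti; first exact: (key x y).
  exact: (key y x).
have key x1 y1 m1 m2 : x1 \in signedperms n -> y1 \in signedperms n ->
    m1 \in signedperms n -> m2 \in signedperms n -> diags up x1 = diags up y1 ->
    weak_le x1 m1 -> weak_le z m1 ->
    (forall u, u \in signedperms n -> weak_le y1 u -> weak_le z u -> weak_le m2 u) ->
    wle (pu up m2) (pu up m1).
  move=> s1 s2 s3 s4 e1 h1 h2 h3; rewrite weak_leE // in h1; rewrite weak_leE // in h2.
  have sp := pu_signed up_neg s3.
  have -> : pu up m1 = pu up (pu up m1) by apply: (pu_eq up_neg); rewrite ?diags_pu.
  apply: (pu_mono up_neg) => //; rewrite -weak_leE //; apply: h3 => //.
    rewrite weak_leE //; apply: wle_trans (pu_ge up_neg s2) _.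
    by rewrite -(pu_eq up_neg s1 s2 e1); apply: (pu_mono up_neg).
  by rewrite weak_leE //; apply: wle_trans h2 _; apply: (pu_ge up_neg).
rewrite -(diags_pu up_neg sm) -(diags_pu up_neg sm'); congr diags.
by apply: wle_anti; [apply: (key y x) | apply: (key x y)].
Qed.

Lemma fibre_generators k : 0 < val k ->
  diags up (camb_pair o k).1 = diags up (camb_pair o k).2.
Proof.
move=> k0; have ub := up_glo upE k0; have lt_k := glo_ghi k.
have lt_k' : (lab (glo (predord k)) < lab (glo k))%R by rewrite (glo_pred k0) glo_ghi.
rewrite /camb_pair; case: (boolP (o (val k))) ub => [ok|/negbTE ok] ub /=.
  have e2 : diags up (gen (predord k)) = diags up (gen (predord k) * gen k)%g.
    apply: (onpath_diags up_neg (cov_up2 k0) (b := glo k)).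
    rewrite /onpath lt_k' lt_k ub /= /bef {1}(glo_pred k0) gen_ghi gen_glo glo_ghi //.
  case: eqP => [k1|_] //; rewrite e2.
  apply: (onpath_diags up_neg (cov_up3 k1) (b := glo k)).
  have E1 : (gen (predord k) * gen k)%g (glo k) = negl (ghi k).
    by rewrite permM {1}(glo_pred k0) gen_ghi glo_pred1 // gen_negl gen_glo.
  have E2 : (gen (predord k) * gen k)%g (negl (ghi k)) = negl (glo k).
    by rewrite permM !gen_negl gen_pred_ghi // gen_ghi.
  have vk : val k = 1 := k1.
  by rewrite /onpath ub /bef E1 E2 !lab_neg lab_glo lab_ghi vk.
case: (eqVneq (val k) 1) => k1.
  have e2 : diags up (gen k) = diags up (gen k * gen (predord k))%g.
    apply: (onpath_diags up_neg (cov_down2_1 k1) (b := glo k)).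
    by rewrite /onpath ub /bef gen_glo gen_ghi lt_k lab_neg lab_glo lab_ghi k1.
  rewrite e2; apply: (onpath_diags up_neg (cov_down3 k1) (b := glo k)).
  rewrite /onpath ub lt_k' lt_k /= /bef !permM gen_glo gen_ghi gen_pred_ghi //.
  by rewrite {1}(glo_pred k0) gen_ghi; apply: lt_trans lt_k' lt_k.
have k2 : 1 < val k by move: k0 k1; move: (val k) => j; clear; lia.
apply: (onpath_diags up_neg (cov_down2 k2) (b := glo k)).
by rewrite /onpath ub lt_k' lt_k /= /bef gen_glo gen_ghi lt_k.
Qed.

Lemma ThetaP v w : v \in signedperms n -> w \in signedperms n ->
  Theta o v w <-> diags up v = diags up w.
Proof.
move=> sv sw; split=> [h|e].
  exact: (h (fun x y => diags up x = diags up y) fibre_congruence fibre_generators).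
move=> Rl cong gensR.
have Rv := forced_pd n_ge2 cong gensR up_neg upE sv.
have Rw := forced_pd n_ge2 cong gensR up_neg upE sw.
have spv := pd_signed up_neg sv; have spw := pd_signed up_neg sw.
apply: (cong_trans cong (y := pd up v)) => //.
rewrite ((pd_eq up_neg sv sw).1 e); exact: cong_sym.
Qed.

Lemma camb_leP v w : v \in signedperms n -> w \in signedperms n ->
  camb_le o v w <-> wle (pd up v) (pd up w).
Proof.
move=> sv sw; have spv := pd_signed up_neg sv; have spw := pd_signed up_neg sw.
split=> [[v' [w' [sv' sw' /ThetaP ev /ThetaP ew]]]|h].
  rewrite weak_leE // => h.
  rewrite ((pd_eq up_neg sv sv').1 (ev sv sv')) ((pd_eq up_neg sw sw').1 (ew sw sw')).
  exact: pd_mono.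
exists (pd up v), (pd up w); split; rewrite ?weak_leE //.
  by apply/ThetaP; rewrite ?diags_pd.
by apply/ThetaP; rewrite ?diags_pd.
Qed.

End FibreCongruence.

(** * The polygon and its triangulations *)

Section Polygon.
Variables (n : nat) (o : nat -> bool) (upn : bool).
Variables (R : realFieldType) (px py : bool * 'I_n.+1 -> R).
Notation L := (bool * 'I_n)%type.
Notation V := (bool * 'I_n.+1)%type.
Implicit Types (u v : L) (p q r s x y z : V).
Hypothesis px_lt : forall x y, (vlab x < vlab y)%R -> (px x < px y)%R.
Hypothesis pneg : forall x, px (vneg x) = (- px x)%R /\ py (vneg x) = (- py x)%R.
Hypothesis py_end : forall x : V, val x.2 = n -> py x = 0%R.
Hypothesis py_up : forall x : V, val x.2 < n -> (0 < py x)%R = vup o upn x.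
Hypothesis convex : convex_pos px py.

Local Notation U := (vup o upn).
Local Notation orient := (orient px py).
Local Notation slope := (slope px py).

Definition up u : bool :=
  let b := if (val u.2).+1 < n then o (val u.2).+1 else upn in
  if u.1 then ~~ b else b.

Lemma up_neg u : up (negl u) = ~~ up u.
Proof. by case: u => [[] i]; rewrite /up /= ?negbK. Qed.

Lemma upE (i : 'I_n) : (val i).+1 < n -> up (false, i) = o (val i).+1.
Proof. by move=> h; rewrite /up /= h. Qed.

Lemma up_vup u x : lab u = lab x -> up u = U x.
Proof.
case: u x => [bu i] [bx j]; rewrite /lab /up /vup /= => h.
have -> : val i = val j by move: h; case: bu; case: bx => /=; clear; lia.
by have -> : bu = bx by move: h; case: bu; case: bx => //=; clear; lia.
Qed.

#[local] Opaque up pd pu.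

Lemma vlt x y : (lab x < lab y)%R -> (px x < px y)%R.
Proof. exact: px_lt. Qed.

Lemma label_of x : (- Posz n.+1 < lab x < Posz n.+1)%R ->
  exists u, lab u = lab x /\ up u = U x.
Proof.
move=> h; have [|u uE] := @lab_ex n (lab x) (lab_neq0 x); first by move: h; clear; lia.
by exists u; split => //; apply: up_vup.
Qed.

Lemma inner_val x : (- Posz n.+1 < lab x < Posz n.+1)%R -> val x.2 < n.
Proof. by case: x => [[] i]; rewrite /lab /=; clear; lia. Qed.

Lemma vnegK : involutive (@vneg n).
Proof. exact: (@neglK n.+1). Qed.

Lemma vneg_U x : U (vneg x) = ~~ U x.
Proof. by case: x => [[] i]; rewrite /vup /= ?negbK. Qed.

Lemma vneg_lab x : lab (vneg x) = (- lab x)%R.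
Proof. exact: lab_neg. Qed.

Local Open Scope ring_scope.

Lemma orientE a b c : orient a b c =
  (px b - px a) * (py c - py a) - (py b - py a) * (px c - px a).
Proof. by []. Qed.

Lemma not_in_tri a b c d : uniq [:: a; b; c; d] ->
  [&& 0 <= orient a b d, 0 <= orient b c d & 0 <= orient c a d] = false /\
  [&& orient a b d <= 0, orient b c d <= 0 & orient c a d <= 0] = false.
Proof.
move=> /convex; rewrite /in_closed_tri negb_or -!andbA => /andP[/negbTE h1 /negbTE h2].
by rewrite h1 h2.
Qed.

Lemma uniq_lab (a b c d : V) : lab a != lab b -> lab a != lab c -> lab a != lab d ->
  lab b != lab c -> lab b != lab d -> lab c != lab d -> uniq [:: a; b; c; d].
Proof.
by rewrite -!lab_eq /= !inE => /negbTE -> /negbTE -> /negbTE -> /negbTE -> /negbTE -> /negbTE ->.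
Qed.

(** Were c on or above the line ab, it would be higher than b, and b would lie in the triangle
    formed by c and the two extreme vertices. The case where c is itself extreme is computed
    directly. *)
Lemma orient_left_up a b c : lab a = - Posz n.+1 -> (lab a < lab b < lab c)%R ->
  0 < py b -> orient a b c < 0.
Proof.
move=> aE /andP[ab bc] yb; rewrite ltNge; apply/negP => h.
have ya : py a = 0 by apply: py_end; move: aE; rewrite /lab; case: (a.1) => /=; clear; lia.
have xab := vlt ab; have xbc := vlt bc.
have [e eE] : exists e : V, lab e = Posz n.+1 by apply: lab_ex; clear; lia.
have ye : py e = 0 by apply: py_end; move: eE; rewrite /lab; case: (e.1) => /=; clear; lia.
rewrite orientE ya in h.
case: (eqVneq (lab c) (Posz n.+1)) => [cE|cne].
  have yc : py c = 0 by apply: py_end; move: cE; rewrite /lab; case: (c.1) => /=; clear; lia.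
  have : 0 < py b * (px c - px a) by apply: mulr_gt0 => //; lra.
  by rewrite yc in h; lra.
have ce : lab c < lab e by rewrite eE; have := lab_bound c; move: cne; clear; lia.
have xce := vlt ce.
have ycb : py b < py c.
  rewrite ltNge; apply/negP => ycb.
  have : (px b - px a) * py c <= (px b - px a) * py b by rewrite ler_pM2l //; lra.
  have : (px b - px a) * py b < (px c - px a) * py b by rewrite ltr_pM2r //; lra.
  by lra.
have [] := @not_in_tri a e c b.
  by apply: uniq_lab; move: ab bc ce; clear; lia.
rewrite !orientE ya ye => /negP W _; apply: W; apply/and3P; split.
- have : 0 < (px e - px a) * py b by apply: mulr_gt0 => //; lra.
  by lra.
- have : (px e - px c) * py b <= (px e - px b) * py c by apply: ler_pM; lra.
  by lra.
by lra.
Qed.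

(** Otherwise b would lie in the triangle of a, c and the leftmost vertex. *)
Lemma orient_up a b c : (lab a < lab b < lab c)%R -> U b -> orient a b c < 0.
Proof.
move=> /andP[ab bc] ub.
have yb : 0 < py b.
  rewrite py_up //; apply: inner_val; have := lab_bound a; have := lab_bound c.
  by move: ab bc; clear; lia.
have [e eE] : exists e : V, lab e = - Posz n.+1 by apply: lab_ex; clear; lia.
have eb : lab e < lab b by rewrite eE; have := lab_bound a; move: ab; clear; lia.
case: (eqVneq (lab a) (lab e)) => [aE|ane].
  by apply: orient_left_up; rewrite ?ab ?bc // aE.
have ea : lab e < lab a by rewrite eE in ane *; have := lab_bound a; move: ane; clear; lia.
have h1 : orient e b c < 0 by apply: orient_left_up; rewrite ?eb ?bc.
rewrite ltNge; apply/negP => h2.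
have xab := vlt ab; have xbc := vlt bc; have xea := vlt ea.
have h3 : orient e a b <= 0.
  rewrite leNgt; apply/negP => h3.
  (* The linear relation between the three vectors from b, in the x-coordinate. *)
  have E : orient e a b * (px c - px b) = orient a b c * (px e - px b) - orient e b c * (px a - px b).
    by rewrite !orientE; ring.
  have : 0 < orient e a b * (px c - px b) by apply: mulr_gt0 => //; lra.
  have : orient a b c * (px e - px b) <= 0 by apply: mulr_ge0_le0 => //; lra.
  have : 0 < orient e b c * (px a - px b) by rewrite nmulr_rgt0 //; lra.
  by lra.
have [] := @not_in_tri e a c b.
  by apply: uniq_lab; move: ab bc ea; clear; lia.
move=> _ /negP W; apply: W; apply/and3P; split => //.
  by move: h2; rewrite !orientE; lra.
by move: h1; rewrite !orientE; lra.
Qed.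

Lemma orient_neg a b c : orient (vneg a) (vneg b) (vneg c) = orient a b c.
Proof.
rewrite !orientE; have [-> ->] := pneg a; have [-> ->] := pneg b; have [-> ->] := pneg c.
ring.
Qed.

Lemma orient_down a b c : (lab a < lab b < lab c)%R -> ~~ U b -> 0 < orient a b c.
Proof.
move=> abc ub; have := @orient_up (vneg c) (vneg b) (vneg a).
rewrite !vneg_lab vneg_U ub orient_neg => /(_ _ isT) h.
have {}h : orient c b a < 0 by apply: h; move: abc; clear; lia.
by move: h; rewrite !orientE; lra.
Qed.

(** The strict side of the line pq on which z lies, read off from labels; [orient_sign] justifies
    it. *)
Definition above p q z : bool :=
  [|| (lab p < lab z < lab q) && U z, (lab z < lab p) && ~~ U p | (lab q < lab z) && ~~ U q].

Definition below p q z : bool :=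
  [|| (lab p < lab z < lab q) && ~~ U z, (lab z < lab p) && U p | (lab q < lab z) && U q].

Lemma orient_sign p q z : lab p < lab q ->
  ((0 < orient p q z) = above p q z) * ((orient p q z < 0) = below p q z).
Proof.
move=> pq; rewrite /above /below.
have rot a b c : orient b c a = orient a b c by rewrite !orientE; ring.
have swap a b c : orient b a c = - orient a b c by rewrite !orientE; ring.
have sgn (b : bool) (t : R) : (b -> t < 0) -> (~~ b -> 0 < t) -> (0 < t) = ~~ b /\ (t < 0) = b.
  case: b => h1 h2 /=; first by have := h1 isT; split; [apply/negbTE|]; lra.
  by have := h2 isT; split; [|apply/negbTE]; lra.
case: (ltgtP (lab z) (lab p)) => [zp|pz|/lab_inj zp].
- have [] := @sgn (U p) (orient z p q).
  + by apply: orient_up; rewrite zp.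
  + by apply: orient_down; rewrite zp.
  rewrite (rot z p q) => -> ->; have -> : (lab q < lab z) = false by move: pq zp; clear; lia.
  by rewrite /= !orbF.
- case: (ltgtP (lab z) (lab q)) => [zq|qz|/lab_inj zq].
  + have [] := @sgn (U z) (orient p z q).
    * by apply: orient_up; rewrite pz.
    * by apply: orient_down; rewrite pz.
    have -> : orient p q z = - orient p z q by rewrite !orientE; ring.
    by rewrite oppr_gt0 oppr_lt0 => -> ->; rewrite /= !orbF.
  + have [] := @sgn (U q) (orient p q z).
    * by apply: orient_up; rewrite pq.
    * by apply: orient_down; rewrite pq.
    by move=> -> ->.
  have -> : orient p q z = 0 by rewrite zq orientE; ring.
  by rewrite zq !ltxx /=; move: (U q) (U p) pq; clear => uq up0 pq; split; lia.
have -> : orient p q z = 0 by rewrite zp orientE; ring.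
by rewrite zp !ltxx /=; move: (U q) (U p) pq; clear => uq up0 pq; split; lia.
Qed.

Lemma vertex_up x y : lab x = lab y -> U x = U y.
Proof. by move/lab_inj ->. Qed.

Lemma above_below p q z : lab p < lab q -> z != p -> z != q -> above p q z = ~~ below p q z.
Proof. by rewrite !lab_eq /above /below; move: (U p) (U q) (U z); clear; lia. Qed.

Lemma below_ends p q z : lab p < lab q -> (z == p) || (z == q) ->
  (above p q z = false) * (below p q z = false).
Proof. by rewrite !lab_eq /above /below => h1 h2; split; move: (U p) (U q) (U z) h1 h2; clear; lia. Qed.

Lemma end_label p u : lab u = lab p -> - Posz n.+1 < lab p < Posz n.+1.
Proof. by move <-; have := lab_bound u; clear; lia. Qed.

Lemma label_vertex u : exists z : V, lab z = lab u.
Proof. by apply: lab_ex; [exact: lab_neq0 | have := lab_bound u; clear; lia]. Qed.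

Lemma extreme_vertices : exists y z : V, lab y = - Posz n.+1 /\ lab z = Posz n.+1.
Proof.
have [y yE] : exists y : V, lab y = - Posz n.+1 by apply: lab_ex; clear; lia.
have [z zE] : exists z : V, lab z = Posz n.+1 by apply: lab_ex; clear; lia.
by exists y, z.
Qed.

(** An up end of pq puts the extreme vertex beyond it below the line, and a down vertex within the
    span is below as well. With the dual lemma, the polygon edges are the pairs that are not
    [pdiag]. *)
Lemma below_inA p q : lab p < lab q -> [exists z, below p q z] = [exists u, inA up p q u].
Proof.
move=> pq; have [y [e [yE eE]]] := extreme_vertices.
have := lab_bound p; have := lab_bound q => bq bp.
apply/existsP/existsP => [[z]|[u]]; rewrite /below /inA.
  case/or3P => /andP[hz uz].
  - have [|u [uE uU]] := @label_of z; first by move: bp bq hz; clear; lia.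
    by exists u; rewrite uE uU uz hz orbT.
  - have [|u [uE uU]] := @label_of p; first by have := lab_bound z; move: bp bq hz pq; clear; lia.
    by exists u; rewrite uE uU uz eqxx.
  - have [|u [uE uU]] := @label_of q; first by have := lab_bound z; move: bp bq hz pq; clear; lia.
    by exists u; rewrite uE uU uz eqxx orbT.
case/orP => /andP[uu].
  case/orP => /eqP uE; have := end_label uE; rewrite -(up_vup uE) uu => hu.
    by exists y; rewrite yE andbT; move: hu; clear; lia.
  by exists e; rewrite eE andbT; move: hu; clear; lia.
move=> hu; have [z zE] := label_vertex u.
by exists z; rewrite -(up_vup (esym zE)) (negbTE uu) zE hu.
Qed.

Lemma above_inB p q : lab p < lab q -> [exists z, above p q z] = [exists u, inB up p q u].
Proof.
move=> pq; have [y [e [yE eE]]] := extreme_vertices.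
have := lab_bound p; have := lab_bound q => bq bp.
apply/existsP/existsP => [[z]|[u]]; rewrite /above /inB.
  case/or3P => /andP[hz uz].
  - have [|u [uE uU]] := @label_of z; first by move: bp bq hz; clear; lia.
    by exists u; rewrite uE uU uz hz orbT.
  - have [|u [uE uU]] := @label_of p; first by have := lab_bound z; move: bp bq hz pq; clear; lia.
    by exists u; rewrite uE uU uz eqxx.
  - have [|u [uE uU]] := @label_of q; first by have := lab_bound z; move: bp bq hz pq; clear; lia.
    by exists u; rewrite uE uU uz eqxx orbT.
case/orP => /andP[uu].
  case/orP => /eqP uE; have := end_label uE; rewrite -(up_vup uE) (negbTE uu) => hu.
    by exists y; rewrite yE andbT; move: hu; clear; lia.
  by exists e; rewrite eE andbT; move: hu; clear; lia.
move=> hu; have [z zE] := label_vertex u.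
by exists z; rewrite -(up_vup (esym zE)) uu zE hu.
Qed.

Lemma pedge_pdiag p q : lab p < lab q -> pedge px py p q = ~~ pdiag up p q.
Proof.
move=> pq; have npq : p != q by rewrite lab_eq; move: pq; clear; lia.
rewrite /pedge /pdiag pq npq -below_inA // -above_inB //= negb_and !negb_exists.
congr orb; apply: eq_forallb => z;
  case: (boolP ((z == p) || (z == q))) => [h|]; rewrite ?(below_ends pq h) -?negb_or ?h //.
- by rewrite negb_or => /andP[zp zq]; rewrite zp zq orient_sign // above_below.
- by rewrite negb_or => /andP[zp zq]; rewrite zp zq orient_sign // above_below // negbK.
Qed.

Lemma orient_swap a b c : orient b a c = - orient a b c.
Proof. by rewrite !orientE; ring. Qed.

Lemma pedgeC p q : pedge px py p q = pedge px py q p.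
Proof.
rewrite /pedge eq_sym orbC; congr andb; congr orb; apply: eq_forallb => z;
  by rewrite andbC orient_swap ?oppr_gt0 ?oppr_lt0.
Qed.

Lemma is_diagP D : is_diag px py D <-> exists p q, D = [set p; q] /\ pdiag up p q.
Proof.
split=> [/existsP[a /existsP[b /and3P[ab ne /eqP ->]]]|[p [q [-> d]]]].
  case: (ltgtP (lab a) (lab b)) => [h|h|/lab_inj e]; last by rewrite e eqxx in ab.
    by exists a, b; split; rewrite -1?[pdiag _ _ _]negbK -?pedge_pdiag.
  by exists b, a; split; rewrite 1?setUC -1?[pdiag _ _ _]negbK -?pedge_pdiag // -pedgeC.
apply/existsP; exists p; apply/existsP; exists q; have pq := pdiag_lt d.
by rewrite eqxx pedge_pdiag // d lab_eq lt_eqF.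
Qed.

Lemma mul_neg (a b : R) : (a * b < 0) = (a < 0) && (0 < b) || (0 < a) && (b < 0).
Proof.
case: (ltgtP a 0) => [ha|ha|->] /=; last by rewrite mul0r ltxx.
  by rewrite orbF nmulr_rlt0.
by rewrite pmulr_rlt0.
Qed.

Lemma crossingC1 a b c d : crossing px py b a c d = crossing px py a b c d.
Proof.
by rewrite /crossing orient_swap (orient_swap a b d) mulrNN (mulrC (orient c d b)).
Qed.

Lemma crossingC2 a b c d : crossing px py a b d c = crossing px py a b c d.
Proof.
by rewrite /crossing (orient_swap c d a) (orient_swap c d b) mulrNN (mulrC (orient a b d)).
Qed.

Definition inAv p q z : bool :=
  U z && ((lab z == lab p) || (lab z == lab q)) || ~~ U z && (lab p < lab z < lab q).

Definition inBv p q z : bool :=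
  ~~ U z && ((lab z == lab p) || (lab z == lab q)) || U z && (lab p < lab z < lab q).

Lemma inAv_label p q z u : lab u = lab z -> inA up p q u = inAv p q z.
Proof. by move=> e; rewrite /inA /inAv (up_vup e) e. Qed.

Lemma inBv_label p q z u : lab u = lab z -> inB up p q u = inBv p q z.
Proof. by move=> e; rewrite /inB /inBv (up_vup e) e. Qed.

(** Of the four ends of two crossing diagonals, the two in the middle of the label order witness
    [cross]. Lying strictly inside a span, they are not extreme and so correspond to labels. *)
Lemma crossing_cross p q r s : lab p < lab q -> lab r < lab s ->
  crossing px py p q r s <-> cross up p q r s.
Proof.
move=> pq rs; rewrite /crossing !mul_neg !orient_sign // /above /below.
split=> [h|[u [v [Au Bu Bv Av]]]]; last first.
  have [y yE] := label_vertex u; have [z zE] := label_vertex v.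
  move: Au Bu Bv Av; rewrite !(inAv_label _ _ (esym yE)) !(inBv_label _ _ (esym yE)).
  rewrite !(inAv_label _ _ (esym zE)) !(inBv_label _ _ (esym zE)) /inAv /inBv.
  have lk x1 x2 : (lab x1 == lab x2) ==> (U x1 == U x2).
    by apply/implyP => /eqP /vertex_up ->.
  move: (lk y p) (lk y q) (lk y r) (lk y s) (lk z p) (lk z q) (lk z r) (lk z s) pq rs.
  move: (U p) (U q) (U r) (U s) (U y) (U z) (lab p) (lab q) (lab r) (lab s) (lab y) (lab z).
  clear => up uq ur us uy uz p q r s y z.
  case: uy; case: uz; rewrite /= ?orbF; lia.
have key y z : (lab p < lab y < lab q) || (lab r < lab y < lab s) ->
    (lab p < lab z < lab q) || (lab r < lab z < lab s) ->
    inAv p q y -> inBv r s y -> inBv p q z -> inAv r s z -> cross up p q r s.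
  move=> hy hz.
  have inner x : (lab p < lab x < lab q) || (lab r < lab x < lab s) ->
      - Posz n.+1 < lab x < Posz n.+1.
    have := lab_bound p; have := lab_bound q; have := lab_bound r; have := lab_bound s.
    by clear; lia.
  have [u [uE _]] := label_of (inner _ hy); have [v [vE _]] := label_of (inner _ hz).
  by rewrite -!(inAv_label _ _ uE) -!(inBv_label _ _ uE)
    -!(inAv_label _ _ vE) -!(inBv_label _ _ vE) => *; exists u, v.
have : [|| [&& lab p < lab r, lab r < lab q, lab q < lab s & U r == U q],
     [&& lab r < lab p, lab p < lab s, lab s < lab q & U p == U s],
     [&& lab p < lab r, lab s < lab q & U r != U s] |
     [&& lab r < lab p, lab q < lab s & U p != U q]].
  move: h pq rs; clear; move: (U p) (U q) (U r) (U s); lia.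
have fin y z : (lab p < lab y < lab q) || (lab r < lab y < lab s) ->
    (lab p < lab z < lab q) || (lab r < lab z < lab s) ->
    inAv p q y && inBv r s y && inBv p q z && inAv r s z \/
    inAv p q z && inBv r s z && inBv p q y && inAv r s y -> cross up p q r s.
  by move=> h1 h2 [] /andP[/andP[/andP[H1 H2] H3] H4]; [apply: (key y z) | apply: (key z y)].
case/or4P => [/and4P[h1 h2 h3 /eqP e]|/and4P[h1 h2 h3 /eqP e]|/and3P[h1 h2 e]|/and3P[h1 h2 e]];
  [apply: (fin r q)|apply: (fin p s)|apply: (fin r s)|apply: (fin p q)].
all: rewrite ?/inAv ?/inBv; (clear -pq rs h1 h2 h3 e || clear -pq rs h1 h2 e); lia.
Qed.

(** * Slopes of crossing diagonals *)

Lemma slope_num a b c d : px a < px b -> px c < px d ->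
  (slope a b < slope c d) = ((py b - py a) * (px d - px c) < (py d - py c) * (px b - px a)).
Proof.
move=> ab cd; have ab' : 0 < px b - px a by lra. have cd' : 0 < px d - px c by lra.
by rewrite /Defs.slope ltr_pdivrMr // mulrAC ltr_pdivlMr.
Qed.

Lemma slope_up x y z : lab x < lab y < lab z -> U y ->
  slope y z < slope x z /\ slope x z < slope x y.
Proof.
move=> h uy; have := orient_up h uy; case/andP: h => /vlt xy /vlt yz.
by rewrite !slope_num ?orientE; try lra; split; nra.
Qed.

Lemma slope_down x y z : lab x < lab y < lab z -> ~~ U y ->
  slope x z < slope y z /\ slope x y < slope x z.
Proof.
move=> h uy; have := orient_down h uy; case/andP: h => /vlt xy /vlt yz.
by rewrite !slope_num ?orientE; try lra; split; nra.
Qed.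

Lemma slopeC a b : slope a b = slope b a.
Proof. by rewrite /Defs.slope -(opprB (py a)) -(opprB (px a)) invrN mulrNN. Qed.

Lemma slope_neg a b : slope (vneg a) (vneg b) = slope a b.
Proof.
rewrite /Defs.slope; have [-> ->] := pneg a; have [-> ->] := pneg b.
by rewrite -!opprD invrN mulrNN.
Qed.

(** The vertices of u and v are the two middle ends. The slopes are compared through a third chord,
    which joins an end of pq to an end of rs. *)
Lemma slope_lt p q r s u v : lab p < lab q -> lab r < lab s ->
  inA up p q u -> inB up r s u -> inB up p q v -> inA up r s v -> lab u < lab v ->
  slope p q < slope r s.
Proof.
move=> pq rs Au Bu Bv Av uv.
have [y yE] := label_vertex u; have [z zE] := label_vertex v.
move: Au Bu Bv Av; rewrite !(inAv_label _ _ (esym yE)) !(inBv_label _ _ (esym yE)).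
rewrite !(inAv_label _ _ (esym zE)) !(inBv_label _ _ (esym zE)) /inAv /inBv.
rewrite -yE -zE in uv.
have ends (e x1 x2 : V) : (lab e == lab x1) || (lab e == lab x2) -> e = x1 \/ e = x2.
  by case/orP => /eqP/lab_inj; auto.
case: (boolP (U y)) => uy; case: (boolP (U z)) => uz; rewrite /= ?orbF.
- move=> /ends ey hy hz /ends ez.
  have ? : y = p by case: ey => // e; subst y; move: uv hz; clear; lia.
  have ? : z = s by case: ez => // e; subst z; move: uv hy; clear; lia.
  subst y z; have [] := @slope_up p s q; rewrite ?hz // => _ h1.
  have [] := @slope_up r p s; rewrite ?hy // => h2 _.
  exact: lt_trans h1 h2.
- move=> /ends ey hy /ends ez hz.
  have ? : y = p by case: ey => // e; subst y; case: ez => e; subst z; move: uv pq; clear; lia.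
  have ? : z = q by case: ez => // e; subst z y; move: uv; clear; lia.
  subst y z; have [|//|h1 _] := @slope_up r p q; first by move: hy pq; clear; lia.
  have [|//|_ h2] := @slope_down r q s; first by move: hz rs; clear; lia.
  exact: lt_trans h1 h2.
- move=> hy /ends ey hz /ends ez.
  have ? : y = r by case: ey => // e; subst y; case: ez => e; subst z; move: uv rs; clear; lia.
  have ? : z = s by case: ez => // e; subst z y; move: uv; clear; lia.
  subst y z; have [|//|_ h1] := @slope_up p s q; first by move: hz pq; clear; lia.
  have [|//|h2 _] := @slope_down p r s; first by move: hy rs; clear; lia.
  exact: lt_trans h1 h2.
move=> hy /ends ey /ends ez hz.
have ? : y = r by case: ey => // e; subst y; move: uv hz; clear; lia.
have ? : z = q by case: ez => // e; subst z; move: uv hy; clear; lia.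
subst y z; have [] := @slope_down p r q; rewrite ?hy // => h1 _.
have [] := @slope_down r q s; rewrite ?hz // => _ h2.
exact: lt_trans h1 h2.
Qed.

Lemma is_diameterP p q : lab p < lab q -> is_diameter [set p; q] = (p == negl q).
Proof.
move=> pq; apply/existsP/eqP => [[a /eqP e]|->].
  have : p \in [set a; vneg a] by rewrite -e !inE eqxx.
  have : q \in [set a; vneg a] by rewrite -e !inE eqxx orbT.
  rewrite !inE => /orP[] /eqP qa /orP[] /eqP pa; subst p q; rewrite ?ltxx // in pq *.
  by rewrite /negl /vneg /= negbK; case: (a).
by exists q; rewrite setUC.
Qed.

Lemma crossing_lt a b c d : crossing px py a b c d ->
  exists p q r s, [/\ [set a; b] = [set p; q], [set c; d] = [set r; s],
    lab p < lab q, lab r < lab s & crossing px py p q r s].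
Proof.
move=> h; have nab : lab a != lab b.
  apply: contraTneq h => /lab_inj <-; rewrite /crossing !orientE; apply/negP => /andP[h _].
  by move: h; rewrite (_ : _ * _ = 0) ?ltxx //; ring.
have ncd : lab c != lab d.
  apply: contraTneq h => /lab_inj <-; rewrite /crossing !orientE; apply/negP => /andP[_ h].
  by move: h; rewrite (_ : _ * _ = 0) ?ltxx //; ring.
case: (ltgtP (lab a) (lab b)) nab => // ab _; case: (ltgtP (lab c) (lab d)) ncd => // cd _.
- by exists a, b, c, d.
- by exists a, b, d, c; rewrite crossingC2; split; rewrite // setUC.
- by exists b, a, c, d; rewrite crossingC1; split; rewrite // setUC.
by exists b, a, d, c; rewrite crossingC1 crossingC2; split; rewrite // setUC.
Qed.

(** * Triangulations and the flip order *)

Lemma dcross_cross p q r s : lab p < lab q -> lab r < lab s ->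
  dcross px py [set p; q] [set r; s] <-> cross up p q r s.
Proof.
move=> pq rs; rewrite -crossing_cross //; split=> [|h]; last first.
  apply/existsP; exists p; apply/existsP; exists q; apply/existsP; exists r.
  by apply/existsP; exists s; rewrite !eqxx.
move=> /existsP[a /existsP[b /existsP[c /existsP[d /and3P[/eqP e1 /eqP e2 h]]]]].
have [p' [q' [r' [s' [E1 E2 pq' rs' h']]]]] := crossing_lt h.
have [-> ->] : p = p' /\ q = q' by apply: pair_inj => //; rewrite e1.
by have [-> ->] : r = r' /\ s = s' by apply: pair_inj => //; rewrite e2.
Qed.

Lemma is_triangP T : is_triang px py T <-> noncrossing_family up T /\ maximal_family up T.
Proof.
split=> [/and3P[/forallP h1 /forallP h2 /forallP h3]|[[h1 h2] h3]].
  have dT D : D \in T -> exists p q, D = [set p; q] /\ pdiag up p q.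
    by move=> hD; apply/is_diagP; move: (h1 D); rewrite hD.
  split; first split=> // p q r s d d' hD hE.
    move/(dcross_cross (pdiag_lt d) (pdiag_lt d')); apply/negP.
    by have := h2 [set p; q]; rewrite hD => /forallP /(_ [set r; s]); rewrite hE.
  move=> p q d nT; have /is_diagP D : exists p0 q0, [set p; q] = [set p0; q0] /\ pdiag up p0 q0.
    by exists p, q.
  have := h3 [set p; q]; rewrite D nT => /existsP[E /andP[hE]].
  have [r [s [eE d']]] := dT _ hE; move: hE; rewrite eE => hE /(dcross_cross (pdiag_lt d) (pdiag_lt d')).
  by exists r, s.
apply/and3P; split.
- by apply/forallP => D; apply/implyP => /h1 h; apply/is_diagP.
- apply/forallP => D; apply/implyP => hD; apply/forallP => E; apply/implyP => hE.
  have [p [q [eD d]]] := h1 _ hD; have [r [s [eE d']]] := h1 _ hE; subst D E.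
  by apply/negP => /(dcross_cross (pdiag_lt d) (pdiag_lt d')); apply: h2.
apply/forallP => D; apply/implyP => /andP[/is_diagP[p [q [-> d]]] /(h3 _ _ d)].
case=> r [s [d' hE cr]]; apply/existsP; exists [set r; s]; rewrite hE.
exact/(dcross_cross (pdiag_lt d) (pdiag_lt d')).
Qed.

Lemma cs_triangP T : cs_triang px py T <->
  [/\ noncrossing_family up T, maximal_family up T & centrally_symmetric T].
Proof.
have invol (D : {set V}) : (@vneg n) @: ((@vneg n) @: D) = D.
  by rewrite -imset_comp -[RHS]imset_id; apply: eq_imset => x; exact: vnegK.
split=> [/andP[/is_triangP[h1 h2] /eqP e]|[h1 h2 h3]].
  by split=> // D hD; rewrite -[in X in _ \in X]e; apply: imset_f.
apply/andP; split; first by apply/is_triangP.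
apply/eqP/setP => D; apply/imsetP/idP => [[E hE ->]|hD]; first exact: h3.
by exists ((@vneg n) @: D); [apply: h3 | rewrite invol].
Qed.

Local Close Scope ring_scope.

Implicit Types (w : {perm L}) (T : {set {set V}}).

Lemma diags_triang w : is_triang px py (diags up w).
Proof. by apply/is_triangP; split; [apply: diags_noncrossing | apply: diags_maximal]. Qed.

Lemma diags_cs w : w \in signedperms n -> cs_triang px py (diags up w).
Proof.
move=> sw; apply/cs_triangP; split; [exact: diags_noncrossing | exact: diags_maximal |].
by move=> D; apply: diags_neg => //; apply: up_neg.
Qed.

Lemma cs_diags T : cs_triang px py T -> exists2 w, w \in signedperms n & diags up w = T.
Proof. by case/cs_triangP => *; apply: diags_surj => //; apply: up_neg. Qed.

Lemma cov_upflip (x y : {perm L}) a c : cov x y a c -> diags up x <> diags up y ->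
  upflip px py (diags up x) (diags up y).
Proof.
move=> cv ne; case: (cv) => sx sy ac _ _.
have [p [q [r [s [[d d' hx hy] [[Aa Bc Ac Ba] flip]]]]]] := cov_cflip up_neg cv ne.
have [pq rs] := (pdiag_lt d, pdiag_lt d').
have sl : (slope p q < slope r s)%R by apply: (slope_lt pq rs Aa Ba Bc Ac ac).
split; [exact: diags_cs | split; first exact: diags_cs].
exists p, q, r, s; split=> //; rewrite is_diameterP //.
have dfl (z z' : {perm L}) p' q' r' s' : cflip (diags up z) p' q' r' s' (diags up z') ->
    dflip px py (diags up z) p' q' r' s' (diags up z').
  by case=> h1 e h3; rewrite /dflip h1 h3 diags_triang -e eqxx.
have dflE T T1 p' q' r' s' : dflip px py T q' p' s' r' T1 = dflip px py T p' q' r' s' T1.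
  by rewrite /dflip (setUC [set q']) (setUC [set s']).
case: flip => [[e fl]|[e [y1 [fl1 fl2]]]]; [left | right].
  by rewrite e eqxx; split => //; have := dfl _ _ _ _ _ _ fl; rewrite e.
split; first exact/eqP.
exists (diags up y1); rewrite !slope_neg; split; [exact: dfl | split => //].
by rewrite -dflE; apply: dfl.
Qed.

Lemma wle_tri_le (x y : {perm L}) : x \in signedperms n -> y \in signedperms n -> wle x y ->
  tri_le px py (diags up x) (diags up y).
Proof.
move=> sx; have [N leN] := ubnP #|ivs y|; elim: N y leN => // N IH y leN sy xy.
case: (eqVneq x y) => [->|nxy]; first exact: rt_refl.
have [y' [a [c [cv xy']]]] := chain_down sx sy xy nxy.
have sy' : y' \in signedperms n by case: cv.
have lt : #|ivs y'| < N.
  rewrite ltnS in leN; apply: leq_trans leN; apply: proper_card; apply/properP; split; first exact: cov_wle cv.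
  by exists (a, c); [apply: cov_in cv | apply: cov_notin cv].
apply: (rt_trans _ _ _ _ _ (IH _ lt sy' xy')).
case: (eqVneq (diags up y') (diags up y)) => [->|/eqP ne]; first exact: rt_refl.
by apply: rt_step; apply: cov_upflip cv ne.
Qed.

Lemma slope_set a b c d : [set a; b] = [set c; d] -> a != b -> slope a b = slope c d.
Proof.
move=> e ab; have : a \in [set c; d] by rewrite -e !inE eqxx.
have : b \in [set c; d] by rewrite -e !inE eqxx orbT.
rewrite !inE => /orP[] /eqP eb /orP[] /eqP ea; subst a b; rewrite ?eqxx // in ab *.
exact: slopeC.
Qed.

(** A common form for both kinds of flip, recording what is lost and gained up to mirror image. *)
Lemma upflip_diff T T' : upflip px py T T' -> exists a b c d,
  [/\ (slope a b < slope c d)%R, [set a; b] \in T /\ [set a; b] \notin T',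
      forall D, D \in T -> D \notin T' -> D = [set a; b] \/ D = [set vneg a; vneg b] &
      forall E, E \in T' -> E \notin T -> E = [set c; d] \/ E = [set vneg c; vneg d]].
Proof.
case=> csT [_ [a [b [c [d [sl flip]]]]]]; exists a, b, c, d.
have ab : [set a; b] \in T -> a != b.
  case/andP: csT => /is_triangP[[h _] _] _ /h [p [q [e /pdiag_lt pq]]].
  apply: contraTneq pq => ab; move: e; rewrite ab setUid => e.
  have : p \in [set b] by rewrite e !inE eqxx.
  have : q \in [set b] by rewrite e !inE eqxx orbT.
  by rewrite !inE => /eqP -> /eqP ->; rewrite ltxx.
case: flip => [[_ /and4P[h1 /eqP -> h3 _]]|[_ [T1 [/and4P[h1 /eqP e1 h3 _]]]]].
  split=> // [|D hD|E].
  - by split=> //; rewrite !inE eqxx /= eq_sym.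
  - by rewrite !inE hD andbT negb_or negbK => /andP[/eqP]; left.
  - by rewrite !inE => /orP[/andP[_ ->]//|/eqP]; left.
case=> /and4P[h4 /eqP -> h5 _] _; rewrite e1; split=> // [|D hD|E].
- split=> //; rewrite !inE eqxx /= [_ == [set c; d]]eq_sym (negbTE h3) andbF /=.
  (* The mirror flip cannot restore ab, because the diagonal it adds has the slope of cd. *)
  apply/negP => /eqP /slope_set -/(_ (ab h1)); rewrite slope_neg => e.
  by rewrite e ltxx in sl.
- rewrite !inE hD andbT negb_or negb_and negbK => /andP[/orP[/eqP ->|h] _]; first by right.
  by move: h; rewrite negb_or negbK => /andP[/eqP]; left.
rewrite !inE => /orP[/andP[_ /orP[/andP[_ ->]//|/eqP]]|/eqP]; [by left | by right].
Qed.

(** A lost and a gained diagonal have the two slopes of the flip, so wherever they cross the slopes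
    determine the order of the middle labels. *)
Lemma upflip_wle (v w : {perm L}) : v \in signedperms n -> w \in signedperms n ->
  upflip px py (diags up v) (diags up w) -> wle (pd up v) (pd up w).
Proof.
move=> sv sw /upflip_diff[a [b [c [d [sl _ hD hE]]]]].
have -> : pd up v = pd up (pd up v) by rewrite (pd_idem up_neg).
apply: (pd_mono up_neg) => //; first exact: (pd_signed up_neg).
apply: (pd_le_of_cross up_neg) => // p q r s u z dp vp wp dr wr Au Bu Bz Az.
have [pq rs] := (pdiag_lt dp, pdiag_lt dr).
have npq : p != q by rewrite lab_eq lt_eqF.
have nrs : r != s by rewrite lab_eq lt_eqF.
have vr : ~~ compat up v r s.
  by apply/negP => vr; apply: (compat_noncross vp vr); exists u, z.
have epq : slope p q = slope a b.
  have [||/slope_set ->|/slope_set ->] // := hD [set p; q];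
    by rewrite ?in_diags ?dp //= slope_neg.
have ers : slope r s = slope c d.
  have [||/slope_set ->|/slope_set ->] // := hE [set r; s];
    by rewrite ?in_diags ?dr //= slope_neg.
case: (ltgtP (lab u) (lab z)) => // [zu|/lab_inj uz].
  have := slope_lt rs pq Az Bz Bu Au zu; rewrite epq ers => h.
  by have := lt_trans h sl; rewrite ltxx.
by move: Bz; rewrite -uz inAB.
Qed.

Lemma tri_le_cs T T' : tri_le px py T T' -> cs_triang px py T -> cs_triang px py T'.
Proof. by elim=> [T1 T2 [_ []]||] //; auto. Qed.

Lemma diags_le (v w : {perm L}) : v \in signedperms n -> w \in signedperms n ->
  tri_le px py (diags up v) (diags up w) <-> wle (pd up v) (pd up w).
Proof.
move=> sv sw; split=> [h|h]; last first.
  by have := wle_tri_le (pd_signed up_neg sv) (pd_signed up_neg sw) h; rewrite !(diags_pd up_neg).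
have key T T' : tri_le px py T T' -> forall v : {perm L},
    v \in signedperms n -> diags up v = T -> diags up w = T' -> wle (pd up v) (pd up w).
  clear v sv h; move/clos_rt_rt1n_iff; elim=> {T T'}[T|T T1 T2 f12 _ IH] v sv ev ew.
    have /(pd_eq up_neg sv sw) -> : diags up v = diags up w by rewrite ev ew.
    exact: wle_refl.
  have [_ [cs1 _]] := f12; have [z sz ez] := cs_diags cs1.
  apply: wle_trans (IH _ sz ez ew); apply: upflip_wle => //.
  by rewrite ev ez.
exact: (key _ _ h).
Qed.

Lemma upflip_neq T T' : upflip px py T T' -> T <> T'.
Proof. by case/upflip_diff => a [b [c [d [_ [h1 h2] _ _]]]] e; rewrite -e h1 in h2. Qed.

(** The first flip of a chain from T to T' leaves T, so in a cover it already reaches T'. *)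
Lemma tri_cover_upflip T T' : tri_cover px py T T' -> upflip px py T T'.
Proof.
case=> ne [h cov]; move/clos_rt_rt1n_iff: (h) => h'; case: h' ne h cov => [//|U T2 f12 h ne _].
move/clos_rt_rt1n_iff: h => h /(_ U) [||e|<- //] //; first exact: rt_step.
by case: (upflip_neq f12).
Qed.

Lemma diags_neg_iff w p q : w \in signedperms n ->
  ([set vneg p; vneg q] \in diags up w) = ([set p; q] \in diags up w).
Proof.
have h p' q' : w \in signedperms n ->
    [set p'; q'] \in diags up w -> [set vneg p'; vneg q'] \in diags up w.
  by move=> sw /(diags_neg up_neg sw); rewrite imsetU1 imset_set1.
move=> sw; apply/idP/idP; last exact: h.
by move/(h _ _ sw); rewrite !vnegK.
Qed.


Lemma in_diags_pd w p q : w \in signedperms n -> pdiag up p q ->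
  ([set p; q] \in diags up w) = compat up (pd up w) p q.
Proof. by move=> sw d; rewrite -(diags_pd up_neg sw) in_diags ?(pdiag_lt d) ?d. Qed.

(** Compatibility requires some pairs to be inverted and others not to be, so it passes to
    intervals. *)
Lemma compat_between (x y z : {perm L}) p q : wle x y -> wle y z ->
  compat up x p q -> compat up z p q -> compat up y p q.
Proof.
move=> /wleP xy /wleP yz /compatP hx /compatP hz; apply/compatP => e f Ae Bf.
case: (ltgtP (lab e) (lab f)) => [ef|fe|/lab_inj e_f]; last by rewrite e_f in Ae; rewrite (inAB Ae) in Bf.
  rewrite -[bef _ _ _]negbK bef_total; last by rewrite lab_eq lt_eqF.
  by apply/negP => /(yz _ _ ef); rewrite (bef_asym (hz _ _ Ae Bf)).
exact: xy fe (hx _ _ Ae Bf).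
Qed.

(** Take the last step of a chain from [pd v] to [pd w]. It changes the fibre, as [pd w] is a bottom
    element, so it creates a diagonal rs. Up to mirror image, rs is all that w has beyond v, so the
    other diagonals of y belong to v; [force_diag] adds the flipped pq. *)
Lemma upflip_cov (v w : {perm L}) : v \in signedperms n -> w \in signedperms n ->
  upflip px py (diags up v) (diags up w) ->
  exists (y : {perm L}) a c, cov y (pd up w) a c /\ diags up y = diags up v.
Proof.
move=> sv sw flip; have ne := upflip_neq flip; have le := upflip_wle sv sw flip.
have [a0 [b0 [c0 [d0 [_ _ _ new]]]]] := upflip_diff flip.
have [spv spw] := (pd_signed up_neg sv, pd_signed up_neg sw).
have npd : pd up v != pd up w by apply/eqP => /(pd_eq up_neg sv sw).
have [y [a [c [cv xy]]]] := chain_down spv spw le npd.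
exists y, a, c; split=> //; have [sy _ ac yac _] := cv.
have ney : diags up y <> diags up (pd up w).
  rewrite (diags_pd up_neg sw) => /(pd_eq up_neg sy sw) e.
  have := pd_le up_neg sy; rewrite e => /subsetP /(_ _ (cov_in cv)).
  by rewrite (negbTE (cov_notin cv)).
have [p [q [r [s [[dp dr hp hr] [[Aa Bc Ac Ba] fl]]]]]] := cov_cflip up_neg cv ney.
have [pq rs] := (pdiag_lt dp, pdiag_lt dr).
have meet p' q' : pdiag up p' q' -> [set p'; q'] \in diags up v ->
    [set p'; q'] \in diags up w -> [set p'; q'] \in diags up y.
  move=> d; rewrite (in_diags_pd sv d) (in_diags_pd sw d) in_diags ?(pdiag_lt d) // d.
  exact: compat_between xy (cov_wle cv).
have Ew : [set r; s] \in diags up w by rewrite in_diags_pd.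
have Ey : [set r; s] \notin diags up y.
  rewrite in_diags // dr; apply/negP => yr; apply: (compat_noncross hp yr).
  by exists a, c.
have Ev : [set r; s] \notin diags up v.
  by apply: contra Ey => Ev; apply: meet.
have new_y D : D \in diags up w -> D \notin diags up v -> D \notin diags up y.
  have Ey' : [set c0; d0] \notin diags up y.
    by case: (new _ Ew Ev) Ey => ->; rewrite ?diags_neg_iff.
  by move=> Dw Dv; case: (new _ Dw Dv) => ->; rewrite ?diags_neg_iff.
have kept p' q' : pdiag up p' q' -> compat up y p' q' -> [set p'; q'] != [set p; q] ->
    [set p'; q'] != [set negl q; negl p] -> [set p'; q'] \in diags up v.
  move=> d yp n1 n2; have Dy : [set p'; q'] \in diags up y by rewrite in_diags ?(pdiag_lt d) ?d.
  apply: contraT => Dv; have := new_y [set p'; q']; rewrite Dy => /(_ _ Dv); apply.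
  rewrite -(diags_pd up_neg sw).
  case: fl => [[_ [_ -> _]]|[_ [y1 [[_ e1 _] [_ -> _]]]]]; first by rewrite in_setU in_setD1 n1 Dy.
  by rewrite in_setU in_setD1 n2 e1 in_setU in_setD1 n1 Dy.
have vp : compat up (pd up v) p q.
  apply: (force_diag up_neg sy spv yac _ dp hp Aa Bc).
  - by move=> e; apply: (cov_adj cv).
  - move=> p' q' d yp n1 n2; have := kept _ _ d yp n1 n2.
    by rewrite in_diags_pd.
  - apply: contraT; rewrite bef_total; last by rewrite lab_eq lt_eqF.
    by move/wleP: xy => /(_ _ _ ac) h /h; rewrite (bef_asym yac).
have Dv : [set p; q] \in diags up v by rewrite in_diags_pd.
apply: (maximal_family_eq (@diags_maximal _ up y) (@diags_noncrossing _ up v)).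
apply/subsetP => D /diagsP[p' [q' [-> d yp]]].
case: (eqVneq [set p'; q'] [set p; q]) => [-> //|n1].
case: (eqVneq [set p'; q'] [set negl q; negl p]) => [->|n2]; last exact: kept.
by rewrite setUC diags_neg_iff.
Qed.

(** The inversion (a, c) decides where an intermediate z belongs: with it, the top of the fibre of z
    is above [pd w]; without it, [pd z] is below y. *)
Lemma upflip_cover (v w : {perm L}) : v \in signedperms n -> w \in signedperms n ->
  upflip px py (diags up v) (diags up w) -> tri_cover px py (diags up v) (diags up w).
Proof.
move=> sv sw flip; split; [exact: upflip_neq | split; first exact: rt_step].
move=> T vT Tw; have [z sz ez] := cs_diags (tri_le_cs vT (diags_cs sv)); subst T.
move/(diags_le sv sz): vT => vz; move/(diags_le sz sw): Tw => zw.
have [y [a [c [cv ey]]]] := upflip_cov sv sw flip; have [sy _ ac _ _] := cv.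
have [spz spw] := (pd_signed up_neg sz, pd_signed up_neg sw).
have anti (x1 x2 : {perm L}) : x1 \in signedperms n -> x2 \in signedperms n ->
    wle (pd up x1) (pd up x2) -> wle (pd up x2) (pd up x1) -> diags up x1 = diags up x2.
  by move=> s1 s2 h1 h2; apply/(pd_eq up_neg s1 s2); apply: wle_anti.
have epd : pd up y = pd up v by apply/(pd_eq up_neg sy sv).
case: (boolP ((a, c) \in ivs (pd up z))) => h; [right | left].
  apply: (anti _ _ sz sw zw).
  have suz := pu_signed up_neg sz.
  have yz : wle y (pu up z).
    apply: (wle_trans (pu_ge up_neg sy)).
    rewrite (pu_eq up_neg sy (pd_signed up_neg sy)) ?(diags_pd up_neg) // epd.
    rewrite (pu_eq up_neg sz spz) ?(diags_pd up_neg) //.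
    exact: (pu_mono up_neg (pd_signed up_neg sv) spz vz).
  have wz : wle (pd up w) (pu up z).
    apply: (cov_wle_above cv suz yz).
    by apply: (subsetP (wle_trans (pd_le up_neg sz) (pu_ge up_neg sz))).
  have := pd_mono up_neg spw suz wz; rewrite (pd_idem up_neg sw).
  have /(pd_eq up_neg suz sz) -> // : diags up (pu up z) = diags up z.
  exact: (diags_pu up_neg).
apply: (anti _ _ sz sv _ vz); rewrite -epd -(pd_idem up_neg sz).
exact: (pd_mono up_neg spz sy (cov_wle_below cv spz zw h)).
Qed.

End Polygon.

Theorem theorem7p4 (n : nat) (o : nat -> bool) (upn : bool)
    (R : realFieldType) (px py : bool * 'I_n.+1 -> R) :
  2 <= n ->
  (* x-coordinates strictly increasing in -n-1 < ... < -1 < 1 < ... < n+1 *)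
  (forall u v, (vlab u < vlab v)%R -> (px u < px v)%R) ->
  (* central symmetry v_{-i} = - v_i *)
  (forall v, px (vneg v) = (- px v)%R /\ py (vneg v) = (- py v)%R) ->
  (* v_{+-(n+1)} on the x-axis *)
  (forall v : bool * 'I_n.+1, val v.2 = n -> py v = 0%R) ->
  (* v_i above the axis iff i is up *)
  (forall v : bool * 'I_n.+1, val v.2 < n -> (0 < py v)%R = vup o upn v) ->
  (* convex polygon *)
  convex_pos px py ->
  exists f : {perm bool * 'I_n} -> {set {set bool * 'I_n.+1}},
    [/\ (forall w, w \in signedperms n -> cs_triang px py (f w)),
        (forall T, cs_triang px py T -> exists2 w, w \in signedperms n & f w = T),
        (forall v w, v \in signedperms n -> w \in signedperms n ->
            (Theta o v w <-> f v = f w)),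
        (forall v w, v \in signedperms n -> w \in signedperms n ->
            (camb_le o v w <-> tri_le px py (f v) (f w))) &
        (forall T T', cs_triang px py T -> cs_triang px py T' ->
            (upflip px py T T' <-> tri_cover px py T T'))].
Proof.
move=> n2 px_lt pneg py_end py_up convex.
have up_neg := @up_neg n o upn; have upE := @upE n o upn.
exists (diags (up o upn)); split.
- by move=> w; apply: diags_cs.
- by move=> T; apply: cs_diags.
- by move=> v w; apply: ThetaP.
- by move=> v w sv sw; rewrite (camb_leP n2 up_neg upE) // diags_le.
move=> T T' /(cs_diags px_lt pneg py_end py_up convex)[v sv <-].
move=> /(cs_diags px_lt pneg py_end py_up convex)[w sw <-].
by split; [apply: (upflip_cover px_lt pneg py_end py_up convex) |
  apply: (tri_cover_upflip px_lt pneg py_end py_up convex)].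
Qed.
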